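(* Let $n\geq1$, let $R$ be a commutative unitary ring and let $\mathsf{B}_R=R[x_{ij}\mid 1\leq i<j\leq n+1]$. (1) The set of the elements $\mathrm{pf}_T$, with $T$ a standard tableau (of any degree $\geq0$) not containing the empty row, is an $R$-basis of $\mathsf{B}_R$. (2) The ring $\mathsf{B}_R$ is defined by quadratic (but not necessarily homogeneous) relations in the generators $\mathrm{pf}_I$: the kernel of the surjective $R$-algebra homomorphism $\pi:R[t_I]\to\mathsf{B}_R$, $t_I\mapsto\mathrm{pf}_I$ (one variable $t_I$ for each nonempty standard row $I$ in $\{1,\dots,n\}$), is generated as an ideal by its elements of degree at most $2$. (3) For every non standard tableau $T$ with two rows, both standard, we have $\Theta_{\mathrm{pf}}(T)=0$ in $\mathsf{B}_R$, and these equations generate, as an $R$-module, the set of quadratic relations: the elements of degree at most $2$ of $\ker\pi$ are exactly the $R$-linear combinations of the polynomials $\Theta_t(T)\in R[t_I]$.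
   Context: Rows and tableaux. A row is a finite (possibly empty) sequence $I=i_1\cdots i_r$ of integers in $\{1,\dots,n\}$; $|I|=r$; $\varnothing$ is the empty row; $IJ$ is concatenation; set-theoretic notation is applied to rows via their entries. A row is standard if its entries are strictly increasing. For a row $I$ with distinct entries, $I^{\leq}$ is the increasing rearrangement and $\varepsilon(I)$ the sign of the permutation sorting $I$ into $I^\leq$. Order on standard rows: $i_1\cdots i_r\leq j_1\cdots j_s$ if $r\geq s$ and $i_m\leq j_m$ for $1\leq m\leq s$. A tableau of degree $d$ is a sequence $T=(I_1,\dots,I_d)$ of rows with $|I_1|\geq\cdots\geq|I_d|$; it is standard if all rows are standard and $I_1\leq I_2\leq\cdots\leq I_d$ (the empty tableau, $d=0$, is standard). Pfaffians. For an antisymmetric $2m\times2m$ matrix $X=(x_{ij})$, with $\omega_X=\frac12\sum_{i,j}x_{ij}e_i\wedge e_j$, the pfaffian is defined by $\frac1{m!}\omega_X^m=\mathrm{Pf}(X)e_1\wedge\cdots\wedge e_{2m}$; it is a polynomial with integer coefficients in the $x_{ij}$, $i<j$, hence makes sense over any $R$. For a row $I$ let $I^0=I$ if $|I|$ is even and $I^0=I$ with $n+1$ appended at the end if $|I|$ is odd. $\mathrm{pf}_I\in\mathsf{B}_R$ is the pfaffian of the matrix with $(a,b)$ entry $x_{c_ac_b}$, where $I^0=c_1c_2\cdots$ and $(x_{ij})$ is the generic $(n+1)\times(n+1)$ antisymmetric matrix ($x_{ji}=-x_{ij}$, $x_{ii}=0$); $\mathrm{pf}_\varnothing=1$. For a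 tableau $T=(I_1,\dots,I_d)$, $\mathrm{pf}_T=\mathrm{pf}_{I_1}\cdots\mathrm{pf}_{I_d}$ (equal to $1$ for $d=0$). Shuffling polynomials. A non standard tableau $T$ with two standard rows is uniquely written in canonical form $T=\binom{IJ}{HK}$ (first row $IJ$, second row $HK$): for some $r\geq0$, $|I|=r$, $|H|=r+1$, the $m$-th entry of $I$ is $\leq$ the $m$-th entry of $H$ for $1\leq m\leq r$, and the first entry of $J$ is greater than the last entry of $H$. Put $Z_1=I\cap H$, $Z_2=J\cap K$ as increasing rows. Consider the formal expression $$\sum(-1)^{\frac{h(h+1)}2}{|J\setminus K|+h\brack h}_{-1}\varepsilon(H'J')\varepsilon(Z_2K_1')\,x(IJ'K_1')\,x(H'K_2'),\quad h=|H|-|H'|,$$ the sum running over all quadruples $(J',H',K_1',K_2')$ of standard rows with $|H'|\leq|H|$, $H'\sqcup J'=H\sqcup J$, $K_1'\sqcup K_2'=K$, $Z_1\subset H'$, $Z_2\subset J'\cap K_2'$. Here ${m\brack k}_{-1}$ is the value at $q=-1$ of the polynomial ${m\brack k}_q=\frac{(1-q^m)\cdots(1-q^{m-k+1})}{(1-q^k)\cdots(1-q)}$ ($0\leq k\leq m$), an integer. $\Theta_{\mathrm{pf}}(T)\in\mathsf{B}_R$ is obtained by substituting $x(L)\mapsto\mathrm{pf}_L$ (with $x(\varnothing)\mapsto1$), and $\Theta_t(T)\in R[t_I]$ by substituting $x(L)\mapsto\varepsilon(L)\,t_{L^\leq}$ for $L\neq\varnothing$ and $x(\varnothing)\mapsto1$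 (all rows $L$ occurring have distinct entries). *)

(* Defs.v *)
From HB Require Import structures.
From mathcomp Require Import all_boot all_order all_fingroup all_algebra.
From mathcomp Require Import mpoly.
Set Implicit Arguments.
Unset Strict Implicit.
Unset Printing Implicit Defensive.
Import Order.TTheory GRing.Theory Num.Theory.
Local Open Scope ring_scope.

(* Indices are shifted down by one: {1, ..., n} is 'I_n, {1, ..., n+1} is
   'I_n.+1, and the extra index n+1 is ord_max : 'I_n.+1. *)

Section Rows.
Variable n : nat.
Implicit Types I J L : seq 'I_n.

Definition std_row I : bool := sorted ltn (map val I).

Definition row_le I J : bool :=
  (size J <= size I)%N &&
  all (fun p : 'I_n * 'I_n => (p.1 <= p.2)%N) (zip I J).

Definition row_sort L : seq 'I_n := sort (fun i j : 'I_n => (i <= j)%N) L.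

(* For a row with distinct entries exactly one permutation satisfies the
   condition.  If some entry is repeated there is none and the value is 0. *)
Definition eps L : int :=
  if [pick s : 'S_(size L) |
        std_row [seq tnth (in_tuple L) (s k) | k <- enum 'I_(size L)]] is Some s
  then (-1) ^+ s else 0.

Definition is_tableau (T : seq (seq 'I_n)) : bool := sorted geq (map size T).

Definition std_tableau (T : seq (seq 'I_n)) : bool :=
  [&& is_tableau T, all std_row T & sorted row_le T].

Definition nonstd2 (L M : seq 'I_n) : bool :=
  [&& is_tableau [:: L; M], std_row L, std_row M & ~~ std_tableau [:: L; M]].

(* A standard row has at most n entries, so bounded sequences lose nothing and
   provide a finite type. *)
Definition nsrow : finType :=
  {I : n.-bseq 'I_n | std_row I && (I != [::] :> seq 'I_n)}.

Definition nsrow_seq (u : nsrow) : seq 'I_n := val (val u).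

End Rows.

(* The exterior algebra of the free A-module on e_i (i < N), in coordinates:
   u S is the coefficient of e_(i_1) /\ ... /\ e_(i_r) in u, where
   S = {i_1 < ... < i_r}; enum lists a set of ordinals increasingly. *)
Section Exterior.
Variables (A : comNzRingType) (N : nat).
Implicit Types u v : {ffun {set 'I_N} -> A}.

Definition ext_one : {ffun {set 'I_N} -> A} := [ffun S => (S == set0)%:R].

Definition ext_gen (i : 'I_N) : {ffun {set 'I_N} -> A} :=
  [ffun S => (S == [set i])%:R].

Definition ext_mul u v : {ffun {set 'I_N} -> A} :=
  [ffun S : {set 'I_N} => \sum_(T : {set 'I_N} | T \subset S)
     (eps (enum T ++ enum (S :\: T)))%:~R * u T * v (S :\: T)].

Definition ext_exp u (m : nat) : {ffun {set 'I_N} -> A} :=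
  iter m (ext_mul u) ext_one.

End Exterior.

Definition upair (N : nat) : finType :=
  {p : 'I_N * 'I_N | (p.1 < p.2)%N}.

Definition nvars (N : nat) : nat := #|upair N|.

Section GenericMatrix.
Variables (R : comNzRingType) (N : nat).

(* x_ij if i < j, and 0 otherwise *)
Definition xvar (i j : 'I_N) : {mpoly R[nvars N]} :=
  if insub (i, j) is Some p then 'X_(enum_rank (p : upair N)) else 0.

Definition gen_mx : 'M[{mpoly R[nvars N]}]_N :=
  \matrix_(i, j) (xvar i j - xvar j i).

End GenericMatrix.

Section Pfaffian.

Definition omega (k N : nat) (X : 'M[{mpoly rat[k]}]_N) :
    {ffun {set 'I_N} -> {mpoly rat[k]}} :=
  [ffun S => 2%:R^-1 *: \sum_i \sum_j
     X i j * ext_mul (ext_gen _ i) (ext_gen _ j) S].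

(* the coefficient of e_1 /\ ... /\ e_2m in omega^m / m! *)
Definition generic_pfaffian_rat (m : nat) : {mpoly rat[nvars m.*2]} :=
  (m`!%:R)^-1 *: ext_exp (omega (gen_mx rat m.*2)) m setT.

(* All coefficients of generic_pfaffian_rat m are integers; numq reads them
   off. *)
Definition generic_pfaffian (m : nat) : {mpoly int[nvars m.*2]} :=
  map_mpoly numq (generic_pfaffian_rat m).

Definition pfaffian (A : comNzRingType) (m : nat) (X : 'M[A]_(m.*2)) : A :=
  mmap (fun z : int => z%:~R)
       (fun k => let p := val (enum_val k : upair m.*2) in X p.1 p.2)
       (generic_pfaffian m).

End Pfaffian.

Section PfaffianRing.
Variables (R : comNzRingType) (n : nat).

(* the row I^0 *)
Definition even_row (I : seq 'I_n) : seq 'I_n.+1 :=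
  [seq widen_ord (leqnSn n) i | i <- I] ++
  (if odd (size I) then [:: ord_max] else [::]).

Definition pf (I : seq 'I_n) : {mpoly R[nvars n.+1]} :=
  let c := even_row I in
  pfaffian (\matrix_(a < (size c)./2.*2, b < (size c)./2.*2)
              gen_mx R n.+1 (nth ord_max c a) (nth ord_max c b)).

Definition pf_tab (T : seq (seq 'I_n)) : {mpoly R[nvars n.+1]} :=
  \prod_(I <- T) pf I.

Definition ntvars : nat := #|nsrow n|.

Definition pi_pf (p : {mpoly R[ntvars]}) : {mpoly R[nvars n.+1]} :=
  p \mPo [tuple pf (nsrow_seq (enum_val k)) | k < ntvars].

(* t_I for I a nonempty standard row *)
Definition tvar (I : seq 'I_n) : {mpoly R[ntvars]} :=
  if [pick u : nsrow n | nsrow_seq u == I] is Some u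
  then 'X_(enum_rank u) else 0.

Definition t_subst (L : seq 'I_n) : {mpoly R[ntvars]} :=
  if L is [::] then 1 else (eps L)%:~R * tvar (row_sort L).

End PfaffianRing.

Section Shuffling.
Variable n : nat.
Implicit Types I J H K L M : seq 'I_n.

(* The numerator is a multiple of the denominator in Z[q], and the denominator
   has leading coefficient 1 or -1, so %/ is exact here. *)
Definition qbinom (m k : nat) : {poly int} :=
  (\prod_(i < k) (1 - 'X^(m - i))) %/ (\prod_(i < k) (1 - 'X^(k - i))).

(* H', J', K1', K2' are the summation indices.  As H ++ J and K have distinct
   entries, perm_eq expresses that they are disjoint unions. *)
Definition theta_index I J H K (H' J' K1' K2' : seq 'I_n) : bool :=
  let Z1 := [seq i <- I | i \in H] in
  let Z2 := [seq i <- J | i \in K] in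
  [&& [&& std_row H', std_row J', std_row K1' & std_row K2'],
      (size H' <= size H)%N,
      perm_eq (H' ++ J') (H ++ J),
      perm_eq (K1' ++ K2') K,
      Z1 \subset H'
    & (Z2 \subset J') && (Z2 \subset K2')].

Definition theta_coef J H K (H' J' K1' : seq 'I_n) : int :=
  let Z2 := [seq i <- J | i \in K] in
  let JmK := [seq i <- J | i \notin K] in
  let h := (size H - size H')%N in
  (-1) ^+ (h * h.+1)./2 * (qbinom (size JmK + h) h).[-1]
    * eps (H' ++ J') * eps (Z2 ++ K1').

Definition theta_canon (A : comNzRingType) (x : seq 'I_n -> A) I J H K : A :=
  \sum_(H' : n.-bseq 'I_n) \sum_(J' : n.-bseq 'I_n)
  \sum_(K1' : n.-bseq 'I_n) \sum_(K2' : n.-bseq 'I_n |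
        theta_index I J H K H' J' K1' K2')
    (theta_coef J H K H' J' K1')%:~R * x (I ++ J' ++ K1') * x (H' ++ K2').

Definition canonical_form I J H K : bool :=
  [&& size H == (size I).+1,
      all (fun p : 'I_n * 'I_n => (p.1 <= p.2)%N) (zip I H)
    & if (J, rev H) is (j :: _, h :: _) then (h < j)%N else false].

(* the length r of I: the first position m with L_m > M_m *)
Definition canon_pos L M : nat :=
  find (fun p : 'I_n * 'I_n => (p.2 < p.1)%N) (zip L M).

Definition theta (A : comNzRingType) (x : seq 'I_n -> A) L M : A :=
  let r := canon_pos L M in
  theta_canon x (take r L) (drop r L) (take r.+1 M) (drop r.+1 M).

Lemma canonical_formP L M : nonstd2 L M ->
  forall I J H K,
    [/\ L = I ++ J, M = H ++ K & canonical_form I J H K] <->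
    (I, J, H, K) = (take (canon_pos L M) L, drop (canon_pos L M) L,
                    take (canon_pos L M).+1 M, drop (canon_pos L M).+1 M).
Proof.
move=> /and4P[]; rewrite /is_tableau /std_tableau /= andbT => sML stL stM.
rewrite /is_tableau /= stL stM sML !andbT /= /row_le sML /=.
have sz : size (zip L M) = size M by rewrite size_zip; apply/minn_idPr.
have -> : all (fun p : 'I_n * 'I_n => (p.1 <= p.2)%N) (zip L M)
        = ~~ has (fun p : 'I_n * 'I_n => (p.2 < p.1)%N) (zip L M).
  by rewrite -all_predC; apply: eq_all => p /=; rewrite -leqNgt.
rewrite negbK => hasP0 I J H K; split.
  case=> eL eM /and3P[/eqP sH allIH].
  case: J eL => // j J' eL; case/lastP: H eM sH allIH => // H0 h eM.
  rewrite rev_rcons size_rcons => -[sH] allIH lt_hj.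
  have zE : zip L M = zip I H0 ++ (j, h) :: zip J' K.
    by rewrite eL eM cat_rcons zip_cat ?sH.
  have zE2 : zip I (rcons H0 h) = zip I H0.
    by rewrite -[I in LHS]cats0 -cats1 zip_cat ?sH //= cats0.
  have rE : canon_pos L M = size I.
    rewrite /canon_pos zE find_cat; case: ifP => [|_].
      move=> /hasP[p pin]; move: allIH; rewrite zE2 => /allP/(_ _ pin) /=.
      by rewrite leqNgt => /negP.
    by rewrite /= lt_hj addn0 size_zip sH minnn.
  rewrite rE eL eM take_size_cat // drop_size_cat //.
  by rewrite take_size_cat ?drop_size_cat ?size_rcons ?sH.
move=> [-> -> -> ->]; rewrite !cat_take_drop; split=> //.
set r := canon_pos L M.
have rM : (r < size M)%N by rewrite -sz -has_find.
have rL : (r < size L)%N by apply: leq_trans sML.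
have [y0 _] : exists y : 'I_n, true by case: (L) rL => // y *; exists y.
rewrite /canonical_form !size_takel ?eqxx //=; last exact: ltnW.
apply/andP; split; last first.
  rewrite (drop_nth y0) // (take_nth y0) // rev_rcons.
  have := nth_find (y0, y0) hasP0; rewrite -/(canon_pos L M) -/r.
  by rewrite nth_zip_cond sz rM /=.
have -> : zip (take r L) (take r.+1 M) = take r (zip L M).
  rewrite (take_nth y0) // -[take r L]cats0 -cats1 zip_cat /=; last first.
    by rewrite !size_takel // ?(ltnW rL) ?(ltnW rM).
  rewrite cats0; elim: (r) (L) (M) => [|k IH] [|a s] [|b t] //=.
  by rewrite IH.
apply/(all_nthP (y0, y0)) => i; rewrite size_takel ?sz ?(ltnW rM) // => ir.
rewrite nth_take // leqNgt.
by have := @before_find _ (y0, y0) _ (zip L M) i ir => ->.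
Qed.

End Shuffling.

Definition is_family_basis (R : nzRingType) (V : lmodType R) (T : eqType)
    (P : pred T) (b : T -> V) : Prop :=
  (forall v : V, exists (s : seq T) (c : T -> R),
     [/\ uniq s, all P s & v = \sum_(t <- s) c t *: b t]) /\
  (forall (s : seq T) (c : T -> R), uniq s -> all P s ->
     \sum_(t <- s) c t *: b t = 0 -> forall t, t \in s -> c t = 0).

Definition in_span (R : nzRingType) (V : lmodType R) (S : V -> Prop) (v : V) :
    Prop :=
  exists s : seq (R * V),
    (forall a, a \in s -> S a.2) /\ v = \sum_(a <- s) a.1 *: a.2.

Definition in_ideal (A : comNzRingType) (S : A -> Prop) (v : A) : Prop :=
  exists s : seq (A * A),
    (forall a, a \in s -> S a.2) /\ v = \sum_(a <- s) a.1 * a.2.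

(* Main.v *)
Require Import Defs.
From HB Require Import structures.
From mathcomp Require Import all_boot all_order all_fingroup all_algebra.
From mathcomp Require Import mpoly.
From mathcomp Require Import zify ring.
Set Implicit Arguments.
Unset Strict Implicit.
Unset Printing Implicit Defensive.
Import Order.TTheory GRing.Theory Num.Theory.
Local Open Scope ring_scope.

(** The derivation comes from homogeneous coordinates: appending k acts linearly on the functions
    x(L), and d_k is that action read in the chart x([]) = 1; the quotient rule produces the
    correction y_k x(L), where y_k = x(k). Halving needs 2 to be regular, so the relation is proved
    over the integers and carried to R by base change. Write F = E + t O with E and O polynomials in
    v = t^2. When |J| is even, E and O have the same remainder modulo one further power of 1 + v, so
    O - E and E + v O gain that power. One of these two, according to the parity of |I|, carries the
    wanted coefficient. The relations are not homogeneous because the empty row is read as 1;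
    tableaux are therefore allowed to contain empty rows until the very end of straightening.
    Straightening is done modulo an abstract submodule N. If N lies in the kernel of pi,
    independence of the standard monomials shows that a kernel element which straightens modulo N
    already lies in N. Taking for N the ideal of the quadratic relations gives (2), and taking the
    span of the Theta(T) gives (3). *)

(* Encode the pfaffians by a function x on arbitrary rows, alternating in its
   entries.  A derivation d_k of B_Z satisfies x (L k) = d_k (x L) + y_k x L with
   y_k = x_{k,n+1}; so a relation \sum c x(P) x(Q) = 0 yields
   \sum c (x(P k) x(Q) + x(P) x(Q k)) = 0, and, applying this twice with the same
   k and halving, \sum c x(P k) x(Q k) = 0.  This reduces the shuffling relation
   to the case of an empty K.  There, let F(t) be the sum of
   eps(H' J') t^|H'| x(J' I) x(H') over all splittings of H J.  Expanding along
   the first entry of H J, two shuffled entries that are paired with each other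
   contribute a factor 1 + t^2, and each entry of I can absorb only one shuffled
   entry, so F is divisible by a high power of 1 + t^2 (up to a known remainder
   when |J| is even).  The signed q-binomials at q = -1 are the coefficients of
   an inverse power of 1 + t^2 (times 1 - t when |J| is even), so that the
   relation says that a quotient has no term of degree |H|.

   The shuffling relations straighten: the leading term of Theta(T) is T, the
   other terms have a longer first row, or one of the same length and smaller
   sum.  Standard monomials are independent because, for
   x_ij = \sum_(a < b) (y_ai y_bj - y_bi y_aj) and x_{i,n+1} = \sum_a y_ai, the
   leading monomial of pf_I is \prod_k y_{k,I_k}, and the product of these over
   the rows of a standard tableau determines the tableau. *)

(** * Pfaffians of rows *)

Section DeletionSums.
Variables (T : Type) (A : comNzRingType).
Implicit Types (f g : T -> A) (s : seq T) (phi psi : seq T -> A).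

(* \sum_i (-1)^i f(s_i) phi(s without its i-th entry), for i >= 0. *)
Fixpoint del_sum f s phi : A :=
  if s is b :: s' then f b * phi s' - del_sum f s' (fun t => phi (b :: t))
  else 0.

Lemma eq_del_sum f s phi psi :
  (forall t, (size t).+1 = size s -> phi t = psi t) ->
  del_sum f s phi = del_sum f s psi.
Proof.
elim: s phi psi => //= b s IH phi psi e; rewrite e //; congr (_ - _).
by apply: IH => t st; apply: e => /=; rewrite st.
Qed.

Lemma eq_del_sumf f g s phi : f =1 g -> del_sum f s phi = del_sum g s phi.
Proof. by move=> e; elim: s phi => //= b s IH phi; rewrite e IH. Qed.

Lemma del_sum0 f s : del_sum f s (fun=> 0) = 0.
Proof. by elim: s => //= b s ->; rewrite mulr0 subr0. Qed.

Lemma del_sumD f s phi psi :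
  del_sum f s (fun t => phi t + psi t) = del_sum f s phi + del_sum f s psi.
Proof.
elim: s phi psi => [|b s IH] phi psi /=; first by rewrite addr0.
by rewrite IH; ring.
Qed.

Lemma del_sumZ f s c phi :
  del_sum f s (fun t => c * phi t) = c * del_sum f s phi.
Proof.
elim: s phi => [|b s IH] phi /=; first by rewrite mulr0.
by rewrite IH; ring.
Qed.

Lemma del_sumZr f s c phi :
  del_sum f s (fun t => phi t * c) = del_sum f s phi * c.
Proof.
by rewrite mulrC -del_sumZ; apply: eq_del_sum => t _; rewrite mulrC.
Qed.

Lemma del_sumN f s phi : del_sum f s (fun t => - phi t) = - del_sum f s phi.
Proof.
rewrite -mulN1r -del_sumZ; apply: eq_del_sum => t _; by rewrite mulN1r.
Qed.

Lemma del_sumB f s phi psi :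
  del_sum f s (fun t => phi t - psi t) = del_sum f s phi - del_sum f s psi.
Proof. by rewrite del_sumD del_sumN. Qed.

Lemma del_sum_lin f g c d s phi :
  del_sum (fun a => c * f a + d * g a) s phi
  = c * del_sum f s phi + d * del_sum g s phi.
Proof.
elim: s phi => [|b s IH] phi /=; first by rewrite !mulr0 addr0.
by rewrite IH; ring.
Qed.

Lemma del_sum_cat f s1 s2 phi :
  del_sum f (s1 ++ s2) phi
  = del_sum f s1 (fun t => phi (t ++ s2))
    + (-1) ^+ size s1 * del_sum f s2 (fun t => phi (s1 ++ t)).
Proof.
elim: s1 phi => [|b s IH] phi /=; first by rewrite add0r mul1r.
by rewrite IH exprS; ring.
Qed.

(** [del_sum f] is contraction with the linear form f on the exterior algebra, and contractions
    anticommute. The diagonal case, [del_sum_sqr], cannot be obtained from this by halving. *)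
Lemma del_sumC f g s phi :
  del_sum f s (fun t => del_sum g t phi)
  = - del_sum g s (fun t => del_sum f t phi).
Proof.
elim: s phi => [|b s IH] phi /=; first by rewrite oppr0.
by rewrite !del_sumB !del_sumZ IH; ring.
Qed.

Lemma del_sum_sqr f s phi : del_sum f s (fun t => del_sum f t phi) = 0.
Proof.
elim: s phi => [|b s IH] phi //=.
by rewrite del_sumB del_sumZ IH; ring.
Qed.

End DeletionSums.

Lemma del_sum_map (T U : Type) (A : comNzRingType) (h : T -> U) (f : U -> A)
    (s : seq T) (phi : seq U -> A) :
  del_sum f (map h s) phi = del_sum (f \o h) s (phi \o map h).
Proof. by elim: s phi => //= b s IH phi; rewrite IH. Qed.

Lemma del_sum_rmorph (T : Type) (A B : comNzRingType) (rho : {rmorphism A -> B})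
    (f : T -> A) (s : seq T) (phi : seq T -> A) :
  rho (del_sum f s phi) = del_sum (rho \o f) s (rho \o phi).
Proof.
elim: s phi => [|b s IH] phi /=; first by rewrite rmorph0.
by rewrite rmorphB rmorphM IH.
Qed.

Section Alternating.
Variables (T : Type) (A : comNzRingType).
Implicit Types (s : seq T) (phi : seq T -> A).

(** Vanishing on equal neighbours is a separate clause because 2 may be a zero divisor. *)
Definition alternating phi : Prop :=
  (forall s1 a b s2, phi (s1 ++ a :: b :: s2) = - phi (s1 ++ b :: a :: s2)) /\
  (forall s1 a s2, phi (s1 ++ a :: a :: s2) = 0).

Lemma alternating_move phi p H g J : alternating phi ->
  phi (p ++ H ++ g :: J) = (-1) ^+ size H * phi (p ++ g :: H ++ J).
Proof.
case=> phiC _; elim: H p => [|h H IH] p /=; first by rewrite mul1r.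
by rewrite -cat_rcons IH cat_rcons phiC exprS; ring.
Qed.

Lemma alternating_catC phi p I J : alternating phi ->
  phi (p ++ J ++ I) = (-1) ^+ (size I * size J) * phi (p ++ I ++ J).
Proof.
move=> alt_phi; elim: I p => [|i I IH] p; first by rewrite cats0 mul1r.
by rewrite alternating_move // -cat_rcons IH cat_rcons mulrA -exprD.
Qed.

End Alternating.

Section RowPfaffian.
Variables (T : Type) (A : comNzRingType) (X : T -> T -> A) (y : T -> A).
Implicit Types (s : seq T).

(** The fuel k replaces structural recursion, as the rows that [del_sum] passes on are not subterms
    of s. *)
Fixpoint rowpf_rec k s : A :=
  match k, s with
  | k'.+1, a :: t => del_sum (X a) t (rowpf_rec k')
                     + (~~ odd (size t))%:R * (y a * rowpf_rec k' t)
  | _, _ => 1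
  end.

(* The pfaffian of the antisymmetric matrix X on the row s, expanded along
   its first line; a row of odd length is completed by an extra last index oo
   with X a oo = y a. *)
Definition rowpf s : A := rowpf_rec (size s) s.

Lemma rowpf_rec_size k s : (size s <= k)%N -> rowpf_rec k s = rowpf s.
Proof.
rewrite /rowpf; have [m] := ubnP (size s); elim: m k s => // m IH k [|a s].
  by case: k.
case: k => // k /=; rewrite !ltnS => sm sk.
rewrite IH //; congr (_ + _); apply: eq_del_sum => t st.
by rewrite IH 1?[RHS]IH -?st //; lia.
Qed.

Lemma rowpf_cons a s :
  rowpf (a :: s) = del_sum (X a) s rowpf
                   + (~~ odd (size s))%:R * (y a * rowpf s).
Proof.
rewrite /rowpf /= -/(rowpf s); congr (_ + _); apply: eq_del_sum => t st.
by rewrite rowpf_rec_size // -st.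
Qed.

Lemma rowpf_nil : rowpf [::] = 1. Proof. by []. Qed.

Hypothesis XC : forall a b, X a b = - X b a.
Hypothesis X0 : forall a, X a a = 0.

(** Expanding along two lines makes the antisymmetry in a and b visible: contractions by [X a] and
    [X b] anticommute, and the y-terms change sign. This settles a swap at the head of the row. *)
Lemma rowpf_cons2 a b s :
  rowpf (a :: b :: s)
  = X a b * rowpf s - del_sum (X a) s (fun t => del_sum (X b) t rowpf)
    + (odd (size s))%:R * (y a * del_sum (X b) s rowpf
                           - y b * del_sum (X a) s rowpf).
Proof.
rewrite rowpf_cons /= negbK.
rewrite (eq_del_sum _ (psi := fun t => del_sum (X b) t rowpf
            + ((odd (size s))%:R * y b) * rowpf t)); last first.
  by move=> t st; rewrite rowpf_cons -st /= ?negbK mulrA.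
rewrite del_sumD del_sumZ rowpf_cons.
by case: (odd (size s)) => /=; ring.
Qed.

Lemma rowpf_alternating : alternating rowpf.
Proof.
have key m : forall s1 a b s2, (size s1 <= m)%N ->
    rowpf (s1 ++ a :: b :: s2) = - rowpf (s1 ++ b :: a :: s2)
    /\ rowpf (s1 ++ a :: a :: s2) = 0.
  elim: m => [|m IH] [|c s1] a b s2 //= sm; try by
    rewrite !rowpf_cons2 XC X0 del_sumC del_sum_sqr; split; ring.
  (* Expanding along c deletes either an entry away from the swapped pair, where induction applies,
     or one of the pair, and those two terms are exchanged by the swap. *)
  rewrite !rowpf_cons !del_sum_cat /= !size_cat /=.
  have [e1 e2] := IH s1 a b s2 sm; rewrite e1 e2.
  rewrite (eq_del_sum _ (psi := fun t => - rowpf (t ++ b :: a :: s2))); last first.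
    by move=> t st; have [] := IH t a b s2 _ => //; lia.
  rewrite [X in _ /\ X + _ + _ = 0](eq_del_sum _ (psi := fun=> 0)); last first.
    by move=> t st; have [] := IH t a a s2 _ => //; lia.
  rewrite del_sum0 del_sumN.
  have d u v : del_sum (X c) s2 (fun t => rowpf (s1 ++ u :: v :: t))
             = - del_sum (X c) s2 (fun t => rowpf (s1 ++ v :: u :: t)).
    by rewrite -del_sumN; apply: eq_del_sum => t _; have [] := IH s1 u v t sm.
  rewrite (d a b).
  rewrite [X in _ /\ _ + _ * (_ - (_ - X)) + _ = 0](eq_del_sum _ (psi := fun=> 0));
    last by move=> t _; have [] := IH s1 a a t sm.
  by rewrite del_sum0; split; ring.
split=> [s1 a b s2|s1 a s2]; first by have [] := key _ s1 a b s2 (leqnn _).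
by have [] := key _ s1 a a s2 (leqnn _).
Qed.

(** For odd length this is the expansion along the line of the extra index oo; for even length it is
    the pfaffian of s with oo appended twice, hence 0. *)
Lemma del_sum_rowpf_y s : del_sum y s rowpf = (odd (size s))%:R * rowpf s.
Proof.
have [m] := ubnP (size s); elim: m s => // m IH [|a s] /= sm.
  by rewrite mul0r.
rewrite (eq_del_sum _ (psi := fun t => del_sum (X a) t rowpf
            + ((odd (size s))%:R * y a) * rowpf t)); last first.
  by move=> t st; rewrite rowpf_cons -st /= ?negbK mulrA.
rewrite del_sumD del_sumZ del_sumC IH // rowpf_cons.
rewrite (eq_del_sum _ (psi := fun t => (~~ odd (size s))%:R * rowpf t)).
  by rewrite del_sumZ; case: odd => /=; ring.
by move=> t st; rewrite -st /= negbK IH //; lia.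
Qed.

Lemma rowpf_rcons s k :
  rowpf (rcons s k) = - (-1) ^+ size s * del_sum (X^~ k) s rowpf
                      + (~~ odd (size s))%:R * (y k * rowpf s).
Proof.
have [m] := ubnP (size s); elim: m s => // m IH [|a s] /= sm.
  by rewrite rowpf_cons /= rowpf_nil; ring.
rewrite rowpf_cons -cats1 del_sum_cat /= cats0 size_cat /= addn1 /= negbK cats1.
rewrite IH // rowpf_cons exprS.
rewrite (eq_del_sum _ (psi := fun t =>
   (-1) ^+ size s * del_sum (X^~ k) t rowpf
     + ((odd (size s))%:R * y k) * rowpf t)); last first.
  move=> t st; rewrite cats1 IH -?st /=; first by rewrite exprS; ring.
  by lia.
rewrite [in RHS](eq_del_sum _ (psi := fun t => del_sum (X a) t rowpf
            + ((odd (size s))%:R * y a) * rowpf t)); last first.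
  by move=> t st; rewrite rowpf_cons -st /= ?negbK mulrA.
rewrite !del_sumD !del_sumZ del_sumC.
by rewrite -signr_odd; case: odd => /=; ring.
Qed.

End RowPfaffian.

Lemma rowpf_map (T U : Type) (A : comNzRingType) (h : T -> U)
    (X : U -> U -> A) (y : U -> A) (s : seq T) :
  rowpf X y (map h s) = rowpf (fun a b => X (h a) (h b)) (y \o h) s.
Proof.
have [m] := ubnP (size s); elim: m s => // m IH [|a s] //= sm.
rewrite !rowpf_cons del_sum_map size_map IH //; congr (_ + _).
by apply: eq_del_sum => t st; rewrite /= IH //; lia.
Qed.

Lemma eq_rowpf (T : Type) (A : comNzRingType)
    (X X' : T -> T -> A) (y y' : T -> A) (s : seq T) :
  X =2 X' -> y =1 y' -> rowpf X y s = rowpf X' y' s.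
Proof.
move=> eX ey; have [m] := ubnP (size s); elim: m s => // m IH [|a s] //= sm.
rewrite !rowpf_cons ey IH // (eq_del_sumf _ _ (eX a)); congr (_ + _).
by apply: eq_del_sum => t st; rewrite /= IH //; lia.
Qed.

Lemma rowpf_rmorph (T : Type) (A B : comNzRingType) (rho : {rmorphism A -> B})
    (X : T -> T -> A) (y : T -> A) (s : seq T) :
  rho (rowpf X y s) = rowpf (fun a b => rho (X a b)) (rho \o y) s.
Proof.
have [m] := ubnP (size s); elim: m s => [|m IH] [|a s] //= sm.
  by rewrite rowpf_nil rmorph1.
rewrite !rowpf_cons rmorphD !rmorphM rmorph_nat del_sum_rmorph IH //.
congr (_ + _); rewrite (eq_del_sumf (g := fun b => rho (X a b))) //.
by apply: eq_del_sum => t st; rewrite /= IH //; lia.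
Qed.

(** Once oo is appended to the odd rows, every length is even and the y-terms disappear. This
    matches [even_row] with the treatment of both parities by y. *)
Lemma rowpf_infty (T U : Type) (A : comNzRingType) (h : T -> U) (oo : U)
    (X : U -> U -> A) (s : seq T) :
  rowpf X (fun=> 0) (map h s ++ if odd (size s) then [:: oo] else [::])
  = rowpf (fun a b => X (h a) (h b)) (fun a => X (h a) oo) s.
Proof.
have [m] := ubnP (size s); elim: m s => // m IH [|a s] //= sm.
rewrite !rowpf_cons mul0r mulr0 addr0 del_sum_cat del_sum_map size_map.
have -> : del_sum (X (h a) \o h) s
    ((fun t => rowpf X (fun=> 0) (t ++ if ~~ odd (size s) then [:: oo] else [::]))
      \o map h)
  = del_sum (fun b => X (h a) (h b)) s
      (rowpf (fun a b => X (h a) (h b)) (fun a => X (h a) oo)).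
  apply: eq_del_sum => t st; rewrite /= -IH -?st /= ?negbK //; lia.
congr (_ + _); case oS: (odd (size s)) => /=.
  by rewrite mulr0 mul0r.
have := IH s sm; rewrite oS => ->.
by rewrite -signr_odd oS subr0.
Qed.

Section RowPfaffianDerivation.
Variables (T : Type) (A : comNzRingType) (X : T -> T -> A) (y : T -> A).
Variables (k : T) (d : A -> A).
Hypothesis dB : forall u v, d (u - v) = d u - d v.
Hypothesis dM : forall u v, d (u * v) = d u * v + u * d v.
Hypothesis dX : forall a b, d (X a b) = y a * X b k - y b * X a k.
Hypothesis dy : forall a, d (y a) = X a k - y a * y k.

Let d0 : d 0 = 0. Proof. by have := dB 0 0; rewrite !subrr. Qed.
Let dN u : d (- u) = - d u. Proof. by rewrite -sub0r dB d0 sub0r. Qed.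
Let dD u v : d (u + v) = d u + d v.
Proof. by rewrite -[v in LHS]opprK dB dN opprK. Qed.
Let d1 : d 1 = 0.
Proof.
have := dM 1 1; rewrite !mulr1 mul1r => /eqP.
by rewrite -subr_eq0 opprD addNKr oppr_eq0 => /eqP.
Qed.

Lemma deriv_del_sum (f : T -> A) s phi :
  d (del_sum f s phi) = del_sum (d \o f) s phi + del_sum f s (d \o phi).
Proof.
elim: s phi => [|b s IH] phi /=; first by rewrite d0 addr0.
by rewrite dB dM IH; ring.
Qed.

Hypothesis XC : forall a b, X a b = - X b a.

(** The hypotheses [dX] and [dy] are this formula for rows of length two and one; the Leibniz rule
    propagates it through the expansion along the first line. *)
Lemma deriv_rowpf s :
  d (rowpf X y s) = rowpf X y (rcons s k) - y k * rowpf X y s.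
Proof.
have [m] := ubnP (size s); elim: m s => // m IH [|a s] /= sm.
  by rewrite rowpf_cons rowpf_nil /= d1; ring.
rewrite !rowpf_cons -cats1 del_sum_cat /= cats0 size_cat /= addn1 /= negbK cats1.
rewrite dD dM dM dy IH // deriv_del_sum.
(* The derived line is a combination of the column of k, which [rowpf_rcons] resums, and of y, which
   [del_sum_rowpf_y] evaluates. *)
rewrite (eq_del_sumf (g := fun b => y a * X b k + (- X a k) * y b)); last first.
  by move=> b; rewrite /= dX; ring.
rewrite del_sum_lin del_sum_rowpf_y //.
rewrite [X in _ + X + _](eq_del_sum _
  (psi := fun t => rowpf X y (t ++ [:: k]) - y k * rowpf X y t)); last first.
  by move=> t st; rewrite /= IH ?cats1 //; lia.
rewrite del_sumB del_sumZ rowpf_rcons // -signr_odd.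
have dnat (b : bool) : d b%:R = 0 by case: b; rewrite ?d1 ?d0.
by rewrite dnat; case: odd => /=; ring.
Qed.

End RowPfaffianDerivation.

Lemma del_sum_sign (T : Type) (A : comNzRingType) (f : T -> A) (s : seq T)
    (phi : seq T -> A) :
  del_sum f s (fun t => (-1) ^+ size t * phi t)
  = - (-1) ^+ size s * del_sum f s phi.
Proof.
rewrite -del_sumZ; apply: eq_del_sum => t <-.
by rewrite exprS mulN1r opprK.
Qed.

(** * Signed sums over the splittings of a row *)

Section SplitSums.
Variables (T : Type) (A : comNzRingType).
Implicit Types (f : T -> A) (G H J : seq T) (phi psi : seq T -> seq T -> A).

(* The sum of eps (H ++ J) * phi H J over the ways of splitting G into two
   complementary subsequences H and J. *)
Fixpoint split_sum G phi : A :=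
  if G is g :: G' then
    split_sum G' (fun H J => (-1) ^+ size H * phi H (g :: J))
    + split_sum G' (fun H J => phi (g :: H) J)
  else phi [::] [::].

Lemma eq_split_sum G phi psi :
  (forall H J, (size H + size J = size G)%N -> phi H J = psi H J) ->
  split_sum G phi = split_sum G psi.
Proof.
elim: G phi psi => [|g G IH] phi psi e /=; first by rewrite e.
congr (_ + _); apply: IH => H J s; rewrite e //= -s; lia.
Qed.

Lemma split_sum0 G : split_sum G (fun _ _ => 0) = 0.
Proof.
elim: G => //= g G IH; rewrite IH addr0 -[RHS]IH.
by apply: eq_split_sum => H J _; rewrite mulr0.
Qed.

Lemma split_sumD G phi psi :
  split_sum G (fun H J => phi H J + psi H J)
  = split_sum G phi + split_sum G psi.
Proof.
elim: G phi psi => [|g G IH] phi psi //=.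
rewrite [RHS]addrACA -[X in _ = X + _]IH -[X in _ = _ + X]IH; congr (_ + _); apply: eq_split_sum => H J _.
by rewrite mulrDr.
Qed.

Lemma split_sumZ G c phi :
  split_sum G (fun H J => c * phi H J) = c * split_sum G phi.
Proof.
elim: G phi => [|g G IH] phi //=.
rewrite mulrDr -!IH; congr (_ + _); apply: eq_split_sum => H J _.
by rewrite mulrCA.
Qed.

Lemma split_sumN G phi :
  split_sum G (fun H J => - phi H J) = - split_sum G phi.
Proof.
rewrite -mulN1r -split_sumZ; apply: eq_split_sum => H J _; by rewrite mulN1r.
Qed.

Lemma split_sum_del f G I (phi : seq T -> seq T -> seq T -> A) :
  split_sum G (fun H J => del_sum f I (phi H J))
  = del_sum f I (fun t => split_sum G (fun H J => phi H J t)).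
Proof.
elim: I phi => [|i I IH] phi /=; first exact: split_sum0.
by rewrite split_sumD split_sumN split_sumZ IH.
Qed.

Lemma split_sum_nil G (psi : seq T -> A) :
  split_sum G (fun H J => (nilp H)%:R * psi J) = psi G.
Proof.
elim: G psi => [|g G IH] psi /=; first by rewrite mul1r.
rewrite -[RHS](IH (fun J => psi (g :: J))) -[RHS]addr0; congr (_ + _).
  by apply: eq_split_sum => -[|h H] J _ /=; rewrite ?mul1r ?mul0r ?mulr0.
by rewrite -[RHS](split_sum0 G); apply: eq_split_sum => H J _; rewrite mul0r.
Qed.

(** The weight (-1)^|H| is the sign of moving the deleted entry of J in front of H. Together with
    [split_sum_dell], this says that deleting from J or from H leads to the same sum, which is the
    origin of the factor 1 + t^2. *)
Lemma split_sum_delr f G phi :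
  split_sum G (fun H J => (-1) ^+ size H * del_sum f J (phi H))
  = del_sum f G (fun G' => split_sum G' phi).
Proof.
elim: G phi => [|g G IH] phi /=; first by rewrite mulr0.
rewrite del_sumD -!IH -split_sumZ opprD addrA.
rewrite -!split_sumN -!split_sumD.
apply: eq_split_sum => H J _ /=; rewrite exprS del_sumZ.
by rewrite -signr_odd; case: odd => /=; ring.
Qed.

Lemma split_sum_dell f G phi :
  split_sum G (fun H J => del_sum f H (fun H' => phi H' J))
  = del_sum f G (fun G' => split_sum G' phi).
Proof.
elim: G phi => [|g G IH] phi //=.
rewrite del_sumD -!IH -split_sumZ opprD addrA.
rewrite -!split_sumN -!split_sumD.
by apply: eq_split_sum => H J _ /=; rewrite del_sum_sign; ring.
Qed.

End SplitSums.

(** * Signs and splittings of standard rows *)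

Lemma big_reindex_seq (I : finType) (T : eqType) (V : nmodType) (P : pred I)
    (h : I -> T) (l : seq T) (F : T -> V) :
  uniq l -> {in P &, injective h} -> (forall i, P i -> h i \in l) ->
  (forall t, t \in l -> exists2 i, P i & h i = t) ->
  \sum_(i | P i) F (h i) = \sum_(t <- l) F t.
Proof.
move=> ul hI hP hl; have -> : \sum_(i | P i) F (h i) = \sum_(i <- enum P) F (h i).
  by rewrite big_enum.
rewrite -(big_map h xpredT F); apply: perm_big; apply: uniq_perm => //.
  rewrite map_inj_in_uniq ?enum_uniq // => i j.
  by rewrite !mem_enum; apply: hI.
move=> t; apply/mapP/idP => [[i]|/hl[i Pi <-]].
  by rewrite mem_enum => /hP + ->.
by exists i; rewrite // mem_enum.
Qed.

Section StandardRows.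
Variable n : nat.
Implicit Types (L G H J : seq 'I_n) (a b g : 'I_n).

Lemma std_rowE L : std_row L = sorted (fun i j : 'I_n => (i < j)%N) L.
Proof. exact: sorted_map. Qed.

Lemma std_row_cons a L :
  std_row (a :: L) = all (fun b : 'I_n => (a < b)%N) L && std_row L.
Proof.
by rewrite !std_rowE /= path_sortedE // => x y z; apply: ltn_trans.
Qed.

Lemma ltn_ord_trans : transitive (fun i j : 'I_n => (i < j)%N).
Proof. by move=> x y z; apply: ltn_trans. Qed.

Lemma ltn_ord_irr : irreflexive (fun i j : 'I_n => (i < j)%N).
Proof. by move=> x; rewrite ltnn. Qed.

Lemma std_row_uniq L : std_row L -> uniq L.
Proof.
by rewrite std_rowE; apply: sorted_uniq; [apply: ltn_ord_trans|apply: ltn_ord_irr].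
Qed.

Lemma std_row_eq L H : std_row L -> std_row H -> perm_eq L H -> L = H.
Proof.
rewrite !std_rowE => sL sH /perm_mem.
by apply: irr_sorted_eq sL sH; [apply: ltn_ord_trans|apply: ltn_ord_irr].
Qed.

Lemma std_row_mem_eq L H : std_row L -> std_row H -> L =i H -> L = H.
Proof.
move=> sL sH e; apply: std_row_eq => //.
by apply: uniq_perm => //; apply: std_row_uniq.
Qed.

Lemma std_row_sort L : std_row (row_sort L) = uniq L.
Proof.
apply/idP/idP => [/std_row_uniq|uL]; first by rewrite sort_uniq.
have : sorted (fun i j : 'I_n => (i <= j)%N) (row_sort L).
  by apply: sort_sorted => x y; apply: leq_total.
rewrite std_rowE; have : uniq (row_sort L) by rewrite sort_uniq.
elim: (row_sort L) => //= a [|b H] IH //= /andP[nab ubH] /andP[ab bH].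
rewrite ltn_neqAle ab andbT; apply/andP; split; last exact: IH.
by apply: contra nab => /eqP/ord_inj ->; rewrite inE eqxx.
Qed.

Lemma perm_row_sort L : perm_eq (row_sort L) L.
Proof. by rewrite perm_sort. Qed.

Lemma row_sort_id L : std_row L -> row_sort L = L.
Proof.
move=> sL; apply: std_row_eq (perm_row_sort L) => //.
by rewrite std_row_sort std_row_uniq.
Qed.

Lemma row_sort_perm L H : perm_eq L H -> row_sort L = row_sort H.
Proof.
move=> e; apply/perm_sortP => //; first by move=> x y; apply: leq_total.
  by move=> x y z; apply: leq_trans.
by move=> x y /anti_leq/ord_inj.
Qed.

Lemma std_row_filter (P : pred 'I_n) L : std_row L -> std_row (filter P L).
Proof.
by rewrite !std_rowE; exact/sorted_filter/ltn_ord_trans.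
Qed.

Lemma std_row_catl L H : std_row (L ++ H) -> std_row L.
Proof. by rewrite !std_rowE => /cat_sorted2[]. Qed.

Lemma std_row_catr L H : std_row (L ++ H) -> std_row H.
Proof. by rewrite !std_rowE => /cat_sorted2[]. Qed.

Lemma size_std_row L : std_row L -> (size L <= n)%N.
Proof.
by move=> /std_row_uniq/card_uniqP <-; rewrite -[n in (_ <= n)%N]card_ord max_card.
Qed.

Lemma alternating_insert a L : std_row L ->
  exists e : int, exists2 L' : seq 'I_n, perm_eq L' (a :: L) &
    (~~ uniq (a :: L) /\ e = 0 \/ std_row L' /\ e * e = 1) /\
    (forall (A : comNzRingType) (phi : seq 'I_n -> A), alternating phi ->
       forall p q, phi (p ++ (a :: L) ++ q) = e%:~R * phi (p ++ L' ++ q)).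
Proof.
elim: L => [|b L IH].
  by exists 1, [:: a] => //; split=> [|A phi _ p q]; [right|rewrite mul1r].
move=> sbL; have [ab|ba|/ord_inj <-] := ltngtP a b.
- exists 1, (a :: b :: L) => //; split=> [|A phi _ p q]; last by rewrite mul1r.
  right; split=> //; rewrite std_row_cons sbL /= ab /= andbT.
  move: sbL; rewrite std_row_cons => /andP[/allP bL _].
  by apply/allP => c /bL; apply: ltn_trans.
- move: sbL; rewrite std_row_cons => /andP[/allP bL sL].
  have [e [L' eL' [se phiE]]] := IH sL.
  exists (- e), (b :: L').
    apply: (@perm_trans _ (b :: a :: L)); first by rewrite perm_cons.
    by rewrite -[b :: a :: L]/([:: b; a] ++ L) -[a :: b :: L]/([:: a; b] ++ L)
      perm_cat2r (perm_catC [:: b] [:: a]).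
  split.
    case: se => [[nu ->]|[sL' ee]]; [left|right].
      by rewrite oppr0; split=> //; apply: contra nu => /= /and3P[];
        rewrite inE negb_or => /andP[_ ->] _ ->.
    rewrite mulrNN ee std_row_cons sL' andbT; split=> //.
    by apply/allP => c; rewrite (perm_mem eL') inE => /predU1P[->|/bL].
  move=> A phi alt_phi p q; have [phiC _] := alt_phi.
  rewrite !cat_cons phiC rmorphN mulNr -cat_rcons; congr (- _).
  by rewrite -cat_cons (phiE A) // cat_rcons.
exists 0, (a :: a :: L) => //; split=> [|A phi [_ phi0] p q].
  by left; rewrite /= mem_head.
by rewrite !cat_cons phi0 mulr0.
Qed.

(** The sign e is chosen before the ring and before phi, so that taking phi to be [eps] later
    identifies e with [eps L]. *)
Lemma alternating_normal_form L :
  exists e : int, exists2 L' : seq 'I_n, perm_eq L' L &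
    (~~ uniq L /\ e = 0 \/ std_row L' /\ e * e = 1) /\
    (forall (A : comNzRingType) (phi : seq 'I_n -> A), alternating phi ->
       forall p q, phi (p ++ L ++ q) = e%:~R * phi (p ++ L' ++ q)).
Proof.
elim: L => [|a L [e [L' pL' [se phiE]]]].
  by exists 1, [::] => //; split=> [|A phi _ p q]; [right|rewrite mul1r].
have [[nu e0]|[sL' ee]] := se.
  exists 0, (a :: L) => //; split=> [|A phi alt_phi p q].
    by left; rewrite /= (negPf nu) andbF.
  by rewrite cat_cons -cat_rcons (phiE A) // e0 !mul0r.
have [e' [L2 pL2 [se' phiE']]] := alternating_insert a sL'.
exists (e * e'), L2.
  by apply: perm_trans pL2 _; rewrite perm_cons.
split.
  case: se' => [[nu ->]|[sL2 ee']]; [left; rewrite mulr0|right; split=> //].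
    by rewrite /= -(perm_mem pL') -(perm_uniq pL').
  by rewrite mulrACA ee ee'.
move=> A phi alt_phi p q.
rewrite cat_cons -cat_rcons (phiE A) // cat_rcons -cat_cons (phiE' A) //.
by rewrite mulrA -rmorphM.
Qed.

(** With k fixed outside, a row and its rearrangements are sorted by permutations of one group,
    whereas the group in [eps] depends on the row. *)
Definition eps_tuple k (t : k.-tuple 'I_n) : int :=
  if [pick s : 'S_k | std_row [seq tnth t (s i) | i <- enum 'I_k]] is Some s
  then (-1) ^+ s else 0.

Lemma eps_val k (t : k.-tuple 'I_n) : eps (val t) = eps_tuple t.
Proof.
case: t => L sL; have e := eqP sL; subst k.
by rewrite /eps /eps_tuple /= (_ : Tuple sL = in_tuple L) //; apply: val_inj.
Qed.

Lemma eps_tupleP k (t : k.-tuple 'I_n) (s : 'S_k) :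
  std_row [seq tnth t (s i) | i <- enum 'I_k] -> eps_tuple t = (-1) ^+ s.
Proof.
pose w (u : 'S_k) := [seq tnth t (u i) | i <- enum 'I_k].
rewrite /eps_tuple -/(w s) => ss; case: pickP => [s' |/(_ s)]; last first.
  by rewrite -/(w s) ss.
rewrite -/(w s') => ss'; suff -> : s' = s by [].
have memw u : w u =i t.
  move=> x; apply/mapP/idP => [[i _ ->]|/tnthP[i ->]]; first exact: mem_tnth.
  by exists (u^-1 i)%g; rewrite ?mem_enum ?permKV.
have ew : w s = w s' by apply: std_row_mem_eq => // x; rewrite !memw.
have inj : injective (fun i => tnth t (s i)).
  move=> i j; have /injectiveP : injectiveb (fun i => tnth t (s i)).
    by rewrite /injectiveb /dinjectiveb (std_row_uniq ss).
  exact.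
apply/permP => i.
have /eq_in_map/(_ i) := ew; rewrite mem_enum => /(_ isT).
rewrite -[s' i](permKV s) => e; by rewrite -(inj _ _ e).
Qed.

(** A permutation s sorts the swapped row exactly when s followed by the transposition [tau] sorts
    the original one. *)
Lemma eps_alternating : alternating (@eps n).
Proof.
have nuniq L : ~~ uniq L -> eps L = 0.
  move=> nu; rewrite /eps; case: pickP => // s ss; case/negP: nu.
  rewrite -[L]/(tval (in_tuple L)) -map_tnth_enum map_inj_uniq ?enum_uniq // => i j.
  have inj : injective (fun i => tnth (in_tuple L) (s i)).
    apply/injectiveP; by rewrite /injectiveb /dinjectiveb (std_row_uniq ss).
  by rewrite -[i](permKV s) -[j](permKV s) => /inj ->.
split=> [s1 a b s2|s1 a s2]; last first.
  by apply: nuniq; rewrite cat_uniq /= inE eqxx /= !andbF.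
pose L := s1 ++ a :: b :: s2; pose L2 := s1 ++ b :: a :: s2.
pose k := size L.
have sL2 : size L2 == k by rewrite /k !size_cat.
pose t := in_tuple L; pose t2 := Tuple sL2.
have i1 : (size s1 < k)%N by rewrite /k size_cat /=; lia.
have i2 : ((size s1).+1 < k)%N by rewrite /k size_cat /=; lia.
pose tau : 'S_k := tperm (Ordinal i1) (Ordinal i2).
have t2E x : tnth t2 x = tnth t (tau x).
  rewrite !(tnth_nth a) /= /L /L2 !nth_cat /tau.
  case: tpermP => [->|->|/eqP n1 /eqP n2] /=.
  - by rewrite ltnn subnn ltnNge leqnSn subSnn.
  - by rewrite ltnn subnn ltnNge leqnSn subSnn.
  case: ltnP => // le; move: n1 n2; rewrite -!val_eqE /= => n1 n2.
  by case d: (x - size s1)%N => [|[|m]] //; lia.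
have sortE (s : 'S_k) : [seq tnth t2 (s i) | i <- enum 'I_k]
     = [seq tnth t ((s * tau)%g i) | i <- enum 'I_k].
  by apply: eq_map => i; rewrite t2E permM.
rewrite -/L -/L2 -[L]/(val t) -[L2]/(val t2) !eps_val.
rewrite {2}/eps_tuple; case: pickP => [s|no].
  rewrite sortE => /eps_tupleP ->; rewrite odd_permM odd_tperm.
  have -> : Ordinal i1 != Ordinal i2 by rewrite -val_eqE /= neq_ltn ltnSn.
  by rewrite addbT signrN.
rewrite oppr0 /eps_tuple; case: pickP => // s ss.
by have := no (s * tau)%g; rewrite sortE -mulgA tperm2 mulg1 ss.
Qed.

Lemma eps_std L : std_row L -> eps L = 1.
Proof.
move=> sL; rewrite -[L]/(val (in_tuple L)) eps_val (@eps_tupleP _ _ 1%g).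
  by rewrite odd_perm1.
rewrite (_ : [seq _ | _ <- _] = L) // -[RHS](map_tnth_enum (in_tuple L)).
by apply: eq_map => i; rewrite perm1.
Qed.

Section AlternatingSort.
Variables (A : comNzRingType) (phi : seq 'I_n -> A).
Hypothesis alt_phi : alternating phi.

Lemma alternating_sort p q L :
  phi (p ++ L ++ q) = (eps L)%:~R * phi (p ++ row_sort L ++ q).
Proof.
have [e [L' pL' [se phiE]]] := alternating_normal_form L.
rewrite (phiE A) //.
have := phiE int (@eps n) eps_alternating [::] [::].
rewrite !cats0 /= intz => ->; case: se => [[_ ->]|[sL' _]]; first by rewrite !mul0r.
by rewrite (eps_std sL') mulr1 -(row_sort_perm pL') row_sort_id.
Qed.

Lemma alternating_nuniq L : ~~ uniq L -> phi L = 0.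
Proof.
move=> nu; have [e [L' pL' [se phiE]]] := alternating_normal_form L.
have := phiE A phi alt_phi [::] [::]; rewrite !cats0 /= => ->.
case: se => [[_ ->]|[/std_row_uniq]]; first by rewrite mul0r.
by rewrite (perm_uniq pL') (negPf nu).
Qed.

End AlternatingSort.

Lemma eps_nuniq L : ~~ uniq L -> eps L = 0.
Proof. exact/alternating_nuniq/eps_alternating. Qed.

Lemma eps_sqr L : uniq L -> eps L * eps L = 1.
Proof.
move=> uL; have [e [L' pL' [se phiE]]] := alternating_normal_form L.
have := phiE int (@eps n) eps_alternating [::] [::]; rewrite !cats0 /= => ->.
case: se => [[/negP//]|[sL' ee]]; by rewrite eps_std // mulr1 intz.
Qed.

Lemma eps_cat_sort L H : eps (L ++ H) = eps L * eps (row_sort L ++ H).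
Proof.
by have := alternating_sort eps_alternating [::] H L; rewrite /= intz.
Qed.

Lemma eps_cat_sortr L H : eps (L ++ H) = eps H * eps (L ++ row_sort H).
Proof.
by have := alternating_sort eps_alternating L [::] H; rewrite /= intz !cats0.
Qed.

Lemma eps_cons_min g L :
  all (fun b : 'I_n => (g < b)%N) L -> eps (g :: L) = eps L.
Proof.
move=> gL; have := eps_cat_sortr [:: g] L; rewrite /= => ->.
have [uL|/eps_nuniq ->] := boolP (uniq L); last by rewrite mul0r.
rewrite (@eps_std (g :: _)) ?mulr1 // std_row_cons std_row_sort uL andbT.
by rewrite (perm_all _ (perm_row_sort L)).
Qed.

(** Rearranging L multiplies both factors by the same sign, which squares to 1. *)
Lemma eps_mul_perm (A : comNzRingType) (phi : seq 'I_n -> A) p q r L H :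
  alternating phi -> perm_eq L H ->
  (eps (p ++ L))%:~R * phi (q ++ L ++ r)
  = (eps (p ++ H))%:~R * phi (q ++ H ++ r).
Proof.
move=> alt_phi pLH; have [uL|nuL] := boolP (uniq L); last first.
  rewrite !eps_nuniq ?mul0r // cat_uniq ?(perm_uniq pLH) -?(perm_uniq pLH);
  by rewrite (negPf nuL) !andbF.
rewrite eps_cat_sortr (eps_cat_sortr p H).
rewrite (alternating_sort alt_phi q r L) (alternating_sort alt_phi q r H).
rewrite (row_sort_perm pLH) !rmorphM /= mulrACA [RHS]mulrACA -!rmorphM /=.
by rewrite !eps_sqr // -(perm_uniq pLH).
Qed.

Fixpoint splits G : seq (seq 'I_n * seq 'I_n) :=
  if G is g :: G' then
    [seq (p.1, g :: p.2) | p <- splits G']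
    ++ [seq (g :: p.1, p.2) | p <- splits G']
  else [:: ([::], [::])].

Lemma mem_splits G H J : std_row G ->
  ((H, J) \in splits G) = [&& std_row H, std_row J & perm_eq (H ++ J) G].
Proof.
elim: G H J => [|g G IH] H J.
  rewrite /= inE => _; apply/eqP/and3P => [[-> ->] //|[_ _]].
  by move=> /perm_nilP; case: H; case: J.
rewrite std_row_cons => /andP[/allP gG sG] /=; rewrite mem_cat.
apply/orP/idP => [[] /mapP[[H' J']] /=|].
- rewrite IH // => /and3P[sH sJ pHJ] [-> ->]; rewrite sH std_row_cons sJ /=.
  rewrite andbT -[g :: J']/([:: g] ++ J') perm_catCA perm_cons pHJ andbT.
  by apply/allP => j jJ; apply: gG; rewrite -(perm_mem pHJ) mem_cat jJ orbT.
- rewrite IH // => /and3P[sH sJ pHJ] [-> ->]; rewrite sJ std_row_cons sH /=.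
  rewrite andbT perm_cons pHJ andbT.
  by apply/allP => j jJ; apply: gG; rewrite -(perm_mem pHJ) mem_cat jJ.
case/and3P=> sH sJ pHJ.
have head_min L : std_row L -> {subset L <= g :: G} -> g \in L ->
    exists2 L', L = g :: L' & std_row L'.
  case: L => // c L; rewrite std_row_cons => /andP[/allP cL sL] sub.
  rewrite inE => /predU1P[->|/cL cg]; first by exists L.
  have /predU1P[E|/gG gc] := sub c (mem_head _ _).
    by rewrite E ltnn in cg.
  by have := ltn_trans cg gc; rewrite ltnn.
have subH : {subset H <= g :: G}.
  by move=> x xH; rewrite -(perm_mem pHJ) mem_cat xH.
have subJ : {subset J <= g :: G}.
  by move=> x xH; rewrite -(perm_mem pHJ) mem_cat xH orbT.
have : g \in H ++ J by rewrite (perm_mem pHJ) mem_head.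
rewrite mem_cat => /orP[gH|gJ]; [right|left].
  have [H' eH sH'] := head_min H sH subH gH.
  apply/mapP; exists (H', J); rewrite ?eH // IH // sH' sJ /=.
  by rewrite -(perm_cons g); move: pHJ; rewrite eH.
have [J' eJ sJ'] := head_min J sJ subJ gJ.
apply/mapP; exists (H, J'); rewrite ?eJ // IH // sH sJ' /=.
by rewrite -(perm_cons g); move: pHJ;
  rewrite eJ -[g :: J']/([:: g] ++ J') perm_catCA.
Qed.

Lemma splits_uniq G : std_row G -> uniq (splits G).
Proof.
elim: G => // g G IH; rewrite std_row_cons => /andP[/allP gG sG] /=.
rewrite cat_uniq !map_inj_uniq ?IH //=; try by move=> [? ?] [? ?] [-> ->].
rewrite andbT; apply/hasPn => _ /mapP[[H J] _ ->] /=.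
apply/negP => /mapP[[H' J']]; rewrite mem_splits // => /and3P[_ _ p] [e _].
have : g \in G by rewrite -(perm_mem p) -e mem_cat mem_head.
by move/gG; rewrite ltnn.
Qed.

Lemma split_sum_splits (A : comNzRingType) G (phi : seq 'I_n -> seq 'I_n -> A) :
  std_row G ->
  split_sum G phi
  = \sum_(p <- splits G) (eps (p.1 ++ p.2))%:~R * phi p.1 p.2.
Proof.
elim: G phi => [|g G IH] phi; first by rewrite big_seq1 /= eps_std // mul1r.
rewrite std_row_cons => /andP[/allP gG sG] /=; rewrite big_cat !big_map !IH //=.
congr (_ + _); rewrite !big_seq; apply: eq_bigr => [[H J]];
  rewrite mem_splits // => /and3P[_ _ pHJ] /=.
  have := alternating_move [::] H g J eps_alternating; rewrite /= => ->.
  rewrite eps_cons_min; first by rewrite rmorphM rmorphXn rmorphN1; ring.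
  by apply/allP => x; rewrite (perm_mem pHJ); apply: gG.
rewrite eps_cons_min //.
by apply/allP => x; rewrite (perm_mem pHJ); apply: gG.
Qed.

End StandardRows.

(** * The pfaffian as a coefficient of an exterior power *)

Section PfaffianOfRows.

Lemma std_row_enum N (S : {set 'I_N}) : std_row (enum S).
Proof.
rewrite /enum_mem -enumT; apply: std_row_filter.
by rewrite /std_row val_enum_ord iota_ltn_sorted.
Qed.

Lemma sum_subset_split N (A : comNzRingType) (S : {set 'I_N})
    (psi : seq 'I_N -> seq 'I_N -> A) :
  \sum_(T : {set 'I_N} | T \subset S)
     (eps (enum T ++ enum (S :\: T)))%:~R * psi (enum T) (enum (S :\: T))
  = split_sum (enum S) psi.
Proof.
have stdS := std_row_enum S; rewrite split_sum_splits //.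
rewrite -(@big_reindex_seq _ _ _ (fun T : {set 'I_N} => T \subset S)
  (fun T => (enum T, enum (S :\: T))) (splits (enum S))
  (fun p => (eps (p.1 ++ p.2))%:~R * psi p.1 p.2)) //.
- exact: splits_uniq.
- move=> T U _ _ [e _]; apply/setP => x.
  by rewrite -[x \in T]mem_enum -[x \in U]mem_enum e.
- move=> T TS; rewrite mem_splits // !std_row_enum /=; apply: uniq_perm.
  + rewrite cat_uniq !enum_uniq andbT /=; apply/hasPn => x.
    by rewrite !mem_enum inE => /andP[].
  + exact: enum_uniq.
  move=> x; rewrite mem_cat !mem_enum inE.
  by have := subsetP TS x; case: (x \in T) => //= ->.
move=> [H J]; rewrite mem_splits // => /and3P[sH sJ pHJ].
have mE x : (x \in S) = (x \in H) || (x \in J).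
  by rewrite -[x \in S]mem_enum -(perm_mem pHJ) mem_cat.
have dHJ x : x \in H -> x \notin J.
  have := enum_uniq S; rewrite -(perm_uniq pHJ) cat_uniq => /and3P[_ /hasPn d _].
  by move=> xH; apply/negP => /d; rewrite xH.
exists [set x in H].
  by apply/subsetP => x; rewrite inE mE => ->.
congr (_, _); apply: std_row_mem_eq => //; rewrite ?std_row_enum // => x.
  by rewrite mem_enum inE.
by rewrite mem_enum !inE mE; have := dHJ x; case: (x \in H) => //= /(_ isT)/negPf.
Qed.

Definition pair_form (T : Type) (A : comNzRingType) (X : T -> T -> A)
  (s : seq T) : A := if s is [:: a; b] then X a b else 0.

Lemma pair_form_cons (T : Type) (A : comNzRingType) (X : T -> T -> A) g H :
  pair_form X (g :: H) = del_sum (X g) H (fun t => (nilp t)%:R).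
Proof.
case: H => [|a [|b H]] //=; first by rewrite mulr1 subr0.
rewrite mulr0 sub0r opprB mulr0 subr0.
by apply/esym; rewrite [LHS]del_sum0.
Qed.

(** A pfaffian is a signed sum over perfect matchings, and splitting off a pair H picks one of the
    |G|/2 edges of a matching. *)
Lemma split_sum_pair_form (T : Type) (A : comNzRingType) (X : T -> T -> A) G :
  ~~ odd (size G) ->
  split_sum G (fun H J => pair_form X H * rowpf X (fun=> 0) J)
  = (size G)./2%:R * rowpf X (fun=> 0) G.
Proof.
have [m] := ubnP (size G); elim: m G => // m IH [|g G] /= sm.
  by rewrite !mul0r.
rewrite negbK => oG.
(* If g stays in J, induction counts the edges avoiding g; the case of g in H adds the one remaining
   edge. *)
have e1 : split_sum G (fun H J => (-1) ^+ size H *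
            (pair_form X H * rowpf X (fun=> 0) (g :: J)))
    = (size G)./2%:R * rowpf X (fun=> 0) (g :: G).
  rewrite (eq_split_sum (psi := fun H J => (-1) ^+ size H *
            del_sum (X g) J (fun t => pair_form X H * rowpf X (fun=> 0) t))).
    rewrite split_sum_delr rowpf_cons mul0r mulr0 addr0 -del_sumZ.
    apply: eq_del_sum => t st; rewrite IH; first by rewrite -st /= uphalf_half;
      move: oG; rewrite -st /= => /negPf ->.
      by lia.
    by move: oG; rewrite -st.
  by move=> H J _; rewrite rowpf_cons mul0r mulr0 addr0 del_sumZ.
rewrite e1 (eq_split_sum (psi := fun H J =>
   del_sum (X g) H (fun t => (nilp t)%:R * rowpf X (fun=> 0) J))); last first.
  move=> H J _; rewrite -[Y in Y * _]/(pair_form X (g :: H)) pair_form_cons mulrC -del_sumZ.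
  by apply: eq_del_sum => t _; rewrite mulrC.
rewrite split_sum_dell (eq_del_sum _ (psi := rowpf X (fun=> 0))); last first.
  by move=> t _; rewrite split_sum_nil.
by rewrite uphalf_half oG natrD rowpf_cons mul0r mulr0 addr0 mulrDl mul1r addrC.
Qed.

Section ExteriorPower.
Variables (k N : nat) (X : 'M[{mpoly rat[k]}]_N).
Hypothesis XC : forall a b, X a b = - X b a.

Lemma ext_mul_genE (i j : 'I_N) (S : {set 'I_N}) :
  ext_mul (ext_gen _ i) (ext_gen _ j) S
  = split_sum (enum S) (fun H J => (H == [:: i])%:R * (J == [:: j])%:R)
    :> {mpoly rat[k]}.
Proof.
rewrite -sum_subset_split ffunE; apply: eq_bigr => T _; rewrite !ffunE mulrA.
have e (U : {set 'I_N}) (x : 'I_N) : (enum U == [:: x]) = (U == [set x]).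
  apply/eqP/eqP => [e|->]; last by rewrite enum_set1.
  by apply/setP => y; rewrite -mem_enum e !inE.
by rewrite !e.
Qed.

Lemma omegaE (S : {set 'I_N}) : omega X S = pair_form (fun a b => X a b) (enum S).
Proof.
rewrite ffunE.
have [eS|neS] := eqVneq (size (enum S)) 2; last first.
  rewrite big1 => [|i _]; last first.
    rewrite big1 // => j _; rewrite ext_mul_genE.
    rewrite (eq_split_sum (psi := fun _ _ => 0)) ?split_sum0 ?mulr0 //.
    move=> H J sHJ; case: eqP => [eH|_]; last by rewrite mul0r.
    case: eqP => [eJ|_]; last by rewrite mulr0.
    by rewrite eH eJ /= in sHJ; rewrite -sHJ in neS.
  by rewrite scaler0; case: (enum S) neS => [|a [|b [|c s]]].
case eE : (enum S) eS => [|a [|b [|c s]]] //= _.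
have bigX c d : \sum_i \sum_j X i j * ((c == i)%:R * (d == j)%:R) = X c d.
  rewrite (bigD1 c) //= (bigD1 d) //= !eqxx !mulr1 big1 ?addr0 ?big1 ?addr0 //.
    move=> i ic; rewrite big1 // => j _.
    by rewrite [c == i]eq_sym (negPf ic) mul0r mulr0.
  by move=> j jd; rewrite [d == j]eq_sym (negPf jd) !mulr0.
rewrite (eq_bigr (fun i => \sum_j X i j * ((a == i)%:R * (b == j)%:R)
    - \sum_j X i j * ((b == i)%:R * (a == j)%:R))); last first.
  move=> i _; rewrite -sumrB; apply: eq_bigr => j _.
  rewrite ext_mul_genE eE /= !eqseq_cons !andbT /=; ring.
rewrite sumrB !bigX [X b a]XC opprK -mulr2n -scaler_nat scalerA.
by rewrite mulVf ?scale1r // pnatr_eq0.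
Qed.

(** Each multiplication by [omega] contributes half the current cardinality, and these factors
    accumulate to the factorial. *)
Lemma ext_exp_omega m (S : {set 'I_N}) : #|S| = m.*2 ->
  ext_exp (omega X) m S = m`!%:R * rowpf (fun a b => X a b) (fun=> 0) (enum S).
Proof.
elim: m S => [|m IH] S cS.
  rewrite /ext_exp /= ffunE fact0 mul1r.
  have /size0nil -> : size (enum S) = 0%N by rewrite -cardE cS.
  by have -> : S = set0; [apply/eqP; rewrite -cards_eq0 cS|rewrite eqxx].
rewrite /ext_exp iterS -/(ext_exp _ m) ffunE.
rewrite (eq_bigr (fun T : {set 'I_N} => (eps (enum T ++ enum (S :\: T)))%:~R *
   (m`!%:R * (pair_form (fun a b => X a b) (enum T) *
              rowpf (fun a b => X a b) (fun=> 0) (enum (S :\: T)))))); last first.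
  move=> T TS; rewrite omegaE -mulrA; congr (_ * _).
  have [cT|cT] := eqVneq #|T| 2.
    rewrite IH; first by ring.
    rewrite cardsD (setIidPr TS) cT cS; lia.
  have -> : pair_form (fun a b => X a b) (enum T) = 0.
    by move: cT; rewrite cardE; case: (enum T) => [|a [|b [|c s]]].
  by rewrite !(mul0r, mulr0).
rewrite (sum_subset_split S (fun H J => m`!%:R * (pair_form (fun a b => X a b) H *
              rowpf (fun a b => X a b) (fun=> 0) J))).
rewrite split_sumZ split_sum_pair_form -cardE cS; last by rewrite odd_double.
by rewrite doubleK factS natrM; ring.
Qed.

End ExteriorPower.

Lemma gen_mxC (R : comNzRingType) N (a b : 'I_N) :
  gen_mx R N a b = - gen_mx R N b a.
Proof. by rewrite !mxE opprB. Qed.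

Lemma gen_mx0 (R : comNzRingType) N (a : 'I_N) : gen_mx R N a a = 0.
Proof. by rewrite mxE subrr. Qed.

Lemma map_gen_mx (R R' : comNzRingType) (rho : {rmorphism R -> R'}) N
    (a b : 'I_N) : map_mpoly rho (gen_mx R N a b) = gen_mx R' N a b.
Proof.
rewrite !mxE rmorphB /= /xvar; congr (_ - _).
  by case: insub => [p|]; rewrite ?rmorph0 //= map_mpolyX.
by case: insub => [p|]; rewrite ?rmorph0 //= map_mpolyX.
Qed.

Lemma generic_pfaffianE m :
  generic_pfaffian m
  = rowpf (fun a b => gen_mx int m.*2 a b) (fun=> 0) (enum 'I_m.*2).
Proof.
set q := RHS.
(* After the factorial cancels, the rational pfaffian is the base change of the integral q, and
   [numq] undoes the base change coefficientwise. *)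
have -> : generic_pfaffian m = map_mpoly numq (map_mpoly (intmul (1 : rat)) q).
  congr map_mpoly; rewrite /generic_pfaffian_rat (ext_exp_omega (@gen_mxC rat _));
    last by rewrite cardsT card_ord.
  rewrite -mul_mpolyC mulrA -mpolyC_nat -mpolyCM mulVf; last first.
    by rewrite pnatr_eq0 -lt0n fact_gt0.
  rewrite mul1r rowpf_rmorph enum_setT -enumT /=.
  by apply: eq_rowpf => [a b|a] /=; rewrite ?rmorph0 ?map_gen_mx.
have injr : injective (intmul (1 : rat)) by exact: intr_inj.
apply/mpolyP => mm.
rewrite [map_mpoly numq _]/map_mpoly /mmap.
rewrite (perm_big _ (msupp_map_mpoly q injr)) /=.
rewrite [in RHS](mpolyE q); congr (_@_mm); apply: eq_bigr => m' _.
by rewrite mcoeff_map_mpoly /= numq_int mmap1_id mul_mpolyC.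
Qed.

Lemma pfaffianE (A : comNzRingType) m (X : 'M[A]_(m.*2)) :
  (forall a b, X a b = - X b a) -> (forall a, X a a = 0) ->
  pfaffian X = rowpf (fun a b => X a b) (fun=> 0) (enum 'I_m.*2).
Proof.
move=> XC X0; rewrite /pfaffian generic_pfaffianE.
pose h (k : 'I_(nvars m.*2)) : A :=
  let p := val (enum_val k : upair m.*2) in X p.1 p.2.
rewrite -[mmap _ _ _]/(mmap (intmul 1) h _).
rewrite rowpf_rmorph; apply: eq_rowpf => [a b|a] /=; last by rewrite raddf0.
rewrite mxE raddfB /= /xvar.
have hE (p : upair m.*2) : mmap (intmul 1) h 'X_(enum_rank p)
    = X (val p).1 (val p).2.
  by rewrite mmapX mmap1U /h enum_rankK.
have [ab|ba|/ord_inj ab] := ltngtP a b.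
- rewrite insubT insubF /=; last by rewrite ltnNge ltnW.
  by rewrite hE mmap0 subr0.
- rewrite insubF /=; last by rewrite ltnNge ltnW.
  by rewrite insubT hE mmap0 sub0r [RHS]XC.
by rewrite ab subrr X0.
Qed.

Variables (R : comNzRingType) (n : nat).

Definition genX (i j : 'I_n) : {mpoly R[nvars n.+1]} :=
  gen_mx R n.+1 (widen_ord (leqnSn n) i) (widen_ord (leqnSn n) j).

Definition geny (i : 'I_n) : {mpoly R[nvars n.+1]} :=
  gen_mx R n.+1 (widen_ord (leqnSn n) i) ord_max.

Lemma pfE (I : seq 'I_n) : pf R I = rowpf genX geny I.
Proof.
rewrite -(rowpf_infty _ _ (fun a b => gen_mx R n.+1 a b)) -/(even_row I) /pf.
set c := even_row I.
have oc : ~~ odd (size c).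
  by rewrite /c /even_row size_cat size_map oddD; case: odd.
have sc : ((size c)./2.*2 = size c)%N by rewrite even_halfK.
rewrite pfaffianE; first last.
- by move=> a; rewrite mxE gen_mx0.
- by move=> a b; rewrite mxE gen_mxC [in RHS]mxE.
pose nthc (i : 'I_(size c)./2.*2) := nth ord_max c i.
have -> : rowpf (fun a b => gen_mx R n.+1 a b) (fun=> 0) c
    = rowpf (fun a b => gen_mx R n.+1 a b) (fun=> 0) (map nthc (enum 'I_(size c)./2.*2)).
  congr rowpf; rewrite -[LHS](mkseq_nth ord_max) /mkseq -{1}sc -val_enum_ord.
  by rewrite -map_comp.
by rewrite rowpf_map; apply: eq_rowpf => [a b|] //; rewrite mxE.
Qed.

End PfaffianOfRows.

(** * The shuffling relation for K empty *)

Section BaseIdentity.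
Variables (T : Type) (A : comNzRingType) (X : T -> T -> A) (y : T -> A) (v : A).
Implicit Types (G I H J : seq T) (e o a f : A).
Let x := rowpf X y.

Definition parity_weight (b : bool) H : A :=
  (odd (size H) == b)%:R * v ^+ (size H)./2.

(* Writing F(t) for the sum of eps (H ++ J) t^|H| x (J ++ I) x (H) over all
   splittings of G, parity_split false and parity_split true are its even part
   and its odd part divided by t, as functions of v = t^2. *)
Definition parity_split b G I : A :=
  split_sum G (fun H J => parity_weight b H * (x (J ++ I) * x H)).

(** The partner of g is another shuffled entry, an entry of I, or oo. In the first case g may lie in
    J or in H; the second choice enlarges H by two entries, whence 1 + v. The y-terms mix the two
    parities: if g and oo are paired inside H, the remaining H is even. *)
Lemma parity_split_cons b g G I :
  parity_split b (g :: G) I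
  = (1 + v) * del_sum (X g) G (parity_split b ^~ I)
    + (-1) ^+ size G * del_sum (X g) I (parity_split b G)
    + y g * ((if b then parity_split false G I else 0)
             + (b == odd (size G + size I))%:R
               * ((-1) ^+ b * parity_split b G I)).
Proof.
have pairJ : split_sum G (fun H J => (-1) ^+ size H *
      del_sum (X g) J (fun t => parity_weight b H * (x (t ++ I) * x H)))
    = del_sum (X g) G (parity_split b ^~ I) by rewrite split_sum_delr.
have pairH : split_sum G (fun H J => parity_weight b (g :: H) *
      (x (J ++ I) * del_sum (X g) H x))
    = v * del_sum (X g) G (parity_split b ^~ I).
  rewrite -[del_sum _ _ (parity_split b ^~ I)]split_sum_dell -split_sumZ.
  apply: eq_split_sum => H J _; rewrite mulrA -!del_sumZ; apply: eq_del_sum.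
  by move=> t st; rewrite /parity_weight /= -st /= negbK exprS; ring.
have pairI : split_sum G (fun H J => (-1) ^+ size G *
      del_sum (X g) I (fun t => parity_weight b H * (x (J ++ t) * x H)))
    = (-1) ^+ size G * del_sum (X g) I (parity_split b G).
  by rewrite split_sumZ split_sum_del.
have singleH : split_sum G (fun H J => parity_weight b (g :: H) *
      (x (J ++ I) * ((~~ odd (size H))%:R * (y g * x H))))
    = y g * (if b then parity_split false G I else 0).
  case: b {pairJ pairH pairI} => /=; last first.
    rewrite mulr0 -[RHS](split_sum0 _ G); apply: eq_split_sum => H J _.
    by rewrite /parity_weight /=; case: odd => /=; ring.
  rewrite -split_sumZ; apply: eq_split_sum => H J _.
  by rewrite /parity_weight /= uphalf_half; case: odd => /=; ring.
have singleJ : split_sum G (fun H J => (-1) ^+ size H * (parity_weight b H *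
      (((~~ odd (size (J ++ I)))%:R * (y g * x (J ++ I))) * x H)))
    = y g * ((b == odd (size G + size I))%:R * ((-1) ^+ b * parity_split b G I)).
  rewrite !mulrA -split_sumZ; apply: eq_split_sum => H J <-.
  rewrite /parity_weight size_cat -signr_odd !oddD.
  by case: odd; case: odd; case: odd; case: (b); rewrite /=; ring.
rewrite mulrDr -singleH -singleJ [(1 + v) * _]mulrDl mul1r -pairH -{}pairJ -pairI.
rewrite -!split_sumD [LHS]/parity_split /= -split_sumD.
apply: eq_split_sum => H J s.
rewrite /x !rowpf_cons del_sum_cat -/x !del_sumZ.
by rewrite !del_sumZr -s exprD; ring.
Qed.

Definition divis_pair u e o : Prop :=
  exists f0 f1, e = (1 + v) ^+ u * f0 /\ o = (1 + v) ^+ u * f1.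

(** The term a is shared by e and o, so that e - o is divisible by one more power of 1 + v. *)
Definition congr_pair u e o : Prop :=
  exists a f0 f1, e = (1 + v) ^+ u * a + (1 + v) ^+ u.+1 * f0 /\
                  o = (1 + v) ^+ u * a + (1 + v) ^+ u.+1 * f1.

Definition pair_module (M : A -> A -> Prop) : Prop :=
  [/\ M 0 0, forall e o e' o', M e o -> M e' o' -> M (e + e') (o + o')
    & forall c e o, M e o -> M (c * e) (c * o)].

Lemma divis_pair_module u : pair_module (divis_pair u).
Proof.
split=> [|_ _ _ _ [f0 [f1 [-> ->]]] [g0 [g1 [-> ->]]]|c _ _ [f0 [f1 [-> ->]]]].
- by exists 0, 0; rewrite !mulr0.
- by exists (f0 + g0), (f1 + g1); split; rewrite ?exprS; ring.
by exists (c * f0), (c * f1); split; rewrite ?exprS; ring.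
Qed.

Lemma congr_pair_module u : pair_module (congr_pair u).
Proof.
split=> [|_ _ _ _ [a [f0 [f1 [-> ->]]]] [d [g0 [g1 [-> ->]]]]|
  c _ _ [a [f0 [f1 [-> ->]]]]].
- by exists 0, 0, 0; rewrite !mulr0 addr0.
- by exists (a + d), (f0 + g0), (f1 + g1); split; rewrite ?exprS; ring.
by exists (c * a), (c * f0), (c * f1); split; rewrite ?exprS; ring.
Qed.

Lemma del_sum_module M (f : T -> A) s (phi psi : seq T -> A) :
  pair_module M -> (forall t, (size t).+1 = size s -> M (phi t) (psi t)) ->
  M (del_sum f s phi) (del_sum f s psi).
Proof.
case=> M0 MD MZ; elim: s phi psi => [|b s IH] phi psi //= h.
apply: MD; first by apply/MZ/h.
rewrite -[X in M X _]mulN1r -[X in M _ X]mulN1r; apply: MZ; apply: IH => t st.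
by apply: h; rewrite /= st.
Qed.

(** At most |I| shuffled entries can be paired with I, so an excess of |G| over |I| forces pairs
    inside G, each giving 1 + v. The index oo disturbs this count, which is why both parities of the
    excess go through one induction. *)
Lemma parity_splitP G I u :
  (size G = size I + u.*2 ->
   divis_pair u (parity_split false G I) (parity_split true G I))%N /\
  (size G = size I + u.*2.+1 ->
   congr_pair u (parity_split false G I) (parity_split true G I))%N.
Proof.
have [m] := ubnP (size G); elim: m G I u => // m IH [|g G] I u /= sm.
  split; last by lia.
  case: u => [_|u]; last by lia.
  by exists (parity_split false [::] I), (parity_split true [::] I);
    rewrite expr0 !mul1r.
split=> sG.
  case: u sG => [|u] sG.
    by exists (parity_split false (g :: G) I), (parity_split true (g :: G) I);
      rewrite expr0 !mul1r.
  have [M0 MD MZ] := divis_pair_module u.+1.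
  rewrite !parity_split_cons; apply: (MD); first apply: (MD).
  - have : divis_pair u (del_sum (X g) G (parity_split false ^~ I))
                        (del_sum (X g) G (parity_split true ^~ I)).
      apply: del_sum_module => [|t st]; first exact: divis_pair_module.
      by have [+ _] := IH t I u ltac:(lia); apply; lia.
    by case=> f0 [f1 [-> ->]]; exists f0, f1; split; rewrite ?exprS; ring.
  - apply: MZ; apply: del_sum_module => [|t st]; first exact: divis_pair_module.
    by have [+ _] := IH G t u.+1 ltac:(lia); apply; lia.
  (* For odd total length the y-terms are 0 and a multiple of e - o; the shared part of the
     congruence cancels there. *)
  - have -> : odd (size G + size I) by lia.
    rewrite /= mul0r addr0 mul1r mulN1r; apply: MZ.
    have [_ /(_ ltac:(lia))[a [f0 [f1 [-> ->]]]]] := IH G I u ltac:(lia).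
    by exists 0, (f0 - f1); split; rewrite ?exprS; ring.
have [M0 MD MZ] := congr_pair_module u.
rewrite !parity_split_cons; apply: (MD); first apply: (MD).
- case: u sG {M0 MD MZ} => [|u] sG.
    by exists 0, (del_sum (X g) G (parity_split false ^~ I)),
      (del_sum (X g) G (parity_split true ^~ I)); split; rewrite ?exprS; ring.
  have : congr_pair u (del_sum (X g) G (parity_split false ^~ I))
                      (del_sum (X g) G (parity_split true ^~ I)).
    apply: del_sum_module => [|t st]; first exact: congr_pair_module.
    by have [_] := IH t I u ltac:(lia); apply; lia.
  by case=> a [f0 [f1 [-> ->]]]; exists a, f0, f1; split; rewrite ?exprS; ring.
- apply: MZ; apply: del_sum_module => [|t st]; first exact: congr_pair_module.
  by have [_] := IH G t u ltac:(lia); apply; lia.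
(* For even total length both components receive the same multiple of e; this creates the shared
   term a. *)
have -> : odd (size G + size I) = false by lia.
rewrite /= mul0r addr0 add0r !mul1r; apply: MZ.
have [/(_ ltac:(lia))[f0 [f1 [-> _]]] _] := IH G I u ltac:(lia).
by exists f0, 0, 0; split; rewrite ?exprS; ring.
Qed.

End BaseIdentity.

(** * Inverse powers of 1 + t and Gaussian binomials at -1 *)

Section InversePowers.
Variable A : comNzRingType.
Implicit Types (p q f : {poly A}).

(* The coefficient of t^w in the power series p / (1 + t)^u. *)
Definition inv_coef u w p : A :=
  \sum_(m < w.+1) (-1) ^+ m * 'C((u + m).-1, m)%:R * p`_(w - m).

Lemma inv_coefD u w p q : inv_coef u w (p + q) = inv_coef u w p + inv_coef u w q.
Proof. by rewrite -big_split; apply: eq_bigr => m _; rewrite coefD mulrDr. Qed.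

Lemma inv_coef0 u p : inv_coef u 0 p = p`_0.
Proof. by rewrite /inv_coef big_ord1 bin0 !mul1r. Qed.

Lemma inv_coefS u w p :
  inv_coef u.+1 w.+1 p = inv_coef u w.+1 p - inv_coef u.+1 w p.
Proof.
rewrite /inv_coef big_ord_recl [X in _ = X - _]big_ord_recl !bin0 -addrA.
congr (_ + _); rewrite -sumrB; apply: eq_bigr => i _.
rewrite /= /bump !add1n !addnS !subSS ?addSn /= binS natrD exprS; ring.
Qed.

Lemma inv_coefM u w f : inv_coef u w ((1 + 'X) ^+ u * f) = f`_w.
Proof.
elim: u w f => [|u IH] w f.
  rewrite /inv_coef big_ord_recl big1 ?addr0 => [|i _].
    by rewrite !mul1r subn0.
  by rewrite /= /bump add1n add0n bin_small // mulr0 mul0r.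
elim: w => [|w IHw].
  rewrite inv_coef0 coef0M.
  suff -> : ((1 + 'X) ^+ u.+1 : {poly A})`_0 = 1 by rewrite mul1r.
  elim: u.+1 => [|k IHk]; first by rewrite coef1.
  by rewrite exprS coef0M IHk coefD coef1 coefX addr0 mul1r.
by rewrite inv_coefS IHw exprSr -mulrA IH mulrDl mul1r coefD coefXM /= addrK.
Qed.

Lemma inv_coefC u w (a : A) :
  inv_coef u.+1 w ((1 + 'X) ^+ u * a%:P) = (-1) ^+ w * a.
Proof.
elim: w => [|w IH].
  by rewrite inv_coef0 -(inv_coef0 u) inv_coefM coefC mul1r.
by rewrite inv_coefS IH inv_coefM coefC exprS sub0r mulN1r mulNr.
Qed.

Lemma size_1X_expM u f : f != 0 -> size ((1 + 'X) ^+ u * f) = (u + size f)%N.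
Proof.
move=> nf; have mon : (1 + 'X : {poly A}) \is monic.
  by rewrite addrC -polyC1 monicXaddC.
elim: u => [|u IH]; first by rewrite mul1r.
rewrite exprS -mulrA size_monicM //; last by rewrite -size_poly_eq0 IH;
  rewrite addn_eq0 negb_and size_poly_eq0 nf orbT.
by rewrite IH addrC -polyC1 size_XaddC.
Qed.

(** Since 1 + X is monic, even over a ring with zero divisors the degree of f is exactly u below
    that of the product. *)
Lemma coef_1X_expM_eq0 u K f w :
  (forall m, (K <= m)%N -> ((1 + 'X) ^+ u * f)`_m = 0) -> (K <= w + u)%N ->
  f`_w = 0.
Proof.
move=> h Kw; apply: nth_default; case: (eqVneq f 0) => [->|nf].
  by rewrite size_poly0.
rewrite leqNgt; apply/negP => lt.
have : lead_coef ((1 + 'X) ^+ u * f) = 0.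
  rewrite lead_coefE h // size_1X_expM //.
  by move: (size f) lt Kw => sf lt Kw; lia.
move/eqP; rewrite lead_coef_eq0 -size_poly_eq0 size_1X_expM // addn_eq0.
by rewrite size_poly_eq0 (negPf nf) andbF.
Qed.

Lemma big_ord_even_odd (F : nat -> A) n :
  \sum_(h < n) F h
  = \sum_(m < uphalf n) F m.*2 + \sum_(m < n./2) F m.*2.+1.
Proof.
elim: n => [|n IH]; first by rewrite !big_ord0 addr0.
have nE := odd_double_half n; rewrite big_ord_recr /= IH uphalf_half.
case: (odd n) nE => /= nE; rewrite ?add1n ?add0n.
  by rewrite [X in _ = _ + X]big_ord_recr /= addrA; congr (_ + F _); rewrite -{1}nE.
by rewrite [X in _ = X + _]big_ord_recr /= addrAC; congr (_ + F _ + _); rewrite -{1}nE.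
Qed.

End InversePowers.

Section GaussianBinomials.

(** The q-Pascal recursion, which can be evaluated at -1, where the denominator in [qbinom] may
    vanish. *)
Fixpoint gauss m k : {poly int} :=
  match m, k with
  | _, 0 => 1
  | 0, _.+1 => 0
  | m'.+1, k'.+1 => gauss m' k' + 'X^k * gauss m' k
  end.

Let num m k : {poly int} := \prod_(i < k) (1 - 'X^(m - i)).

Let num_gt m k : (m < k)%N -> num m k = 0.
Proof.
by move=> mk; rewrite /num (bigD1 (Ordinal mk)) //= subnn expr0 subrr mul0r.
Qed.

Lemma gauss_prod m k : num m k = gauss m k * num k k.
Proof.
elim: m k => [|m IH] [|k]; rewrite ?mul1r //.
- by rewrite num_gt //= mul0r.
- by rewrite /num !big_ord0.
have numS a b : num a.+1 b.+1 = (1 - 'X^(a.+1)) * num a b.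
  by rewrite /num big_ord_recl subn0.
have numSr : num m k.+1 = num m k * (1 - 'X^(m - k)).
  by rewrite /num big_ord_recr.
rewrite /= mulrDl -['X^(k.+1) * _ * _]mulrA -IH numSr !numS mulrCA -IH.
have [km|mk] := leqP k m; last by rewrite num_gt // !mulr0 mul0r mulr0 addr0.
have -> : 'X^(m.+1) = 'X^(k.+1) * 'X^(m - k) :> {poly int}.
  by rewrite -exprD addSn subnKC.
ring.
Qed.

Lemma qbinomE m k : qbinom m k = gauss m k.
Proof.
rewrite /qbinom -/(num m k) -/(num k k) gauss_prod Pdiv.IdomainUnit.mulpK //.
rewrite /num lead_coef_prod; apply: rpred_prod => i _.
rewrite -opprB lead_coefN unitrN.
by rewrite lead_coefXnsubC ?unitr1 // subn_gt0.
Qed.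

(** The case q = -1 of the q-Lucas theorem. *)
Lemma gauss_N1 m k :
  (gauss m k).[-1] = if ~~ odd m && odd k then 0 else 'C(m./2, k./2)%:R.
Proof.
elim: m k => [|m IH] [|k].
- by rewrite /= hornerC.
- rewrite /= horner0; case: ifP => // /negbT; rewrite negbK => ok.
  by rewrite bin_small // uphalf_gt0; case: k ok.
- by rewrite /= hornerC andbF bin0.
rewrite /= hornerD hornerM hornerXn !IH /= exprS -[(-1) ^+ k]signr_odd.
rewrite !uphalf_half; case om: (odd m); case ok: (odd k) => /=.
- by rewrite !add1n binS natrD; ring.
- by rewrite !add0n; ring.
- by rewrite !add0n !add1n; ring.
by rewrite !add0n; ring.
Qed.

(** These are the coefficients of t^h in 1 / (1 + t^2)^(s./2 + 1), multiplied by 1 - t when s is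
    even. *)
Definition kappa s h : int := (-1) ^+ (h * h.+1)./2 * (qbinom (s + h) h).[-1].

Lemma kappa_even s m : kappa s m.*2 = (-1) ^+ m * 'C(s./2 + m, m)%:R.
Proof.
rewrite /kappa qbinomE gauss_N1 odd_double andbF halfD odd_double andbF add0n.
rewrite !doubleK -doubleMl doubleK -signr_odd oddM /= odd_double andbT.
by rewrite signr_odd.
Qed.

Lemma kappa_odd s m :
  kappa s m.*2.+1 = if odd s then 0 else - ((-1) ^+ m * 'C(s./2 + m, m)%:R).
Proof.
have e : ((m.*2.+1 * m.*2.+2)./2 = m.*2.+1 * m.+1)%N.
  by rewrite -doubleS -doubleMr doubleK.
have sE : (-1) ^+ (m.*2.+1 * m.+1) = - (-1) ^+ m :> int.
  rewrite -signr_odd oddM /= odd_double /= -[in RHS]signr_odd.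
  by case: (odd m).
rewrite /kappa e sE qbinomE gauss_N1 addnS /= oddD odd_double /= addbF negbK andbT.
case: ifP => os; first by rewrite mulr0.
rewrite uphalf_half oddD odd_double os add0n halfD odd_double andbF add0n.
by rewrite doubleK uphalf_double mulNr.
Qed.

End GaussianBinomials.

Lemma split_sum_raddf (T : Type) (A B : comNzRingType) (rho : {additive A -> B})
    (G : seq T) (phi : seq T -> seq T -> A) :
  rho (split_sum G phi) = split_sum G (fun H J => rho (phi H J)).
Proof.
elim: G phi => [|g G IH] phi //=; rewrite raddfD !IH; congr (_ + _).
apply: eq_split_sum => H J _.
by rewrite -signr_odd -[in RHS]signr_odd; case: odd;
  rewrite ?mulN1r ?raddfN ?mul1r.
Qed.

Lemma split_sum_sum (T : Type) (A : comNzRingType) (G : seq T) m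
    (phi : 'I_m -> seq T -> seq T -> A) :
  \sum_(i < m) split_sum G (phi i)
  = split_sum G (fun H J => \sum_(i < m) phi i H J).
Proof.
elim: m phi => [|m IH] phi.
  rewrite big_ord0 -[LHS](split_sum0 A G); apply: eq_split_sum => H J _.
  by rewrite big_ord0.
rewrite big_ord_recl IH -split_sumD; apply: eq_split_sum => H J _.
by rewrite big_ord_recl.
Qed.

Section BaseRelation.
Variables (T : Type) (A : comNzRingType) (X : T -> T -> A) (y : T -> A).
Implicit Types (G I H J : seq T).
Let x := rowpf X y.

Definition size_part k G I : A :=
  split_sum G (fun H J => (size H == k)%:R * (x (J ++ I) * x H)).

Let Xp a b : {poly A} := (X a b)%:P.
Let yp a : {poly A} := (y a)%:P.

Lemma coef_parity_split b G I m :
  (parity_split Xp yp 'X b G I)`_m = size_part (m.*2 + b)%N G I.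
Proof.
rewrite -[LHS]/(coefp m _) split_sum_raddf; apply: eq_split_sum => H J _ /=.
rewrite -[rowpf Xp yp (J ++ I)](rowpf_rmorph polyC X y) /=.
rewrite -[rowpf Xp yp H](rowpf_rmorph polyC X y) /= -polyCM coefMC.
congr (_ * _); rewrite /parity_weight -polyC_natr coefCM coefXn -natrM mulnb.
congr ((nat_of_bool _)%:R); rewrite -[in RHS](odd_double_half (size H)) addnC.
case: (b) (odd (size H)) => -[] /=; rewrite ?addn1 ?addn0; lia.
Qed.

Lemma size_part_gt k G I : (size G < k)%N -> size_part k G I = 0.
Proof.
move=> lt; rewrite -(split_sum0 A G); apply: eq_split_sum => H J s.
by rewrite eqn_leq leqNgt [(k <= _)%N]leqNgt; case: ltngtP => //; rewrite ?mul0r //; lia.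
Qed.

(** The left side is, up to sign, the coefficient of t^(r+1), with r = |I|, in F times the series of
    the [kappa s h] at t or -t, according to the parity of r. Divisibility makes the relevant part a
    polynomial of too small a degree. *)
Lemma size_part_relation s G I : size G = (size I + s.+1)%N ->
  \sum_(h < (size I).+2) (kappa s h)%:~R * (-1) ^+ (size I * (s + h))
     * size_part ((size I).+1 - h)%N G I = 0.
Proof.
move=> sG; set r := size I in sG *; set N := size G in sG.
pose F (b : bool) := parity_split Xp yp 'X b G I.
have FE b m : (F b)`_m = size_part (m.*2 + b)%N G I by apply: coef_parity_split.
have Fgt (b : bool) m : (N < m.*2 + b)%N -> (F b)`_m = 0.
  by move=> lt; rewrite FE size_part_gt.
pose g (h : nat) : A := (kappa s h)%:~R * (-1) ^+ (r * (s + h)) * size_part (r.+1 - h)%N G I.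
have rE := odd_double_half r.
have urE : uphalf r = (odd r + r./2)%N by rewrite uphalf_half.
rewrite -[LHS]/(\sum_(h < r.+2) g h) big_ord_even_odd /=.
(* As |H| = r + 1 - h, even h meet the parity class of r + 1 and odd h that of r. *)
have -> : \sum_(m < (uphalf r).+1) g m.*2
    = (-1) ^+ (r * s) * inv_coef (s./2).+1 (uphalf r) (F (~~ odd r)).
  rewrite mulr_sumr; apply: eq_bigr => m _; rewrite /g kappa_even FE.
  have -> : ((uphalf r - m).*2 + ~~ odd r = r.+1 - m.*2)%N.
    move: (nat_of_ord m) (ltn_ord m) rE urE => k.
    by case: (odd r) => /=; move: (uphalf r) (r./2) => a b; lia.
  rewrite -[(-1) ^+ (r * (s + _))]signr_odd oddM oddD odd_double addbF -oddM.
  by rewrite signr_odd rmorphM /= rmorph_sign rmorph_nat ?addSn /=; ring.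
have -> : \sum_(m < (r./2).+1) g m.*2.+1 =
    if odd s then 0 else
    - (-1) ^+ r * inv_coef (s./2).+1 r./2 (F (odd r)).
  case: ifP => os.
    by rewrite big1 // => m _; rewrite /g kappa_odd os mul0r mul0r.
  rewrite mulr_sumr; apply: eq_bigr => m _; rewrite /g kappa_odd os FE.
  have -> : ((r./2 - m).*2 + odd r = r.+1 - m.*2.+1)%N.
    move: (nat_of_ord m) (ltn_ord m) rE => k.
    by case: (odd r) => /=; move: (r./2) => b; lia.
  rewrite -[(-1) ^+ (r * (s + _))]signr_odd oddM oddD /= odd_double os andbT.
  by rewrite signr_odd rmorphN rmorphM /= rmorph_sign rmorph_nat ?addSn /=; ring.
(* The excess of |G| over |I| is s + 1, and u is half of it, rounded down. *)
have [divP congP] := parity_splitP Xp yp 'X G I (s./2 + odd s).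
have sE := odd_double_half s.
case os: (odd s) sE => sE /=.
  have {congP} [f0 [f1 [F0 F1]]] := divP ltac:(rewrite -/r -/N sG; lia).
  (* The series is here the polynomial f: sizes of H bound the degree of [F b], and the division
     lowers it by s./2 + 1. *)
  have zero (b : bool) w f : F b = (1 + 'X) ^+ (s./2).+1 * f -> (r < w.*2 + b)%N ->
      inv_coef (s./2).+1 w (F b) = 0.
    move=> eF rw; rewrite eF inv_coefM.
    apply: (@coef_1X_expM_eq0 _ (s./2).+1 (w + (s./2).+1)) => // m lem.
    by rewrite -eF Fgt // sG; lia.
  rewrite addr0 os addn1 in F0 F1 *.
  have [f eF] : exists f, F (~~ odd r) = (1 + 'X) ^+ (s./2).+1 * f.
    by case: (odd r); [exists f0|exists f1].
  by rewrite (zero _ _ _ eF) ?mulr0 //; case: (odd r) rE urE => /=; lia.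
rewrite os addn0 in divP congP.
have {divP} [a [f0 [f1 [F0 F1]]]] := congP ltac:(rewrite -/r -/N sG; lia).
(* Only the value of a at -1 matters; the difference is a multiple of 1 + X and joins the higher
   power. *)
have [a0 [a1 aE]] : exists a0 a1, a = a0%:P + (1 + 'X) * a1.
  exists a.[-1]; have /factor_theorem[q qE] : root (a - a.[-1]%:P) (-1).
    by rewrite rootE !hornerE subrr.
  exists q; rewrite -[LHS](subrK a.[-1]%:P) qE rmorphN opprK; ring.
have {F0 F1 f0 f1} [f FbE] : exists f, forall b : bool,
    F b = (1 + 'X) ^+ s./2 * a0%:P + (1 + 'X) ^+ (s./2).+1 * f b.
  exists (fun b => if b then f1 + a1 else f0 + a1) => -[].
    by rewrite /F F1 aE exprS; ring.
  by rewrite /F F0 aE exprS; ring.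
have coefE (b : bool) w : (r <= w.*2 + b)%N ->
    inv_coef (s./2).+1 w (F b) = (-1) ^+ w * a0.
  move=> rw; rewrite FbE inv_coefD inv_coefC inv_coefM.
  rewrite (@coef_1X_expM_eq0 _ (s./2).+1 (w + (s./2).+1) (f b)) ?addr0 // => m lem.
  have -> : (1 + 'X) ^+ (s./2).+1 * f b = F b - (1 + 'X) ^+ s./2 * a0%:P.
    by rewrite FbE [X in _ = X - _]addrC addrK.
  rewrite coefB Fgt ?sub0r; last by rewrite sG; lia.
  rewrite nth_default ?oppr0 //; have [->|na] := eqVneq a0%:P 0.
    by rewrite mulr0 size_poly0.
  by rewrite size_1X_expM //; have := size_polyC_leq1 a0; move: (size a0%:P); lia.
(* In these degrees both series coincide with a0 / (1 + X), whose coefficients alternate; the sums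
   over even and odd h cancel. *)
rewrite !coefE; first last.
- by case: (odd r) rE urE => /=; lia.
- by rewrite -{1}rE; lia.
rewrite urE -signr_odd oddM os andbF -[(-1) ^+ r]signr_odd.
by case: (odd r) => /=; rewrite ?add0n ?add1n ?exprS; ring.
Qed.

End BaseRelation.

(** * The general shuffling relation *)

Section Relations.
Variables (n : nat) (A : comNzRingType).
Variables (X : 'I_n -> 'I_n -> A) (y : 'I_n -> A).
Hypothesis XC : forall a b, X a b = - X b a.
Hypothesis X0 : forall a, X a a = 0.
Implicit Types (G H I J K L Z P Q : seq 'I_n) (l : seq (int * seq 'I_n * seq 'I_n)).
Let x := rowpf X y.

(** The test encodes |H'| <= |H|; truncated subtraction alone would give [kappa s 0], that is 1,
    beyond it. *)
Definition rel_coef s r h : int := if (h <= r)%N then kappa s (r - h)%N else 0.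

Lemma split_relation s G I : size G = (size I + s.+1)%N ->
  split_sum G (fun H J => (rel_coef s (size I).+1 (size H))%:~R
                          * (x (I ++ J) * x H)) = 0.
Proof.
move=> sG; rewrite -[RHS](size_part_relation X y sG).
under eq_bigr do rewrite /size_part -split_sumZ.
rewrite split_sum_sum; apply: eq_split_sum => H J sHJ.
under eq_bigr do rewrite mulrA.
rewrite -mulr_suml.
(* With h = |I| + 1 - |H|, the number s + h is |J|, so this sign cancels the one in
   [size_part_relation]. *)
have /= -> := alternating_catC [::] I J (rowpf_alternating y XC X0).
rewrite -/x -[(_ * x _) * x H]mulrA [RHS]mulrA; congr (_ * _).
rewrite /rel_coef; case: leqP => [le|gt].
  have lt : ((size I).+1 - size H < (size I).+2)%N by lia.
  rewrite (bigD1 (Ordinal lt)) //= big1 ?addr0 => [|i ni].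
    rewrite subKn // eqxx mulr1 (_ : (s + _ = size J)%N); last by lia.
    by rewrite -mulrA -exprD addnn -signr_odd odd_double mulr1.
  case: eqP => [e|_]; last by rewrite mulr0.
  by case/eqP: ni; apply: val_inj => /=; have := ltn_ord i; lia.
rewrite big1 ?mul0r // => i _.
by case: eqP => [e|_]; rewrite ?mulr0 //; have := ltn_ord i; lia.
Qed.

Definition rel_sum l : A := \sum_(t <- l) t.1.1%:~R * (x t.1.2 * x t.2).

Variable d : 'I_n -> {additive A -> A}.
Hypothesis dM : forall k u v, d k (u * v) = d k u * v + u * d k v.
Hypothesis dX : forall k a b, d k (X a b) = y a * X b k - y b * X a k.
Hypothesis dy : forall k a, d k (y a) = X a k - y a * y k.
Hypothesis reg2 : forall u : A, u *+ 2 = 0 -> u = 0.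

Lemma rel_sum_extend k l : rel_sum l = 0 ->
  rel_sum ([seq (t.1.1, rcons t.1.2 k, t.2) | t <- l] ++
           [seq (t.1.1, t.1.2, rcons t.2 k) | t <- l]) = 0.
Proof.
move=> rl.
have dx L : d k (x L) = x (rcons L k) - y k * x L.
  by apply: deriv_rowpf => //; apply: raddfB.
have dz z u : d k (z%:~R * u) = z%:~R * d k u.
  by rewrite mulrzl raddfMz mulrzl.
(* Each of the two factors of a product contributes a correction -y_k, hence the coefficient 2. *)
have : d k (rel_sum l) + 2%:R * y k * rel_sum l = 0.
  by rewrite rl raddf0 mulr0 addr0.
move=> <-; rewrite /rel_sum big_cat !big_map /= raddf_sum /= mulr_sumr.
rewrite -!big_split /=; apply: eq_bigr => t _.
rewrite dz dM !dx; ring.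
Qed.

Lemma rel_sum_cat l l' : rel_sum (l ++ l') = rel_sum l + rel_sum l'.
Proof. exact: big_cat. Qed.

(* Extending twice by z, the terms with z twice in a row vanish, and the other
   ones occur twice. *)
Lemma rel_sum_extend2 z l : rel_sum l = 0 ->
  rel_sum [seq (t.1.1, rcons t.1.2 z, rcons t.2 z) | t <- l] = 0.
Proof.
move=> /(rel_sum_extend z)/(rel_sum_extend z) r0; apply: reg2.
rewrite -r0 mulr2n !map_cat !rel_sum_cat /rel_sum -!map_comp !big_map /=.
have [_ xx] := rowpf_alternating y XC X0.
rewrite [X in _ = X + _ + _]big1 => [|t _]; last first.
  by rewrite -cats1 -cats1 -catA /x xx mul0r mulr0.
rewrite [X in _ = _ + (_ + X)]big1 ?add0r ?addr0 => [//|t _].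
by rewrite -!cats1 -catA /x xx !mulr0.
Qed.

Lemma rel_sum_extend2_seq Z l : rel_sum l = 0 ->
  rel_sum [seq (t.1.1, t.1.2 ++ Z, t.2 ++ Z) | t <- l] = 0.
Proof.
elim: Z l => [|z Z IH] l r0.
  rewrite (_ : map _ l = l) // -[RHS]map_id; apply: eq_map => -[[c P] Q].
  by rewrite !cats0.
rewrite -[RHS](IH _ (rel_sum_extend2 z r0)) -map_comp; congr rel_sum.
by apply: eq_map => t /=; rewrite !cat_rcons.
Qed.

Lemma rel_sum_extend_seq K l : rel_sum l = 0 ->
  \sum_(t <- l) \sum_(q <- splits K)
    t.1.1%:~R * (x (t.1.2 ++ q.1) * x (t.2 ++ q.2)) = 0.
Proof.
elim: K l => [|k K IH] l r0.
  by rewrite -[RHS]r0; apply: eq_bigr => t _; rewrite big_seq1 /= !cats0.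
rewrite -[RHS](IH _ (rel_sum_extend k r0)) big_cat !big_map /= -big_split /=.
apply: eq_bigr => t _; rewrite big_cat !big_map addrC /=.
by congr (_ + _); apply: eq_bigr => q _; rewrite cat_rcons.
Qed.

(** Z plays the entries common to J and K, which occur in both rows of every term, and K the
    remaining ones, which are distributed. Since all entries are appended at the ends, no sign
    arises. *)
Lemma shuffle_relation s G I Z K : std_row G -> size G = (size I + s.+1)%N ->
  \sum_(p <- splits G) \sum_(q <- splits K)
    (rel_coef s (size I).+1 (size p.1) * eps (p.1 ++ p.2))%:~R
    * (x (I ++ p.2 ++ Z ++ q.1) * x (p.1 ++ Z ++ q.2)) = 0.
Proof.
move=> stdG sG; pose l := [seq (rel_coef s (size I).+1 (size p.1) * eps (p.1 ++ p.2),
                              I ++ p.2, p.1) | p <- splits G].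
have r0 : rel_sum l = 0.
  rewrite /rel_sum big_map -[RHS](split_relation sG) split_sum_splits //.
  by apply: eq_bigr => p _; rewrite rmorphM /= mulrAC mulrC.
have := rel_sum_extend_seq K (rel_sum_extend2_seq Z r0).
rewrite !big_map => r; rewrite -[RHS]r; apply: eq_bigr => p _; apply: eq_bigr => q _ /=.
by rewrite !catA.
Qed.

End Relations.

Section GenericDerivation.
Variable n : nat.
Let B := {mpoly int[nvars n.+1]}.
Let g (i j : 'I_n.+1) : B := gen_mx int n.+1 i j.
Let w (i : 'I_n) : 'I_n.+1 := widen_ord (leqnSn n) i.

(** The values are forced by the wanted formula on rows with one and two entries; they are used for
    i < j only, so i is never the extra index. *)
Definition shift_field (k : 'I_n) (i j : 'I_n.+1) : B :=
  if j == ord_max then g i (w k) - g i ord_max * g (w k) ord_max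
  else g i ord_max * g j (w k) - g j ord_max * g i (w k).

(* The vector field d_k for which pf (L k) = d_k (pf L) + x_{k,n+1} pf L. *)
Definition shift_deriv (k : 'I_n) (p : B) : B :=
  \sum_(v < nvars n.+1)
    (let ij := val (enum_val v : upair n.+1) in shift_field k ij.1 ij.2) * p^`M(v).

Lemma shift_deriv_additive k : zmod_morphism (shift_deriv k).
Proof.
move=> p q; rewrite /shift_deriv -sumrB; apply: eq_bigr => v _.
by rewrite mderivB mulrBr.
Qed.

HB.instance Definition _ k :=
  GRing.isZmodMorphism.Build B B (shift_deriv k) (shift_deriv_additive k).

Lemma shift_derivM k p q :
  shift_deriv k (p * q) = shift_deriv k p * q + p * shift_deriv k q.
Proof.
rewrite /shift_deriv mulr_suml mulr_sumr -big_split; apply: eq_bigr => v _ /=.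
by rewrite mderivM; ring.
Qed.

Lemma shift_deriv_g k (i j : 'I_n.+1) : (i < j)%N ->
  shift_deriv k (gen_mx int n.+1 i j) = shift_field k i j.
Proof.
move=> ij; rewrite mxE /xvar insubT insubF ?subr0 /=; last first.
  by rewrite ltnNge ltnW.
set p := Sub _ _; rewrite /shift_deriv (bigD1 (enum_rank p)) //= big1 ?addr0.
  rewrite enum_rankK /= mderivX mnm1E eqxx scale1r.
  rewrite (_ : (U_(_) - U_(_) = 0)%MM) ?mpolyX0 ?mulr1 //.
  by apply/mnmP => v; rewrite mnmBE subnn mnm0E.
by move=> v /negPf nv; rewrite mderivX mnm1E eq_sym nv scale0r mulr0.
Qed.

Lemma shift_deriv_genX k a b :
  shift_deriv k (genX int a b)
  = geny int a * genX int b k - geny int b * genX int a k.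
Proof.
have wn c : (w c == ord_max) = false.
  by apply/negbTE; rewrite -val_eqE /= neq_ltn ltn_ord.
have [ab|ba|/ord_inj <-] := ltngtP a b.
- by rewrite /genX shift_deriv_g // /shift_field wn.
- rewrite [genX int a b]gen_mxC raddfN /= shift_deriv_g // /shift_field wn.
  by rewrite /geny /genX /g /w; ring.
by rewrite /genX gen_mx0 raddf0; ring.
Qed.

Lemma shift_deriv_geny k a :
  shift_deriv k (geny int a) = genX int a k - geny int a * geny int k.
Proof.
rewrite /geny shift_deriv_g; last exact: (ltn_ord a).
by rewrite /shift_field eqxx.
Qed.

End GenericDerivation.

Local Notation row_quad n := (n.-bseq 'I_n * n.-bseq 'I_n * n.-bseq 'I_n * n.-bseq 'I_n)%type.

(** * The shuffling polynomial as a sum over splittings *)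

Section CanonicalForm.
Variable n : nat.
Implicit Types (G H I J K L M Z : seq 'I_n).

Lemma theta_canon_quad (A : comNzRingType) (x : seq 'I_n -> A) I J H K :
  theta_canon x I J H K =
  \sum_(q : row_quad n | theta_index I J H K q.1.1.1 q.1.1.2 q.1.2 q.2)
    (theta_coef J H K q.1.1.1 q.1.1.2 q.1.2)%:~R
    * x (I ++ q.1.1.2 ++ q.1.2) * x (q.1.1.1 ++ q.2).
Proof.
rewrite /theta_canon.
under eq_bigr do under eq_bigr do under eq_bigr do rewrite big_mkcond.
by rewrite pair_bigA pair_bigA pair_bigA /= -big_mkcond.
Qed.

Lemma insub_bseq_std L : std_row L -> val (insub_bseq n L) = L.
Proof. by move=> /size_std_row ss; rewrite val_insubd ss. Qed.

Lemma eps_cons a L : a \notin L ->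
  eps (a :: L) = (-1) ^+ count (fun b : 'I_n => (b < a)%N) L * eps L.
Proof.
have std s : std_row s -> a \notin s ->
    eps (a :: s) = (-1) ^+ count (fun b : 'I_n => (b < a)%N) s.
  elim: s => [|b s IH]; first by rewrite eps_std.
  rewrite std_row_cons inE negb_or => /andP[/allP bs ss] /andP[ab as_] /=.
  have [lt|gt|/ord_inj e] := ltngtP a b; last by rewrite e eqxx in ab.
    rewrite eps_std ?std_row_cons /=.
      rewrite (eq_in_count (a2 := pred0)) ?count_pred0 // => c /bs bc /=.
      by apply/negbTE; rewrite -leqNgt ltnW // (ltn_trans lt).
    rewrite lt ss !andbT /=; apply/andP; split; apply/allP => c /bs //.
    exact: ltn_trans.
  have -> : eps [:: a, b & s] = - eps [:: b, a & s].
    by have [epsC _] := @eps_alternating n; apply: (epsC [::]).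
  rewrite eps_cons_min ?IH ?exprS ?mulN1r //=.
  by rewrite gt; apply/allP.
move=> aL; have := eps_cat_sortr [:: a] L; rewrite /= => ->.
have [uL|/eps_nuniq->] := boolP (uniq L); last by rewrite mul0r mulr0.
rewrite std ?std_row_sort ?mem_sort // mulrC; congr (_ * _).
by congr (_ ^+ _); apply/seq.permP/perm_row_sort.
Qed.

Lemma eps_cat Z L : uniq (Z ++ L) ->
  eps (Z ++ L) = eps Z * eps L
    * (-1) ^+ (\sum_(z <- Z) count (fun b : 'I_n => (b < z)%N) L).
Proof.
elim: Z => [_|z Z IH]; first by rewrite big_nil [eps [::]]eps_std // mulr1 mul1r.
rewrite cat_cons cons_uniq => /andP[nz u].
have nzZ : z \notin Z by move: nz; rewrite mem_cat negb_or => /andP[].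
rewrite eps_cons // IH // (eps_cons nzZ) big_cons count_cat !exprD; ring.
Qed.

(** All three signs count inversions between Z and the second row, and this count is additive in
    that row. *)
Lemma eps_cat_perm Z L L1 L2 : std_row Z -> std_row L -> std_row L1 ->
  std_row L2 -> uniq (Z ++ L) -> perm_eq (L1 ++ L2) L ->
  eps (Z ++ L1) * eps (Z ++ L2) = eps (Z ++ L).
Proof.
move=> sZ sL s1 s2 u p.
have sub s : {subset s <= L} -> uniq s -> uniq (Z ++ s).
  move=> ss us; move: u; rewrite !cat_uniq us => /and3P[-> h _] /=.
  by rewrite andbT; apply: contra h => /hasP[a /ss aL aZ]; apply/hasP; exists a.
rewrite !eps_cat ?sub ?std_row_uniq //; try by move=> a aL;
  rewrite -(perm_mem p) mem_cat aL ?orbT.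
rewrite !eps_std // !mul1r -exprD -big_split /=; congr (_ ^+ _).
by apply: eq_bigr => z _; rewrite -count_cat; apply/seq.permP.
Qed.

Lemma perm_filterC_mem Z L : uniq Z -> uniq L -> {subset Z <= L} ->
  perm_eq ([seq i <- L | i \notin Z] ++ Z) L.
Proof.
move=> uZ uL ZL; rewrite perm_catC.
have h := permEl (perm_filterC (mem Z) L); apply: (perm_trans _ h).
rewrite perm_cat2r; apply: uniq_perm => //; first exact: filter_uniq.
by move=> a; rewrite mem_filter -[mem Z a]/(a \in Z);
  case: (boolP (a \in Z)) => [/ZL ->|].
Qed.

Lemma splits_filterC Z L P Q : std_row Z -> std_row L ->
  std_row P -> std_row Q -> perm_eq (P ++ Q) L -> {subset Z <= Q} ->
  (P, [seq i <- Q | i \notin Z]) \in splits [seq i <- L | i \notin Z] /\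
  row_sort ([seq i <- Q | i \notin Z] ++ Z) = Q.
Proof.
move=> sZ sL sP sQ pPQ ZQ; split; last first.
  rewrite -[RHS]row_sort_id //; apply: row_sort_perm.
  by apply: perm_filterC_mem; rewrite ?std_row_uniq.
have uPQ : uniq (P ++ Q) by rewrite (perm_uniq pPQ) std_row_uniq.
rewrite mem_splits ?std_row_filter // sP /=.
have {1}-> : P = [seq i <- P | i \notin Z].
  apply/esym/all_filterP/allP => a aP; apply/negP => /ZQ aQ.
  by move: uPQ; rewrite cat_uniq => /and3P[_ /hasPn/(_ a aQ)]; rewrite /= aP.
by rewrite -filter_cat perm_filter.
Qed.

Lemma splits_insert Z L P Q : std_row Z -> std_row L -> {subset Z <= L} ->
  (P, Q) \in splits [seq i <- L | i \notin Z] ->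
  [/\ std_row P, std_row (row_sort (Q ++ Z)),
      perm_eq (P ++ row_sort (Q ++ Z)) L, {subset Z <= row_sort (Q ++ Z)}
    & [seq i <- row_sort (Q ++ Z) | i \notin Z] = Q].
Proof.
move=> sZ sL ZL; rewrite mem_splits ?std_row_filter // => /and3P[sP sQ pPQ].
have pL : perm_eq (P ++ row_sort (Q ++ Z)) L.
  apply: perm_trans (perm_filterC_mem (std_row_uniq sZ) (std_row_uniq sL) ZL).
  rewrite (perm_catl _ (perm_row_sort _)) catA perm_cat2r //.
have stdQZ : std_row (row_sort (Q ++ Z)).
  rewrite std_row_sort -(perm_uniq (perm_row_sort _)).
  by have := std_row_uniq sL; rewrite -(perm_uniq pL) cat_uniq => /and3P[].
split=> // [a aZ|]; first by rewrite mem_sort mem_cat aZ orbT.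
apply: std_row_mem_eq => // [|a]; first exact: std_row_filter.
rewrite mem_filter mem_sort mem_cat; case: (boolP (a \in Z)) => aZ /=.
  apply/esym/negP => aQ.
  have : a \in [seq i <- L | i \notin Z] by rewrite -(perm_mem pPQ) mem_cat aQ orbT.
  by rewrite mem_filter aZ.
by rewrite orbF.
Qed.

Variables (A : comNzRingType) (x : seq 'I_n -> A).
Hypothesis alt_x : alternating x.
Variables (I J H K : seq 'I_n).
Hypothesis (stdHJ : std_row (H ++ J)) (stdK : std_row K).
Let Z := [seq i <- J | i \in K].
Let Jb := [seq i <- J | i \notin K].
Let Kb := [seq i <- K | i \notin Z].
Let G := H ++ Jb.

Let stdJ : std_row J. Proof. exact: std_row_catr stdHJ. Qed.
Let stdH : std_row H. Proof. exact: std_row_catl stdHJ. Qed.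
Let stdZ : std_row Z. Proof. exact: std_row_filter. Qed.
Let stdKb : std_row Kb. Proof. exact: std_row_filter. Qed.
Let uniqHJ : uniq (H ++ J). Proof. exact: std_row_uniq. Qed.

Let ZJ a : a \in Z -> a \in J. Proof. by rewrite mem_filter => /andP[]. Qed.
Let ZK a : a \in Z -> a \in K. Proof. by rewrite mem_filter => /andP[]. Qed.

Let HnJ a : a \in H -> a \notin J.
Proof.
move=> aH; move: uniqHJ; rewrite cat_uniq => /and3P[_ /hasPn h _].
by apply/negP => /h; rewrite aH.
Qed.

Let GE : G = [seq i <- H ++ J | i \notin Z].
Proof.
rewrite filter_cat /G; congr (_ ++ _).
  apply/esym/all_filterP/allP => a /HnJ aJ; apply: contra aJ; exact: ZJ.
by apply: eq_in_filter => a aJ; rewrite mem_filter aJ andbT.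
Qed.

Let stdG : std_row G. Proof. by rewrite GE; apply: std_row_filter. Qed.

Let ZHJ : {subset Z <= H ++ J}.
Proof. by move=> a /ZJ aJ; rewrite mem_cat aJ orbT. Qed.

Let theta_term (p q : seq 'I_n * seq 'I_n) : A :=
  (rel_coef (size Jb) (size H) (size p.1) * eps (p.1 ++ p.2))%:~R
  * (x (I ++ p.2 ++ Z ++ q.1) * x (p.1 ++ Z ++ q.2)).

(** Collecting Z into one block of each row costs signs whose dependence on the splitting is just
    [eps (p.1 ++ p.2)]; the rest is a global sign. The sign from the second row combines with
    [eps (Z ++ q.1)] by [eps_cat_perm]. *)
Lemma theta_canon_term p q : p \in splits G -> q \in splits Kb ->
  (size p.1 <= size H)%N ->
  (theta_coef J H K p.1 (row_sort (p.2 ++ Z)) q.1)%:~R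
    * x (I ++ row_sort (p.2 ++ Z) ++ q.1) * x (p.1 ++ row_sort (q.2 ++ Z))
  = (eps (G ++ Z) * eps (Z ++ Kb))%:~R * theta_term p q.
Proof.
case: p q => [H' Jb'] [K1 Kb2] /=; rewrite GE => pG qK szH.
have [sH' sJ' pHJ' _ _] := splits_insert stdZ stdHJ ZHJ pG.
have [sK1 sK2 pK _ _] := splits_insert stdZ stdK ZK qK.
move: pG qK; rewrite -GE !mem_splits //.
move=> /and3P[_ sJb' pHJb] /and3P[_ sKb2 pKb].
have uZKb : uniq (Z ++ Kb).
  rewrite cat_uniq !std_row_uniq // andbT /=; apply/hasPn => a.
  by rewrite mem_filter => /andP[].
rewrite /theta_term /theta_coef -/Z -/Jb -/(kappa _ _).
rewrite /rel_coef szH.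
have e1 := eps_mul_perm H' I K1 alt_x (perm_row_sort (Jb' ++ Z)).
have e2 : x (H' ++ row_sort (Kb2 ++ Z))
    = (eps (Z ++ Kb2))%:~R * x (H' ++ Z ++ Kb2).
  have := alternating_sort alt_x H' [::] (Z ++ Kb2); rewrite !cats0 => ->.
  rewrite mulrA -rmorphM eps_sqr ?mul1r; last first.
    by rewrite (perm_uniq (permEl (perm_catC Z Kb2))) -std_row_sort.
  by congr (x (H' ++ _)); apply/row_sort_perm/permEl/perm_catC.
have e3 : eps (H' ++ Jb' ++ Z) = eps (H' ++ Jb') * eps (G ++ Z).
  by rewrite catA (eps_cat_sort (H' ++ Jb') Z) (row_sort_perm pHJb) row_sort_id.
have e4 := eps_cat_perm stdZ stdKb sK1 sKb2 uZKb pKb.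
rewrite -{}e4 {}e2 !rmorphM /= -[_ * x (I ++ _)]mulrA [_ * x (I ++ _)]mulrC.
rewrite [x (I ++ _) * _]mulrC.
transitivity ((kappa (size Jb) (size H - size H'))%:~R * (eps (Z ++ K1))%:~R
   * ((eps (H' ++ row_sort (Jb' ++ Z)))%:~R * x (I ++ row_sort (Jb' ++ Z) ++ K1))
   * ((eps (Z ++ Kb2))%:~R * x (H' ++ Z ++ Kb2))).
  by rewrite /kappa !rmorphM /=; ring.
by rewrite e1 e3 rmorphM /= -!catA; ring.
Qed.

Definition theta_quad (q : row_quad n) :
    (seq 'I_n * seq 'I_n) * (seq 'I_n * seq 'I_n) :=
  ((val q.1.1.1, [seq i <- q.1.1.2 | i \notin Z]),
   (val q.1.2, [seq i <- q.2 | i \notin Z])).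

(* The entries of Z stay in both rows; the condition on the entries common to I
   and H may be dropped, since the terms that violate it have a repeated entry. *)
Lemma theta_canon_splits :
  theta_canon x I J H K
  = (eps (G ++ Z) * eps (Z ++ Kb))%:~R
    * \sum_(p <- splits G) \sum_(q <- splits Kb) theta_term p q.
Proof.
pose F (t : (seq 'I_n * seq 'I_n) * (seq 'I_n * seq 'I_n)) : A :=
  (theta_coef J H K t.1.1 (row_sort (t.1.2 ++ Z)) t.2.1)%:~R
  * x (I ++ row_sort (t.1.2 ++ Z) ++ t.2.1) * x (t.1.1 ++ row_sort (t.2.2 ++ Z)).
pose C (p : seq 'I_n * seq 'I_n) :=
  (size p.1 <= size H)%N && ([seq i <- I | i \in H] \subset p.1).
pose ls := [seq (p, q) | p <- [seq p <- splits G | C p], q <- splits Kb].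
transitivity (\sum_(t <- ls) F t).
  rewrite theta_canon_quad.
  have index_quad (q : row_quad n) :
      theta_index I J H K q.1.1.1 q.1.1.2 q.1.2 q.2 ->
      theta_quad q \in ls /\
      (row_sort ([seq i <- q.1.1.2 | i \notin Z] ++ Z) = q.1.1.2 /\
       row_sort ([seq i <- q.2 | i \notin Z] ++ Z) = q.2).
    case: q => [[[H' J'] K1] K2] /= /and5P[/and4P[sH sJ sK1 sK2] szH pHJ pK].
    move=> /andP[Z1H /andP[/subsetP ZJ' /subsetP ZK2]].
    have [p1 r1] := splits_filterC stdZ stdHJ sH sJ pHJ ZJ'.
    have [p2 r2] := splits_filterC stdZ stdK sK1 sK2 pK ZK2.
    split=> //; apply: allpairs_f => //.
    by rewrite mem_filter /C /= szH Z1H GE.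
  rewrite -(@big_reindex_seq _ _ _ (fun q : row_quad n => theta_index I J H K q.1.1.1 q.1.1.2 q.1.2 q.2)
    theta_quad ls F).
  - apply: eq_bigr => q /index_quad[_ [r1 r2]].
    by rewrite /F /= r1 r2.
  - apply: allpairs_uniq; rewrite ?filter_uniq ?splits_uniq //.
    by move=> [? ?] [? ?].
  - move=> q q' /index_quad[_ [r1 r2]] /index_quad[_ [r1' r2']].
    case: q q' r1 r2 r1' r2' => [[[H1 J1] K1] L1] [[[H2 J2] K2] L2] /=.
    move=> r1 r2 r1' r2' [/val_inj-> eJ /val_inj-> eL].
    have -> : J1 = J2 by apply: val_inj; rewrite -[LHS]r1 eJ; apply: r1'.
    by have -> : L1 = L2 by apply: val_inj; rewrite -[LHS]r2 eL; apply: r2'.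
  - by move=> q /index_quad[].
  move=> t /allpairsP[[[H' Jb'] [K1 Kb2]] [/= + qK ->]].
  rewrite mem_filter GE => /andP[/andP[szH Z1H] pG].
  have [sH' sJ' pHJ' Zs fJ] := splits_insert stdZ stdHJ ZHJ pG.
  have [sK1 sK2 pK Zs2 fK] := splits_insert stdZ stdK ZK qK.
  exists (insub_bseq n H', insub_bseq n (row_sort (Jb' ++ Z)), insub_bseq n K1,
          insub_bseq n (row_sort (Kb2 ++ Z))); last first.
    by rewrite /theta_quad /= !insub_bseq_std // fJ fK.
  rewrite /= !insub_bseq_std // /theta_index sH' sJ' sK1 sK2 szH pHJ' pK Z1H /=.
  by apply/andP; split; apply/subsetP.
rewrite big_allpairs big_filter mulr_sumr big_mkcond !big_seq.
apply: eq_bigr => p pG; rewrite /C; case: ifP => [/andP[szH Z1H]|nC].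
  rewrite mulr_sumr !big_seq; apply: eq_bigr => q qK.
  exact: theta_canon_term.
rewrite big1 ?mulr0 // => q _; rewrite /theta_term /rel_coef.
case: leqP nC => [szH /= /subsetPn[a aZ1 anp]|_ _]; last by rewrite mul0r mul0r.
rewrite [X in _ * (X * _)](alternating_nuniq alt_x) ?mul0r ?mulr0 //.
move: aZ1; rewrite mem_filter => /andP[aH aI].
have ap2 : a \in p.2.
  move: pG; case: (p) anp => H' J'; rewrite mem_splits //= => anp.
  move=> /and3P[_ _ /perm_mem/(_ a)]; by rewrite !mem_cat (negPf anp) aH.
by rewrite cat_uniq !negb_and; apply/orP; right; apply/orP; left;
  rewrite negbK; apply/hasP; exists a => //; rewrite mem_cat ap2.
Qed.

End CanonicalForm.

Section ThetaPf.
Variable n : nat.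
Implicit Types (I J H K L M : seq 'I_n).

Lemma std_row_cat L M : std_row (L ++ M)
  = [&& allrel (fun i j : 'I_n => (i < j)%N) L M, std_row L & std_row M].
Proof.
by rewrite !std_rowE !sorted_pairwise ?pairwise_cat //; apply: ltn_ord_trans.
Qed.

Lemma canonical_std_row I J H K : std_row H -> std_row J ->
  canonical_form I J H K -> std_row (H ++ J).
Proof.
case: J => [|j J] stdH stdJ /and3P[_ _] //.
case/lastP: H stdH => // H h stdH; rewrite rev_rcons => hj.
rewrite std_row_cat stdH stdJ !andbT; apply/allrelP => a b.
move: stdH; rewrite -cats1 std_row_cat => /and3P[/allrelP aH _ _].
move: stdJ; rewrite std_row_cons => /andP[/allP bJ _].
rewrite mem_cat mem_seq1 inE => ha hb.
have {}ha : (a <= h)%N.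
  by case/orP: ha => [/aH/(_ (mem_head _ _))/ltnW|/eqP ->].
have {}hb : (j <= b)%N by case/orP: hb => [/eqP -> //|/bJ/ltnW].
exact: leq_ltn_trans ha (leq_trans hj hb).
Qed.

Lemma canonical_split L M : nonstd2 L M ->
  exists I J H K,
    [/\ L = I ++ J, M = H ++ K, size H = (size I).+1, std_row (H ++ J)
      & forall (A : comNzRingType) (x : seq 'I_n -> A),
          theta x L M = theta_canon x I J H K].
Proof.
move=> nLM; have /and4P[_ stdL stdM _] := nLM.
set r := canon_pos L M.
exists (take r L), (drop r L), (take r.+1 M), (drop r.+1 M).
have [_ /(_ erefl)[eL eM cf]] :=
  canonical_formP nLM (take r L) (drop r L) (take r.+1 M) (drop r.+1 M).
have /and3P[/eqP sH _ _] := cf.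
split=> //; apply: canonical_std_row cf.
  by apply: (@std_row_catl _ _ (drop r.+1 M)); rewrite -eM.
by apply: (@std_row_catr _ (take r L)); rewrite -eL.
Qed.

Lemma eq_theta_canon (A : comNzRingType) (x x' : seq 'I_n -> A) I J H K :
  x =1 x' -> theta_canon x I J H K = theta_canon x' I J H K.
Proof. by move=> e; do 4![apply: eq_bigr => ? _]; rewrite !e. Qed.

Lemma theta_rmorph (A B : comNzRingType) (rho : {rmorphism A -> B})
    (x : seq 'I_n -> A) L M :
  rho (theta x L M) = theta (rho \o x) L M.
Proof.
rewrite /theta /theta_canon rmorph_sum; apply: eq_bigr => H' _.
rewrite rmorph_sum; apply: eq_bigr => J' _.
rewrite rmorph_sum; apply: eq_bigr => K1 _.
rewrite rmorph_sum; apply: eq_bigr => K2 _.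
by rewrite rmorphM /= rmorphM /= rmorph_int.
Qed.

Lemma genXC (R : comNzRingType) (a b : 'I_n) : genX R a b = - genX R b a.
Proof. exact: gen_mxC. Qed.

Lemma genX0 (R : comNzRingType) (a : 'I_n) : genX R a a = 0.
Proof. exact: gen_mx0. Qed.

Lemma pf_alternating (R : comNzRingType) : alternating (pf R (n := n)).
Proof.
have [xC x0] := rowpf_alternating (@geny R n) (@genXC R) (@genX0 R).
split=> [s1 a b s2|s1 a s2]; first by rewrite 2!pfE; apply: xC.
by rewrite pfE; apply: x0.
Qed.

Lemma map_pf (R R' : comNzRingType) (rho : {rmorphism R -> R'}) L :
  map_mpoly rho (pf R L) = pf R' L.
Proof.
rewrite !pfE rowpf_rmorph; apply: eq_rowpf => [a b|a]; exact: map_gen_mx.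
Qed.

Lemma theta_pf (R : comNzRingType) L M : nonstd2 L M -> theta (pf R (n := n)) L M = 0.
Proof.
move=> nLM; have /and4P[_ stdL stdM _] := nLM.
(* The integers supply the regularity of 2 that [rel_sum_extend2] requires. *)
suff t0 : theta (pf int (n := n)) L M = 0.
  have := theta_rmorph (map_mpoly (intmul (1 : R))) (pf int (n := n)) L M.
  rewrite t0 rmorph0 => e; rewrite [RHS]e.
  rewrite /theta; apply: eq_theta_canon => s /=.
  by rewrite -(map_pf (intmul (1 : R))).
have [I [J [H [K [eL eM sH stdHJ ->]]]]] := canonical_split nLM.
have stdK : std_row K by move: stdM; rewrite eM => /std_row_catr.
rewrite theta_canon_splits //; last exact: pf_alternating.
set Jb := [seq i <- J | i \notin K]; set Z := [seq i <- J | i \in K].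
set Kb := [seq i <- K | i \notin Z].
have reg2 (u : {mpoly int[nvars n.+1]}) : u *+ 2 = 0 -> u = 0.
  rewrite -mulr_natr => /eqP; rewrite mulf_eq0 => /orP[/eqP //|].
  by rewrite -mpolyC_nat mpolyC_eq0.
have stdG : std_row (H ++ Jb).
  move: stdHJ; rewrite !std_row_cat => /and3P[/allrelP h -> sJ] /=.
  rewrite std_row_filter // andbT; apply/allrelP => a b aH.
  by rewrite mem_filter => /andP[_]; apply: h.
have sG : size (H ++ Jb) = (size I + (size Jb).+1)%N.
  by rewrite size_cat sH addSnnS.
have := shuffle_relation (@genXC int) (@genX0 int) (@shift_derivM n)
  (@shift_deriv_genX n) (@shift_deriv_geny n) reg2 Z Kb stdG sG.
rewrite -sH => r0; rewrite -[RHS](mulr0 (eps ((H ++ Jb) ++ Z) * eps (Z ++ Kb))%:~R).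
congr (_ * _); rewrite -[RHS]r0; apply: eq_bigr => p _; apply: eq_bigr => q _.
by rewrite !pfE.
Qed.

End ThetaPf.

(** * Straightening *)

Section RowRank.
Variable n : nat.
Implicit Types (I J H K L M : seq 'I_n).

Definition row_sum L : nat := (\sum_(i <- L) i)%N.

Lemma row_sum_lt c L : all (fun i : 'I_n => (i < c)%N) L ->
  (row_sum L + size L <= size L * c)%N.
Proof.
elim: L => [|a L IH] /=; first by rewrite /row_sum big_nil.
by move=> /andP[ac /IH]; rewrite /row_sum big_cons mulSn; lia.
Qed.

Lemma row_sum_ge c L : all (fun i : 'I_n => (c <= i)%N) L ->
  (size L * c <= row_sum L)%N.
Proof.
elim: L => [|a L IH] //= /andP[ac /IH]; rewrite /row_sum big_cons mulSn; lia.
Qed.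

Lemma row_sum_std L : std_row L -> (row_sum L <= n * n)%N.
Proof.
move=> /size_std_row sL.
have : all (fun i : 'I_n => (i < n)%N) L by apply/allP => a _; apply: ltn_ord.
move=> /row_sum_lt h; apply: leq_trans (leq_addr _ _) (leq_trans h _).
by rewrite leq_mul2r sL orbT.
Qed.

(** J consists of the largest entries available, so any other choice of the same size replaces some
    of them by entries of H. *)
Lemma row_sum_shuffle H J H' J' : std_row (H ++ J) -> std_row H' ->
  std_row J' -> perm_eq (H' ++ J') (H ++ J) -> size H' = size H -> H' <> H ->
  (row_sum J' < row_sum J)%N.
Proof.
move=> stdHJ sH' sJ' pHJ szH neH.
have [sH sJ] : std_row H /\ std_row J.
  by split; [apply: std_row_catl stdHJ|apply: std_row_catr stdHJ].
have szJ : size J' = size J.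
  by have := perm_size pHJ; rewrite !size_cat szH => /addnI.
case: J => [|j J0] in stdHJ sJ pHJ szJ *.
  case: J' szJ pHJ {sJ'} => // _; rewrite !cats0 => /std_row_eq e.
  by case: neH; apply: e.
set J := j :: J0 in stdHJ sJ pHJ szJ *.
move: stdHJ; rewrite std_row_cat => /and3P[/allrelP HJ _ _].
have jJ : all (fun i : 'I_n => (j <= i)%N) J.
  by move: sJ; rewrite std_row_cons /= leqnn => /andP[/allP h _];
    apply/allP => a /h/ltnW.
(* The common parts C1 and D1 cancel; the head j of J separates C2 from D2, which have the same
   size. *)
pose C1 := [seq i <- J' | i \in J]; pose C2 := [seq i <- J' | i \notin J].
pose D1 := [seq i <- J | i \in J']; pose D2 := [seq i <- J | i \notin J'].
have pC : perm_eq (C1 ++ C2) J' := permEl (perm_filterC (mem J) J').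
have pD : perm_eq (D1 ++ D2) J := permEl (perm_filterC (mem J') J).
have pCD : perm_eq C1 D1.
  apply: uniq_perm; rewrite ?filter_uniq ?std_row_uniq // => a.
  by rewrite !mem_filter andbC.
have sumE s t : perm_eq s t -> row_sum s = row_sum t by move=> e; apply: perm_big.
have sumcat s t : row_sum (s ++ t) = (row_sum s + row_sum t)%N.
  exact: big_cat.
rewrite -(sumE _ _ pC) -(sumE _ _ pD) !sumcat (sumE _ _ pCD) ltn_add2l.
have szCD : size C2 = size D2.
  have := perm_size pC; have := perm_size pD; rewrite !size_cat (perm_size pCD).
  by rewrite szJ => <- /addnI.
have C2lt : all (fun i : 'I_n => (i < j)%N) C2.
  apply/allP => a; rewrite mem_filter => /andP[aJ aJ'].
  apply: HJ; last exact: mem_head.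
  have : a \in H ++ J by rewrite -(perm_mem pHJ) mem_cat aJ' orbT.
  by rewrite mem_cat (negPf aJ) orbF.
have D2ge : all (fun i : 'I_n => (j <= i)%N) D2.
  by apply/allP => a; rewrite mem_filter => /andP[_]; apply: (allP jJ).
have C2n : (0 < size C2)%N.
  rewrite lt0n size_eq0; apply/eqP => C20; case: neH.
  have eJ : J' = J.
    apply: std_row_eq => //; apply: perm_trans pD.
    rewrite perm_sym; have := size0nil (etrans (esym szCD) (congr1 size C20)) => ->.
    by rewrite cats0 -(permPl pCD); move: pC; rewrite C20 cats0.
  by apply: std_row_eq => //; move: pHJ; rewrite eJ perm_cat2r.
have := row_sum_lt C2lt; have := row_sum_ge D2ge; rewrite -szCD => le1 le2.
by apply: leq_trans (leq_trans le2 le1); rewrite -addn1 leq_add2l.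
Qed.

(** A lexicographic comparison in one number: since the sum of a standard row is at most n^2, length
    dominates, and a smaller sum ranks higher. *)
Definition row_rank L : nat := (size L * (n * n).+1 - row_sum L)%N.

(* Replacing a pair of rows by a pair with a row of larger rank increases the
   total weight. *)
Definition row_weight L : nat := (2 ^ row_rank L).-1.

Lemma row_rank_size L M : std_row L -> std_row M ->
  (row_rank M <= row_rank L)%N -> (size M <= size L)%N.
Proof.
move=> /row_sum_std sL /row_sum_std sM; rewrite /row_rank => le.
rewrite leqNgt; apply/negP => lt; move: le.
have : ((size L).+1 * (n * n).+1 <= size M * (n * n).+1)%N.
  by rewrite leq_mul2r lt orbT.
rewrite mulSn; move: (size L * _)%N (size M * _)%N => a b; lia.
Qed.

Lemma row_weight_bound L : std_row L -> (row_weight L <= 2 ^ (n * (n * n).+1))%N.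
Proof.
move=> /size_std_row sL; rewrite /row_weight.
apply: leq_trans (leq_pred _) _; rewrite leq_exp2l // /row_rank.
by apply: leq_trans (leq_subr _ _) _; rewrite leq_mul2r sL orbT.
Qed.

Definition row_pair_lt L M L' M' : bool :=
  (size L < size L')%N || [&& size L' == size L, size M' == size M
                            & (row_sum L' < row_sum L)%N].

(** One more unit of rank doubles the power of 2, which outweighs both old rows together because M
    ranks no higher than L; M' may be arbitrarily light. *)
Lemma row_pair_weight L M L' M' : std_row L -> std_row L' ->
  (row_rank M <= row_rank L)%N -> row_pair_lt L M L' M' ->
  (row_weight L + row_weight M < row_weight L' + row_weight M')%N.
Proof.
move=> sL sL' rML lt.
have rLL' : (row_rank L < row_rank L')%N.
  have [bL bL'] := (row_sum_std sL, row_sum_std sL').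
  rewrite /row_rank; case/orP: lt => [lt|/and3P[/eqP-> _ lt]].
    have : ((size L).+1 * (n * n).+1 <= size L' * (n * n).+1)%N.
      by rewrite leq_mul2r lt orbT.
    by rewrite mulSn; lia.
  have L0 : (0 < size L)%N.
    by case: (L) lt => //; rewrite /row_sum big_nil.
  have : ((n * n).+1 <= size L * (n * n).+1)%N by rewrite leq_pmull.
  lia.
have e1 : (2 ^ (row_rank L).+1 <= 2 ^ row_rank L')%N by rewrite leq_exp2l.
have e2 : (2 ^ row_rank M <= 2 ^ row_rank L)%N by rewrite leq_exp2l.
have e3 : (0 < 2 ^ row_rank M)%N by rewrite expn_gt0.
by rewrite /row_weight; move: e1; rewrite expnS; lia.
Qed.

Lemma row_le_trans : transitive (@row_le n).
Proof.
move=> M L K; rewrite /row_le => /andP[sLM aLM] /andP[sMK aMK].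
rewrite (leq_trans sMK sLM) /=.
elim: L M K sLM aLM sMK aMK => [|a L IH] [|b M] [|c K] //=.
move=> sLM /andP[ab aLM] sMK /andP[bc aMK].
by rewrite (leq_trans ab bc) (IH M).
Qed.

End RowRank.

Section RowMonomials.
Variables (R : comNzRingType) (n : nat).
Implicit Types (I J H K L M : seq 'I_n) (T : seq (seq 'I_n)).
Local Notation Rt := {mpoly R[ntvars n]}.

(** The empty row must be singled out, since [tvar] returns 0 on it. *)
Definition row_var L : Rt := if L is [::] then 1 else tvar R L.

Definition tab_mon T : Rt := \prod_(L <- T) row_var L.

Lemma t_substE L : t_subst R L = (eps L)%:~R * row_var (row_sort L).
Proof.
case: L => [|a L]; first by rewrite /= eps_std // mulr1.
rewrite /t_subst /row_var; case e: (row_sort (a :: L)) => [|//].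
by have := perm_size (perm_row_sort (a :: L)); rewrite e.
Qed.

Lemma t_subst_std L : std_row L -> t_subst R L = row_var L.
Proof. by move=> sL; rewrite t_substE eps_std // mul1r row_sort_id. Qed.

Lemma shuffle_sizes (i j j' k1 h h' : nat) :
  (i + (j' + k1) <= i + j)%N -> (h' + j' = h + j)%N -> (h' <= h)%N ->
  [/\ k1 = 0%N, h' = h & j' = j].
Proof. by split; lia. Qed.

(** The leading term is the unshuffled index H' = H, J' = J, K1' empty, K2' = K, with coefficient 1.
    Terms with a repeated entry are left out, as [t_subst] kills them. *)
Lemma theta_lead L M : nonstd2 L M ->
  exists s : seq (int * (seq 'I_n * seq 'I_n)),
    (forall a, a \in s -> [/\ std_row a.2.1, std_row a.2.2
                            & row_pair_lt L M a.2.1 a.2.2]) /\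
    theta (t_subst R (n := n)) L M
    = row_var L * row_var M
      + \sum_(a <- s) a.1%:~R * (row_var a.2.1 * row_var a.2.2).
Proof.
move=> nLM; have /and4P[_ stdL stdM _] := nLM.
have [I [J [H [K [eL eM sH stdHJ ->]]]]] := canonical_split nLM.
have stdH : std_row H by apply: std_row_catl stdHJ.
have stdJ : std_row J by apply: std_row_catr stdHJ.
have stdK : std_row K by move: stdM; rewrite eM => /std_row_catr.
pose idx (q : row_quad n) := theta_index I J H K q.1.1.1 q.1.1.2 q.1.2 q.2.
pose q0 : row_quad n := (insub_bseq n H, insub_bseq n J, insub_bseq n [::],
  insub_bseq n K).
pose r1 (q : row_quad n) := I ++ q.1.1.2 ++ q.1.2.
pose r2 (q : row_quad n) := val q.1.1.1 ++ q.2.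
pose ok q := [&& idx q, q != q0, uniq (r1 q) & uniq (r2 q)].
exists [seq (theta_coef J H K q.1.1.1 q.1.1.2 q.1.2 * eps (r1 q) * eps (r2 q),
             (row_sort (r1 q), row_sort (r2 q))) | q : row_quad n <- enum ok].
split.
  move=> _ /mapP[q + ->] /=; rewrite mem_enum => /and4P[iq nq u1 u2].
  rewrite !std_row_sort; split=> //.
  have pe1 := perm_row_sort (r1 q); have pe2 := perm_row_sort (r2 q).
  have sumE m (s t : seq (ordinal m)) : perm_eq s t -> row_sum s = row_sum t by move=> e; apply: perm_big.
  have sumcat (s t : seq 'I_n) : row_sum (s ++ t) = (row_sum s + row_sum t)%N.
    exact: big_cat.
  rewrite /row_pair_lt (perm_size pe1) (perm_size pe2) (sumE _ _ _ pe1).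
  rewrite /r1 /r2 eL eM.
  move: iq nq; rewrite /idx /q0; case: q {u1 u2 pe1 pe2} => [[[H' J'] K1] K2] /=.
  move=> /and5P[/and4P[sH' sJ' sK1 sK2] szH pHJ pK _] nq.
  have eHJ := perm_size pHJ; have eK := perm_size pK.
  rewrite !size_cat in eHJ eK *.
  (* As |H'| <= |H|, the new first row is never shorter than L; equal length forces K1 to be empty
     and |H'| = |H|, so only H and J are shuffled. *)
  case: ltnP => // le /=.
  have [/size0nil K10 szHH szJJ] := shuffle_sizes le eHJ szH.
  have eK2 : val K2 = K.
    by apply: std_row_eq => //; move: pK; rewrite K10.
  rewrite K10 /= addn0 szHH eK2 szJJ !eqxx /= cats0 !sumcat ltn_add2l.
  apply: (row_sum_shuffle stdHJ sH' sJ' pHJ szHH) => eH; case/eqP: nq.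
  have eJ : val J' = J.
    by apply: std_row_eq => //; move: pHJ; rewrite eH perm_cat2l.
  have <- : H' = insub_bseq n H by apply: val_inj; rewrite insub_bseq_std.
  have <- : J' = insub_bseq n J by apply: val_inj; rewrite insub_bseq_std.
  have <- : K1 = insub_bseq n [::] by apply: val_inj; rewrite insub_bseq_std.
  by have <- : K2 = insub_bseq n K by apply: val_inj; rewrite insub_bseq_std.
have q0E : [/\ val q0.1.1.1 = H, val q0.1.1.2 = J, val q0.1.2 = [::] & val q0.2 = K].
  by rewrite !insub_bseq_std.
have [e1 e2 e3 e4] := q0E.
rewrite theta_canon_quad (bigD1 q0) /=; last first.
  rewrite e1 e2 e3 e4 /theta_index stdH stdJ stdK leqnn !perm_refl /=.
  by apply/and3P; split; apply/subsetP => a; rewrite mem_filter => /andP[].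
congr (_ + _).
  rewrite e1 e2 e3 e4 /theta_coef subnn -/(kappa _ 0).
  rewrite (kappa_even _ 0) bin0 !eps_std // ?cats0 ?std_row_filter //.
  by rewrite !mul1r -eL -eM !t_subst_std.
rewrite big_map big_enum /= [RHS]big_mkcond [LHS]big_mkcond /=.
apply: eq_bigr => q _; rewrite unfold_in /ok /idx.
case: (theta_index _ _ _ _ _ _ _ _); case: (q != q0) => //=.
rewrite -/(r1 q) -/(r2 q) !t_substE.
have [u1|/eps_nuniq ->] := boolP (uniq (r1 q)); last by rewrite !(mulr0z, mulr0, mul0r).
have [u2|/eps_nuniq ->] := boolP (uniq (r2 q)); last by rewrite !(mulr0z, mulr0, mul0r).
by rewrite !rmorphM /=; ring.
Qed.

End RowMonomials.

Lemma measure_decrease (B x y l m l' m' k : nat) : (l + m < l' + m' ->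
  B - (x + (l + (m + y))) < k.+1 -> x + (l' + (m' + y)) <= B ->
  B - (x + (l' + (m' + y))) < k)%N.
Proof. lia. Qed.

Section Straightening.
Variables (R : comNzRingType) (n : nat).
Implicit Types (I J H K L M : seq 'I_n) (T : seq (seq 'I_n)).
Local Notation Rt := {mpoly R[ntvars n]}.

Definition basis_tab T : bool := std_tableau T && ([::] \notin T).

Lemma tab_mon_cat T T' : tab_mon R (T ++ T') = tab_mon R T * tab_mon R T'.
Proof. exact: big_cat. Qed.

Lemma tab_mon_perm T T' : perm_eq T T' -> tab_mon R T = tab_mon R T'.
Proof. by move=> e; apply: perm_big. Qed.

Lemma tab_mon_nonempty T : tab_mon R [seq L <- T | L != [::]] = tab_mon R T.
Proof.
rewrite /tab_mon big_filter [RHS](bigID (fun L => L != [::])) /=.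
rewrite [X in _ = _ * X]big1 ?mulr1 // => L.
by rewrite negbK => /eqP ->.
Qed.

Lemma row_le_tableau T : all (@std_row n) T -> sorted (@row_le n) T ->
  std_tableau T.
Proof.
move=> sT lT; rewrite /std_tableau sT lT !andbT /is_tableau.
rewrite sorted_map; apply: sub_sorted lT => L M.
by rewrite /row_le => /andP[].
Qed.

Lemma basis_tab_nonempty T : std_tableau T ->
  basis_tab [seq L <- T | L != [::]].
Proof.
case/and3P => _ sT lT; rewrite /basis_tab row_le_tableau /=.
- by rewrite mem_filter eqxx.
- by apply/allP => L; rewrite mem_filter => /andP[_]; apply: (allP sT).
by apply: sorted_filter lT; apply: row_le_trans.
Qed.

Lemma not_sorted_split (T : eqType) (r : rel T) (s : seq T) : ~~ sorted r s ->
  exists s1 a b s2, s = s1 ++ a :: b :: s2 /\ ~~ r a b.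
Proof.
elim: s => [//|a [//|b s] IH] /=; rewrite negb_and; case: (boolP (r a b)) => /=.
  move=> _ /IH[s1 [c [e [s2 [-> rce]]]]].
  by exists (a :: s1), c, e, s2.
by move=> rab _; exists [::], a, b, s.
Qed.

Variable N : Rt -> Prop.
Hypothesis N0 : N 0.
Hypothesis ND : forall p q, N p -> N q -> N (p + q).
Hypothesis NZ : forall c p, N p -> N (c *: p).
Variable d : nat.
Hypothesis N_theta : forall T1 T2 L M, nonstd2 L M ->
  (size T1 + (size T2).+2)%N = d ->
  N (tab_mon R T1 * (theta (t_subst R (n := n)) L M * tab_mon R T2)).

(** N is abstract so that one straightening serves an ideal and a mere span; d, the number of rows
    with empty ones counted, bounds the products for which N must contain the relation. *)
Definition straight (p : Rt) : Prop :=
  exists s : seq (R * seq (seq 'I_n)),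
    all (fun a => basis_tab a.2) s /\
    N (p - \sum_(a <- s) a.1 *: tab_mon R a.2).

Lemma straight_N p : N p -> straight p.
Proof. by move=> Np; exists [::]; rewrite big_nil subr0. Qed.

Lemma straightD p q : straight p -> straight q -> straight (p + q).
Proof.
move=> [s [hs Ns]] [t [ht Nt]]; exists (s ++ t).
by rewrite all_cat hs ht big_cat opprD addrACA; split=> //; apply: ND.
Qed.

Lemma straightZ c p : straight p -> straight (c *: p).
Proof.
move=> [s [hs Ns]]; exists [seq (c * a.1, a.2) | a <- s]; split.
  by rewrite all_map; apply: sub_all hs.
rewrite big_map (eq_bigr (fun a => c *: (a.1 *: tab_mon R a.2))); last first.
  by move=> a _; rewrite scalerA.
by rewrite -scaler_sumr -scalerBr; apply: NZ.
Qed.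

Lemma straight_sum (U : eqType) (s : seq U) (F : U -> Rt) :
  (forall u, u \in s -> straight (F u)) -> straight (\sum_(u <- s) F u).
Proof.
elim: s => [|u s IH] h; first by rewrite big_nil; apply: straight_N.
rewrite big_cons; apply: straightD; first by apply: h; rewrite mem_head.
by apply: IH => v vs; apply: h; rewrite inE vs orbT.
Qed.

(** Each use of a relation preserves the number of rows and increases the total weight, which is
    bounded by B; the induction is on the distance to B. *)
Lemma straighten T : all (@std_row n) T -> size T = d -> straight (tab_mon R T).
Proof.
pose wt T := (\sum_(L <- T) row_weight L)%N.
have wt_bound T' : all (@std_row n) T' ->
    (wt T' <= size T' * 2 ^ (n * (n * n).+1))%N.
  elim: T' => [|L T' IH] /=; first by rewrite /wt big_nil.
  move=> /andP[/row_weight_bound bL /IH bT].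
  by rewrite /wt big_cons mulSn leq_add.
pose B := (d * 2 ^ (n * (n * n).+1))%N.
have [m] := ubnP (B - wt T); elim: m T => // m IH T0 lt sT0 dT0.
(* Sorting by rank, possible because monomials commute, makes every adjacent pair a tableau, so that
   a failure of [row_le] is a [nonstd2] pair. *)
pose ord := fun L M => (row_rank M <= row_rank L)%N.
set T := sort ord T0; have pT : perm_eq T T0 by rewrite perm_sort.
have {}sT : all (@std_row n) T by rewrite (perm_all _ pT).
have {}dT : size T = d by rewrite (perm_size pT).
have eT : wt T = wt T0 by apply: perm_big.
have oT : sorted ord T.
  by apply: sort_sorted => L M; rewrite /ord leq_total.
rewrite -(tab_mon_perm pT).
have [lT|/not_sorted_split[T1 [L [M [T2 [ET nLM]]]]]] := boolP (sorted (@row_le n) T).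
  exists [:: (1, [seq L <- T | L != [::]])].
  by rewrite /= basis_tab_nonempty ?row_le_tableau // big_seq1 scale1r
    tab_mon_nonempty subrr.
have rML : (row_rank M <= row_rank L)%N.
  by move: oT; rewrite ET => /cat_sorted2[_ /= /andP[]].
have [sT1 sL sM sT2] : [/\ all (@std_row n) T1, std_row L, std_row M
    & all (@std_row n) T2].
  by move: sT; rewrite ET all_cat /= => /and4P[].
have nstd : nonstd2 L M.
  rewrite /nonstd2 sL sM /std_tableau /is_tableau /= sL sM !andbT /=.
  by rewrite (negPf nLM) andbF andbT; apply: row_rank_size.
have dT12 : (size T1 + (size T2).+2)%N = d.
  by rewrite -dT ET size_cat.
have [s [hs thE]] := theta_lead R nstd.
have -> : tab_mon R T = tab_mon R T1 * (theta (t_subst R (n := n)) L M * tab_mon R T2)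
   - \sum_(a <- s) a.1%:~R *: tab_mon R (T1 ++ [:: a.2.1, a.2.2 & T2]).
  rewrite thE mulrDl mulrDr ET tab_mon_cat /tab_mon !big_cons -/(tab_mon R T2).
  rewrite mulrA -[X in X = _]addr0 -!addrA; congr (_ + _); first by rewrite !mulrA.
  apply/eqP; rewrite eq_sym subr_eq0; apply/eqP.
  rewrite mulr_suml mulr_sumr; apply: eq_bigr => a _.
  by rewrite big_cat !big_cons /= -mul_mpolyC rmorph_int -/(tab_mon R T2); ring.
rewrite -scaleN1r; apply: straightD; first by apply/straight_N/N_theta.
apply: straightZ; apply: straight_sum => a /hs[s1 s2 gt].
apply: straightZ; apply: IH; last first.
- by rewrite size_cat.
- by rewrite all_cat /= sT1 s1 s2.
have lw := row_pair_weight sL s1 rML gt.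
have := wt_bound (T1 ++ [:: a.2.1, a.2.2 & T2]).
rewrite all_cat /= sT1 s1 s2 sT2 size_cat /= dT12 => /(_ isT).
rewrite -/B; move: lt; rewrite -eT ET /wt !big_cat !big_cons.
exact: measure_decrease.
Qed.

End Straightening.

(** * Independence of the standard monomials *)

Section MultilinearExpansion.
Variables (n : nat) (A : comNzRingType) (Y : 'I_n -> 'I_n -> A).
Variables (E : 'I_n -> 'I_n -> A) (z : 'I_n -> A).
Implicit Types (L s : seq 'I_n) (phi psi : seq 'I_n -> A).

Fixpoint multilin L phi : A :=
  if L is i :: L' then \sum_a Y a i * multilin L' (fun s => phi (a :: s))
  else phi [::].

Definition bilin_form i j : A := \sum_a Y a i * \sum_b Y b j * E a b.
Definition lin_form i : A := \sum_a Y a i * z a.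

Lemma eq_multilin L phi psi :
  (forall s, size s = size L -> phi s = psi s) -> multilin L phi = multilin L psi.
Proof.
elim: L phi psi => [|i L IH] phi psi e /=; first exact: e.
by apply: eq_bigr => a _; congr (_ * _); apply: IH => s ss; apply: e; rewrite /= ss.
Qed.

Lemma multilinD L phi psi :
  multilin L (fun s => phi s + psi s) = multilin L phi + multilin L psi.
Proof.
elim: L phi psi => [|i L IH] phi psi //=.
by rewrite -big_split; apply: eq_bigr => a _; rewrite IH mulrDr.
Qed.

Lemma multilinZ L c phi : multilin L (fun s => c * phi s) = c * multilin L phi.
Proof.
elim: L phi => [|i L IH] phi //=.
by rewrite mulr_sumr; apply: eq_bigr => a _; rewrite IH mulrCA.
Qed.

Lemma multilinN L phi : multilin L (fun s => - phi s) = - multilin L phi.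
Proof.
by rewrite -mulN1r -multilinZ; apply: eq_multilin => s _; rewrite mulN1r.
Qed.

Lemma del_sum_multilin (c : 'I_n -> A) L psi :
  del_sum (fun j => \sum_b Y b j * c b) L (fun t => multilin t psi)
  = multilin L (fun s => del_sum c s psi).
Proof.
set f := fun j => _; elim: L psi => [|j L IH] psi //=.
have -> : del_sum f L
      (fun t => \sum_a Y a j * multilin t (fun s => psi (a :: s)))
    = \sum_a Y a j * multilin L (fun s => del_sum c s (fun t => psi (a :: t))).
  rewrite -(eq_bigr _ (fun a _ => congr1 (fun u => Y a j * u)
              (IH (fun s => psi (a :: s))))).
  elim: (index_enum _) => [|a r IHr].
    by rewrite big_nil -[RHS](del_sum0 f L);
      apply: eq_del_sum => t _; rewrite big_nil.
  rewrite big_cons -IHr -del_sumZ -del_sumD; apply: eq_del_sum => t _.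
  by rewrite big_cons.
rewrite {1}/f mulr_suml -sumrB; apply: eq_bigr => b _.
by rewrite multilinD multilinN multilinZ; ring.
Qed.

Lemma del_sum_sumf (U : Type) (r : seq U) (c : U -> A) (f : U -> 'I_n -> A) L phi :
  del_sum (fun j => \sum_(u <- r) c u * f u j) L phi
  = \sum_(u <- r) c u * del_sum (f u) L phi.
Proof.
elim: r => [|u r IH].
  rewrite big_nil; elim: L phi => //= j L IH phi.
  by rewrite IH big_nil mul0r subr0.
rewrite big_cons -IH -[X in _ = _ + X]mul1r -del_sum_lin.
by apply: eq_del_sumf => j; rewrite big_cons mul1r.
Qed.

(** A Cauchy-Binet formula for pfaffians (minor summation), left as a sum over all words instead of
    being grouped into minors. *)
Lemma rowpf_multilin L :
  rowpf bilin_form lin_form L = multilin L (rowpf E z).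
Proof.
have [m] := ubnP (size L); elim: m L => // m IH [|i L] //= sm.
rewrite rowpf_cons IH //.
rewrite (eq_del_sum _ (psi := fun t => multilin t (rowpf E z))); last first.
  by move=> t st; rewrite IH //; lia.
rewrite del_sum_sumf mulr_suml mulr_sumr -big_split /=.
apply: eq_bigr => a _; rewrite del_sum_multilin.
rewrite [in RHS](eq_multilin (psi := fun s => del_sum (E a) s (rowpf E z)
   + ((~~ odd (size L))%:R * z a) * rowpf E z s)); last first.
  by move=> s ss; rewrite rowpf_cons ss mulrA.
by rewrite multilinD multilinZ; ring.
Qed.

Fixpoint words r : seq (seq 'I_n) :=
  if r is r'.+1 then [seq a :: s | a <- enum 'I_n, s <- words r'] else [:: [::]].

Fixpoint word_mon L s : A :=
  match L, s with
  | i :: L', a :: s' => Y a i * word_mon L' s'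
  | _, _ => 1
  end.

Lemma multilin_words L phi :
  multilin L phi = \sum_(s <- words (size L)) word_mon L s * phi s.
Proof.
elim: L phi => [|i L IH] phi /=; first by rewrite big_seq1 mul1r.
rewrite big_allpairs_dep big_enum; apply: eq_bigr => a _.
by rewrite IH mulr_sumr; apply: eq_bigr => s _; rewrite mulrA.
Qed.

Lemma mem_words r s : (s \in words r) = (size s == r).
Proof.
elim: r s => [|r IH] [|a s] //=.
- by apply/negbTE/negP => /allpairsP[[? ?] []].
rewrite eqSS -IH; apply/allpairsP/idP => [[[b t] [_ /= ts [_ ->]]] //|ss].
by exists (a, s); rewrite /= mem_enum.
Qed.

Lemma words_uniq r : uniq (words r).
Proof.
elim: r => //= r IH; apply: allpairs_uniq; rewrite ?enum_uniq //.
by move=> [? ?] [? ?] _ _ /= [-> ->].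
Qed.

End MultilinearExpansion.

(** * Leading exponents of rows and tableaux *)

Section Exponents.
Variable n : nat.
Implicit Types (I L M : seq 'I_n) (s : seq nat) (T : seq (seq 'I_n)).
Local Notation NV := (n * n).+1.
Local Open Scope nat_scope.

(* The index of the variable y_{a,i} in the lexicographic order of the pairs
   (a, i); it is meaningful for a < n only. *)
Definition yvar (a : nat) (i : 'I_n) : 'I_NV := inord (a * n + i).

Lemma yvar_val a i : (a < n)%N -> val (yvar a i) = (a * n + i)%N.
Proof.
move=> an; rewrite /yvar /= inordK // ltnS; apply: ltnW.
have : (a.+1 * n <= n * n)%N by rewrite leq_mul2r an orbT.
by rewrite mulSn; have := ltn_ord i; lia.
Qed.

Lemma yvar_lt a i b j : (a < n)%N -> (b < n)%N ->
  (yvar a i < yvar b j)%N = (a < b)%N || (a == b) && (i < j)%N.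
Proof.
move=> an bn; rewrite -[nat_of_ord (yvar a i)]/(val _) -[nat_of_ord (yvar b j)]/(val _).
rewrite !yvar_val //; case: (ltngtP a b) => [ab|ba|->] /=; last by rewrite ltn_add2l.
  have : (a.+1 * n <= b * n)%N by rewrite leq_mul2r ab orbT.
  by rewrite mulSn; have := ltn_ord i; lia.
have : (b.+1 * n <= a * n)%N by rewrite leq_mul2r ba orbT.
rewrite mulSn => h; apply/negbTE; have := ltn_ord j; lia.
Qed.

Lemma yvar_inj a i b j : (a < n)%N -> (b < n)%N -> yvar a i = yvar b j ->
  a = b /\ i = j.
Proof.
move=> an bn e.
have := yvar_lt i j an bn; have := yvar_lt j i bn an; rewrite e ltnn.
case: (ltngtP a b) => //= -> /esym/negbT; rewrite -leqNgt => le1.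
by move=> /esym/negbT; rewrite -leqNgt => le2; split=> //;
  apply/val_inj/anti_leq; rewrite le1 le2.
Qed.

Fixpoint word_exp L (s : seq nat) : 'X_{1..NV} :=
  match L, s with
  | i :: L', a :: s' => (U_(yvar a i) + word_exp L' s')%MM
  | _, _ => 0%MM
  end.

Lemma mdeg_word_exp L s : size s = size L -> mdeg (word_exp L s) = size L.
Proof.
elim: L s => [|i L IH] [|a s] //=; first by rewrite mdeg0.
by move=> [ss]; rewrite mdegD mdeg1 IH.
Qed.

Lemma word_exp_eq0 L s (v : 'I_NV) :
  all (fun p => yvar p.2 p.1 != v) (zip L s) -> word_exp L s v = 0.
Proof.
elim: L s => [|i L IH] [|a s] //=; rewrite ?mnm0E // => /andP[/negPf nv /IH].
by rewrite mnmDE mnm1E nv => ->.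
Qed.

(** In the monomial order smaller indices of variables weigh more, so the best word puts the least
    letter c on the least entry of L, and so on along the row. *)
Lemma word_exp_lt L s c : std_row L -> size s = size L -> c + size L <= n ->
  uniq s -> all (fun a => c <= a < n) s -> s != iota c (size L) ->
  (word_exp L s < word_exp L (iota c (size L)))%O.
Proof.
elim: L s c => [|i L IH] s c; first by case: s.
case: s => [//|a s] siL /= [ss] cn /andP[nas us].
move=> /andP[/andP[ca an] cs].
have [sL iL] : std_row L /\ all (fun b : 'I_n => i < b) L.
  by move: siL; rewrite std_row_cons => /andP[].
rewrite eqseq_cons; have [eac|nac] := eqVneq a c.
  move=> /= ne; rewrite eac ltmc_add2r; apply: IH => //; first by lia.
  apply/allP => b bs; have /andP[cb ->] := allP cs b bs; rewrite andbT ltn_neqAle cb.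
  by rewrite andbT; apply: contra nas => /eqP e; rewrite eac e.
(* If s does not start with c, the first difference is at y_{c,i}: every other variable involved
   comes later, and s misses this one. *)
move=> _; apply/ltmcP; first by rewrite !mdegD !mdeg1 !mdeg_word_exp // size_iota.
have {}ca : c < a by rewrite ltn_neqAle eq_sym nac.
have cltn : c < n by lia.
have rows (v : 'I_NV) (t : seq nat) (b : nat) (j : 'I_n) : size t = size L -> v <= yvar c i ->
    all (fun d => c <= d < n) t -> (b = c -> i < j) -> c <= b < n ->
    yvar b j != v.
  move=> _ vi _ bj /andP[cb bn]; apply/eqP => e; rewrite -e leqNgt in vi.
  case/negP: vi; rewrite yvar_lt //; case: ltngtP cb => //= ebc _.
  by apply: bj.
have zero (v : 'I_NV) (t : seq nat) : size t = size L -> v <= yvar c i ->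
    all (fun d => c <= d < n) t -> word_exp L t v = 0.
  move=> st vi ct; apply: word_exp_eq0; apply/allP => -[j b] jb /=.
  have jL : j \in L by have := map_f fst jb; rewrite -/unzip1 unzip1_zip ?st.
  have bt : b \in t by have := map_f snd jb; rewrite -/unzip2 unzip2_zip ?st.
  by apply: (rows v t) => // [_|]; [apply: (allP iL)|apply: (allP ct)].
have ciota : all (fun d => c <= d < n) (iota c.+1 (size L)).
  apply/allP => d; rewrite mem_iota; lia.
exists (yvar c i) => [v vlt|].
  rewrite !mnmDE !zero ?size_iota // ?(ltnW vlt) // !mnm1E !addn0.
  have -> : (yvar c i == v) = false.
    by apply/negbTE; apply: contraL vlt => /eqP ->; rewrite ltnn.
  by apply/eqP; rewrite eqb0 (rows v s) ?(ltnW vlt) // ?(ltnW ca) //; lia.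
rewrite !mnmDE !zero ?size_iota // !mnm1E eqxx !addn0.
by rewrite (negPf (rows _ s a i _ _ _ _ _)) // ?(ltnW ca) //; lia.
Qed.

Definition tab_exp T : 'X_{1..NV} :=
  (\sum_(L <- T) word_exp L (iota 0 (size L)))%MM.

Lemma word_exp_iota c L a i : c + size L <= n -> a < n ->
  word_exp L (iota c (size L)) (yvar a i)
  = [&& c <= a, a < c + size L & nth i L (a - c) == i].
Proof.
elim: L c => [|j L IH] c /= cn an.
  by rewrite mnm0E addn0; case: ltnP => //; rewrite ?andbF // ltnNge => /negPf ->.
rewrite mnmDE mnm1E IH //; last by lia.
have cn' : c < n by lia.
have neq : a != c -> (yvar c j == yvar a i) = false.
  by move=> ac; apply/eqP => /(yvar_inj cn' an)[ca _]; rewrite ca eqxx in ac.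
have [e|ac] := eqVneq a c; last first.
  rewrite neq // add0n addSnnS; have [ca|ca] := boolP (c < a).
    by rewrite (ltnW ca) -[(a - c)%N](subnSK ca).
  by have -> : (c <= a) = false by rewrite leq_eqVlt eq_sym (negPf ac) (negPf ca).
rewrite e subnn /= ltnn /= addn0.
have -> : c < c + (size L).+1 by lia.
congr (nat_of_bool _); rewrite leqnn; apply/eqP/eqP => [/(yvar_inj cn' cn')[] //|-> //].
Qed.

Lemma tab_expE T a i : all (@std_row n) T -> a < n ->
  tab_exp T (yvar a i) = count (fun L => (a < size L) && (nth i L a == i)) T.
Proof.
move=> sT an; rewrite /tab_exp mnm_sumE; elim: T sT => [|L T IH] /=.
  by rewrite big_nil.
move=> /andP[sL sT]; rewrite big_cons IH // word_exp_iota //.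
  by rewrite subn0.
exact: size_std_row.
Qed.

Lemma row_leP L M : row_le L M -> forall k i, k < size M ->
  k < size L /\ (nth i L k <= nth i M k).
Proof.
rewrite /row_le; elim: M L => [|b M IH] [|a L] //= /andP[sML /andP[ab h]].
by move=> [|k] i //= kM; apply: IH => //; rewrite h andbT.
Qed.

Lemma tab_exp_cons L T :
  tab_exp (L :: T) = (word_exp L (iota 0 (size L)) + tab_exp T)%MM.
Proof. by rewrite /tab_exp big_cons. Qed.

Lemma row_le_head L T M : sorted (@row_le n) (L :: T) -> M \in L :: T ->
  M = L \/ row_le L M.
Proof.
move=> /= /(order_path_min (@row_le_trans n))/allP h.
by rewrite inE => /predU1P[|/h]; [left|right].
Qed.

(* The first row of a standard tableau collects the least entries of its
   columns, so it can be read off the exponents. *)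
Lemma tab_exp_head L T L' T' : all (@std_row n) (L :: T) ->
  sorted (@row_le n) (L :: T) -> all (@std_row n) (L' :: T') ->
  sorted (@row_le n) (L' :: T') -> tab_exp (L :: T) = tab_exp (L' :: T') ->
  forall k i, k < size L -> k < size L' /\ nth i L' k <= nth i L k.
Proof.
move=> sT lT sT' lT' e k i kL.
have kn : k < n by apply: leq_trans kL (size_std_row (allP sT L (mem_head _ _))).
have := congr1 (fun m : 'X_{1..NV} => m (yvar k (nth i L k))) e.
rewrite !tab_expE // [in LHS]/= kL (set_nth_default i) // eqxx => h.
have /hasP[M MT /andP[kM /eqP eM]] :
    has (fun M => (k < size M) && (nth (nth i L k) M k == nth i L k)) (L' :: T').
  by rewrite has_count -h.
have eM' : nth i M k = nth i L k by rewrite -eM; apply: set_nth_default.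
have [<-|/row_leP/(_ k i kM)] := row_le_head lT' MT; first by rewrite eM'.
by rewrite eM'.
Qed.

Lemma basis_tab_behead L T : basis_tab (L :: T) -> basis_tab T.
Proof.
case/andP=> /and3P[_ /andP[_ sT] /path_sorted lT].
by rewrite inE negb_or /basis_tab row_le_tableau // => /andP[].
Qed.

Lemma tab_exp_neq0 L T : basis_tab (L :: T) -> tab_exp (L :: T) <> 0%MM.
Proof.
case/andP=> _; rewrite inE negb_or eq_sym => /andP[nL _].
rewrite tab_exp_cons => /(congr1 (@mdeg _)).
rewrite mdegD mdeg_word_exp ?size_iota // mdeg0 => /eqP.
by rewrite addn_eq0 size_eq0 (negPf nL).
Qed.

Lemma tab_exp_inj T T' : basis_tab T -> basis_tab T' ->
  tab_exp T = tab_exp T' -> T = T'.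
Proof.
elim: T T' => [|L T IH] [|L' T'] // bT bT' e.
- by case: (tab_exp_neq0 bT'); rewrite -e /tab_exp big_nil.
- by case: (tab_exp_neq0 bT); rewrite e /tab_exp big_nil.
suff eL : L = L'.
  rewrite -eL; congr (_ :: _); apply: IH.
  - exact: basis_tab_behead bT.
  - exact: basis_tab_behead bT'.
  by move: e; rewrite !tab_exp_cons eL => /addmI.
move: bT bT' => /andP[/and3P[_ sT lT] nT] /andP[/and3P[_ sT' lT'] nT'].
have h := tab_exp_head sT lT sT' lT' e.
have h' := tab_exp_head sT' lT' sT lT (esym e).
case: L => [|i L0] in sT lT nT e h h' *; first by rewrite mem_head in nT.
set L := i :: L0 in sT lT nT e h h' *.
have sz : size L = size L'.
  apply/anti_leq/andP; split; rewrite leqNgt; apply/negP => lt.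
    by have [] := h _ i lt; rewrite ltnn.
  by have [] := h' _ i lt; rewrite ltnn.
apply: (@eq_from_nth _ i) => // k kL; apply/val_inj/anti_leq/andP; split.
  by have [] := h' k i; rewrite -?sz.
by have [] := h k i.
Qed.

End Exponents.

Lemma eq_in_del_sumf (T : eqType) (A : comNzRingType) (f g : T -> A) (s : seq T)
    (phi : seq T -> A) : {in s, f =1 g} -> del_sum f s phi = del_sum g s phi.
Proof.
elim: s phi => //= b s IH phi e; rewrite e ?mem_head // IH // => c cs.
by apply: e; rewrite inE cs orbT.
Qed.

(** * The substitution and its leading terms *)

Section Specialization.
Variables (R : comNzRingType) (n : nat).
Implicit Types (L s : seq 'I_n) (T : seq (seq 'I_n)).
Local Notation NV := (n * n).+1.
Local Notation C := {mpoly R[NV]}.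

Definition sign_form (A : comNzRingType) (a b : 'I_n) : A :=
  ((a < b)%N)%:R - ((b < a)%N)%:R.

Lemma sign_formC (A : comNzRingType) a b : sign_form A a b = - sign_form A b a.
Proof. by rewrite /sign_form opprB. Qed.

Lemma sign_form0 (A : comNzRingType) a : sign_form A a a = 0.
Proof. by rewrite /sign_form subrr. Qed.

(** On an increasing row the first line is constantly 1, that is, equal to y; so the contraction is
    given by [del_sum_rowpf_y], and it is nonzero exactly when the y-term is absent. *)
Lemma rowpf_sign_form (A : comNzRingType) s :
  std_row s -> rowpf (sign_form A) (fun=> 1) s = 1.
Proof.
elim: s => // a s IH; rewrite std_row_cons => /andP[/allP as_ ss].
rewrite rowpf_cons (@eq_in_del_sumf _ _ _ (fun=> 1)); last first.
  move=> b /as_ ab; rewrite /sign_form ab ltnNge (ltnW ab) subr0 //.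
rewrite del_sum_rowpf_y IH //.
by case: odd => /=; ring.
Qed.

Definition specY (a i : 'I_n) : C := 'X_(yvar a i).

Definition spec_entry (p q : 'I_n.+1) : C :=
  match insub (val p) : option 'I_n, insub (val q) : option 'I_n with
  | Some i, Some j => bilin_form specY (sign_form C) i j
  | Some i, None => lin_form specY (fun=> 1) i
  | _, _ => 0
  end.

(* The substitution x_ij = \sum_(a < b) (y_ai y_bj - y_bi y_aj),
   x_{i,n+1} = \sum_a y_ai. *)
Definition spec (p : {mpoly R[nvars n.+1]}) : C :=
  mmap (@mpolyC _ R)
    (fun v => let ij := val (enum_val v : upair n.+1) in spec_entry ij.1 ij.2) p.

Lemma spec_comb (U : Type) (r : seq U) (c : U -> R)
    (F : U -> {mpoly R[nvars n.+1]}) :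
  spec (\sum_(u <- r) c u *: F u) = \sum_(u <- r) c u *: spec (F u).
Proof.
rewrite /spec raddf_sum; apply: eq_bigr => u _ /=.
by rewrite mmapZ mul_mpolyC.
Qed.

Lemma bilin_specE i j : bilin_form specY (sign_form C) i j
  = \sum_a \sum_b specY a i * specY b j * ((a < b)%N)%:R
    - \sum_a \sum_b specY a j * specY b i * ((a < b)%N)%:R.
Proof.
rewrite [X in _ = _ - X]exchange_big -sumrB; apply: eq_bigr => a _ /=.
rewrite mulr_sumr -sumrB; apply: eq_bigr => b _.
by rewrite /sign_form; ring.
Qed.

Lemma spec_gen (i j : 'I_n.+1) : (i < j)%N -> spec (gen_mx R n.+1 i j) = spec_entry i j.
Proof.
move=> ij; rewrite /spec mxE /xvar insubT insubF ?subr0 /=; last first.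
  by rewrite ltnNge ltnW.
by rewrite mmapX mmap1U enum_rankK.
Qed.

Lemma spec_genX a b : spec (genX R a b) = bilin_form specY (sign_form C) a b.
Proof.
have [ab|ba|/ord_inj <-] := ltngtP a b.
- by rewrite /genX spec_gen // /spec_entry /= !valK.
- rewrite /spec [genX R a b]gen_mxC raddfN /= -/(spec _) spec_gen //.
  by rewrite /spec_entry /= !valK !bilin_specE opprB.
by rewrite /spec [genX R a a]gen_mx0 raddf0 bilin_specE subrr.
Qed.

Lemma spec_geny a : spec (geny R a) = lin_form specY (fun=> 1) a.
Proof.
rewrite /geny spec_gen; last exact: (ltn_ord a).
by rewrite /spec_entry /= valK insubF ?ltnn.
Qed.

Lemma spec_pf L : spec (pf R L)
  = \sum_(s <- words n (size L))
      (rowpf (sign_form R) (fun=> 1) s) *: 'X_[word_exp L (map val s)].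
Proof.
rewrite pfE /spec rowpf_rmorph.
rewrite (eq_rowpf _ (X' := bilin_form specY (sign_form C))
   (y' := lin_form specY (fun=> 1))) => [|a b|a]; first last.
- exact: spec_geny.
- exact: spec_genX.
rewrite rowpf_multilin multilin_words !big_seq; apply: eq_bigr => s.
rewrite mem_words => /eqP ss.
rewrite (eq_rowpf s (X' := fun a b => (sign_form R a b)%:MP_[NV])
   (y' := (@mpolyC _ R) \o (fun=> 1))) => [|a b|a]; first last.
- by rewrite /= mpolyC1.
- by rewrite /sign_form mpolyCB !mpolyC_nat.
rewrite -rowpf_rmorph /= mulrC mul_mpolyC; congr (_ *: _).
elim: L s ss => [|i L IH] [|a s] //=; first by rewrite mpolyX0.
by move=> [ss]; rewrite IH // mpolyXD.
Qed.

(** Words with a repeated letter drop out by alternation, and all others except 0, 1, 2, ... have a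
    smaller exponent by [word_exp_lt]. *)
Lemma spec_pf_coef L m : std_row L ->
  (word_exp L (iota 0 (size L)) <= m)%O ->
  (spec (pf R L))@_m = (word_exp L (iota 0 (size L)) == m)%:R.
Proof.
move=> sL le; rewrite spec_pf raddf_sum /=.
pose s0 := take (size L) (enum 'I_n).
have s0E : map val s0 = iota 0 (size L).
  by rewrite map_take val_enum_ord take_iota (minn_idPl (size_std_row sL)).
have ss0 : size s0 = size L by rewrite -(size_map val) s0E size_iota.
have std0 : std_row s0 by rewrite /std_row s0E iota_ltn_sorted.
rewrite (bigD1_seq s0) ?words_uniq ?mem_words ?ss0 //=.
rewrite mcoeffZ mcoeffX s0E rowpf_sign_form // mul1r.
rewrite big_seq_cond big1 ?addr0 // => s; rewrite mem_words.
move=> /andP[/eqP ss ns]; rewrite mcoeffZ mcoeffX.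
have [us|nus] := boolP (uniq s); last first.
  rewrite (alternating_nuniq (rowpf_alternating _ _ _) nus) ?mul0r //.
    exact: sign_formC.
  exact: sign_form0.
have lt : (word_exp L (map val s) < word_exp L (iota 0 (size L)))%O.
  apply: word_exp_lt => //.
  - by rewrite size_map.
  - exact: size_std_row.
  - by rewrite map_inj_uniq //; apply: val_inj.
  - by apply/allP => _ /mapP[a _ ->] /=.
  by apply: contra ns => /eqP e; apply/eqP/(inj_map val_inj); rewrite e s0E.
by rewrite (lt_eqF (lt_le_trans lt le)) mulr0.
Qed.

Lemma mlead_unique (k : nat) (p : {mpoly R[k]}) m :
  (forall m', (m <= m')%O -> p@_m' = (m == m')%:R) -> mlead p = m.
Proof.
move=> h; have pm : m \in msupp p by rewrite mcoeff_msupp h ?lexx // eqxx oner_eq0.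
have p0 : p != 0 by apply: contraTneq pm => ->; rewrite msupp0.
have := mlead_supp p0; rewrite mcoeff_msupp h ?msupp_le_mlead //.
by case: (m =P mlead p) => [<- //|_]; rewrite mulr0n eqxx.
Qed.

Lemma mlead_spec_pf L : std_row L ->
  mlead (spec (pf R L)) = word_exp L (iota 0 (size L)) /\
  (spec (pf R L))@_(mlead (spec (pf R L))) = 1.
Proof.
move=> sL; have e := mlead_unique (fun m => @spec_pf_coef L m sL).
by rewrite e spec_pf_coef // eqxx.
Qed.

(** Leading coefficients equal to 1 make leading monomials multiplicative over any R. *)
Lemma mlead_spec_tab T : all (@std_row n) T ->
  mlead (spec (pf_tab R T)) = tab_exp T /\
  (spec (pf_tab R T))@_(tab_exp T) = 1.
Proof.
move=> sT; have -> : spec (pf_tab R T) = \prod_(L <- T) spec (pf R L).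
  by rewrite /spec rmorph_prod.
elim: T sT => [|L T IH] /=.
  by rewrite big_nil /tab_exp big_nil mlead1 mcoeff1 eqxx.
move=> /andP[/mlead_spec_pf[eL cL] /IH[eT cT]].
rewrite big_cons tab_exp_cons -eL -{1}eT -mleadM_proper; last first.
  by rewrite cL eT cT mulr1 oner_eq0.
by split=> //; rewrite -{1}eT mleadcM eT cL cT mulr1.
Qed.

Lemma seq_max_exists (U : eqType) d (O : orderType d) (f : U -> O) (s : seq U) u :
  u \in s -> exists2 v, v \in s & forall w, w \in s -> (f w <= f v)%O.
Proof.
elim: s u => // a [|b s] IH u _.
  by exists a; rewrite ?mem_head // => w; rewrite inE => /eqP ->.
have [v vs mv] := IH b (mem_head _ _).
have [le|le] := leP (f a) (f v).
  exists v; first by rewrite inE vs orbT.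
  by move=> w; rewrite inE => /predU1P[->|/mv].
exists a; first exact: mem_head.
move=> w; rewrite inE => /predU1P[->//|/mv lw].
exact: le_trans lw (ltW le).
Qed.

Lemma pf_tab_free (s : seq (seq (seq 'I_n))) (c : seq (seq 'I_n) -> R) :
  uniq s -> all (@basis_tab n) s ->
  \sum_(T <- s) c T *: pf_tab R T = 0 -> forall T, T \in s -> c T = 0.
Proof.
move=> us bs s0 T Ts; apply/eqP; apply: contraT => nc.
pose s' := [seq T <- s | c T != 0].
have Ts' : T \in s' by rewrite mem_filter nc.
(* Among the tableaux with nonzero coefficient, only T0 contributes at its own exponent, by
   injectivity of [tab_exp]. *)
have [T0 T0s' max0] := @seq_max_exists _ _ _ (@tab_exp n) s' T Ts'.
move: T0s'; rewrite mem_filter => /andP[nc0 T0s].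
have bT U : U \in s -> basis_tab U by move=> Us; apply: (allP bs).
have sT U : U \in s -> all (@std_row n) U.
  by move=> /bT/andP[/and3P[]].
have := congr1 (fun p => (spec p)@_(tab_exp T0)) s0.
rewrite spec_comb [in RHS]/spec mmap0 mcoeff0 raddf_sum /=.
rewrite (bigD1_seq T0) //= mcoeffZ.
have [_ ->] := mlead_spec_tab (sT _ T0s).
rewrite mulr1 big_seq_cond big1 ?addr0 => [c0|U /andP[Us nU]].
  by rewrite c0 eqxx in nc0.
rewrite mcoeffZ.
have [->|ncU] := eqVneq (c U) 0; first by rewrite mul0r.
rewrite mcoeff_gt_mlead ?mulr0 //; have [-> _] := mlead_spec_tab (sT _ Us).
rewrite lt_neqAle max0 ?mem_filter ?ncU // andbT.
by apply: contra nU => /eqP/(tab_exp_inj (bT _ Us) (bT _ T0s)) ->.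
Qed.

End Specialization.

(** * Relations among the pfaffians *)

Section Generators.
Variables (R : comNzRingType) (n : nat).
Implicit Types (I J L M : seq 'I_n) (T : seq (seq 'I_n)).
Local Notation Rt := {mpoly R[ntvars n]}.

Lemma nsrow_seq_inj : injective (@nsrow_seq n).
Proof. by move=> u v /val_inj/val_inj. Qed.

Lemma tvar_nsrow (u : nsrow n) : tvar R (nsrow_seq u) = 'X_(enum_rank u).
Proof.
rewrite /tvar; case: pickP => [v /eqP/nsrow_seq_inj -> //|/(_ u)].
by rewrite eqxx.
Qed.

Lemma nsrowP L : std_row L -> L != [::] -> exists u : nsrow n, nsrow_seq u = L.
Proof.
move=> sL nL; have P : std_row (insub_bseq n L) && (val (insub_bseq n L) != [::]).
  by rewrite -[bseqval _]/(val _) insub_bseq_std // sL nL.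
by exists (Sub (insub_bseq n L) P); rewrite /nsrow_seq SubK insub_bseq_std.
Qed.

Lemma nsrow_std (u : nsrow n) : std_row (nsrow_seq u) && (nsrow_seq u != [::]).
Proof. exact: valP u. Qed.

Lemma row_var_nsrow (u : nsrow n) : row_var R (nsrow_seq u) = 'X_(enum_rank u).
Proof.
by rewrite -tvar_nsrow /row_var; case: (nsrow_seq u) (nsrow_std u).
Qed.

Lemma pf_nil : pf R ([::] : seq 'I_n) = 1.
Proof. by rewrite pfE rowpf_nil. Qed.

Lemma pi_row_var L : std_row L -> pi_pf (row_var R L) = pf R L.
Proof.
move=> sL; have [->|nL] := eqVneq L [::].
  by rewrite pf_nil; apply: rmorph1.
have [u <-] := nsrowP sL nL.
by rewrite row_var_nsrow /pi_pf comp_mpolyXU -tnth_nth tnth_mktuple enum_rankK.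
Qed.

Lemma pi_tab_mon T : all (@std_row n) T -> pi_pf (tab_mon R T) = pf_tab R T.
Proof.
move=> /allP sT; rewrite /pi_pf rmorph_prod /= /pf_tab !big_seq.
by apply: eq_bigr => L /sT/pi_row_var.
Qed.

Lemma pi_t_subst L : pi_pf (t_subst R L) = pf R L.
Proof.
rewrite t_substE /pi_pf rmorphM rmorph_int /= -/(pi_pf _).
have := alternating_sort (@pf_alternating n R) [::] [::] L; rewrite !cats0 /= => ->.
have [uL|/eps_nuniq ->] := boolP (uniq L); last by rewrite mulr0z !mul0r.
by rewrite pi_row_var // std_row_sort.
Qed.

Lemma pi_theta L M : nonstd2 L M -> pi_pf (theta (t_subst R (n := n)) L M) = 0.
Proof.
move=> nLM; rewrite -[RHS](theta_pf R nLM) /pi_pf theta_rmorph.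
by rewrite /theta; apply: eq_theta_canon => s; apply: pi_t_subst.
Qed.

Lemma msize_row_var L : (msize (row_var R L) <= 2)%N.
Proof.
rewrite /row_var; case: L => [|a L]; first by rewrite msize1.
by rewrite /tvar; case: pickP => [u _|_]; rewrite ?msizeX ?mdeg1 // msize0.
Qed.

(** [msize] exceeds the degree by one, so 3 means degree at most 2. *)
Lemma msize_theta L M : nonstd2 L M ->
  (msize (theta (t_subst R (n := n)) L M) <= 3)%N.
Proof.
move=> nLM; have [s [_ ->]] := theta_lead R nLM.
have prod (A B : seq 'I_n) : (msize (row_var R A * row_var R B) <= 3)%N.
  have [->|nz] := eqVneq (row_var R A * row_var R B) 0; first by rewrite msize0.
  have nA : row_var R A != 0 by apply: contraNneq nz => ->; rewrite mul0r.
  have nB : row_var R B != 0 by apply: contraNneq nz => ->; rewrite mulr0.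
  have := msize_row_var A; have := msize_row_var B.
  rewrite -!mlead_deg // !ltnS => dB dA.
  apply: leq_trans (lemc_mdeg (mleadM_le _ _)) _.
  by rewrite mdegD -[2%N]/(1 + 1)%N leq_add.
apply: leq_trans (msizeD_le _ _) _; rewrite geq_max prod /=.
apply: leq_trans (msize_sum _ _ _) _; apply/bigmax_leqP_seq => a _ _.
rewrite -[_%:~R](rmorph_int (@mpolyC _ R)) mul_mpolyC.
exact: leq_trans (msizeZ_le _ _) (prod _ _).
Qed.

Definition mon_tab (m : 'X_{1..ntvars n}) : seq (seq 'I_n) :=
  flatten [seq nseq (m k) (nsrow_seq (enum_val k)) | k <- enum 'I_(ntvars n)].

Lemma mon_tab_std m : all (@std_row n) (mon_tab m).
Proof.
rewrite /mon_tab; apply/allP => L /flatten_mapP[k _ /nseqP[-> _]].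
by have /andP[] := nsrow_std (enum_val k).
Qed.

Lemma mon_tabE m : tab_mon R (mon_tab m) = 'X_[m].
Proof.
rewrite mpolyXE_id /tab_mon big_flatten /= big_map big_enum /=.
apply: eq_bigr => k _; rewrite big_nseq row_var_nsrow enum_valK.
by rewrite -Monoid.iteropE.
Qed.

Lemma size_mon_tab m : size (mon_tab m) = mdeg m.
Proof.
rewrite size_flatten /shape -map_comp mdegE sumnE big_map big_enum /=.
by apply: eq_bigr => k _; rewrite size_nseq.
Qed.

(** The variables are themselves pfaffians: x_ij of the row ij, and x_{i,n+1} of the row i. *)
Lemma pi_surjective (b : {mpoly R[nvars n.+1]}) : exists p : Rt, pi_pf p = b.
Proof.
have gen (v : 'I_(nvars n.+1)) : exists p : Rt, pi_pf p = 'X_v.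
  have vE : 'X_v = gen_mx R n.+1 (val (enum_val v)).1 (val (enum_val v)).2.
    have ij := valP (enum_val v).
    rewrite mxE /xvar -surjective_pairing valK insubF ?subr0 ?enum_valK //.
    by rewrite /= ltnNge ltnW.
  have := valP (enum_val v); rewrite vE; case: (val (enum_val v)) => i j /= ij.
  have i_n : (i < n)%N by apply: leq_trans ij _; rewrite -ltnS.
  pose i' := Ordinal i_n; have iE : i = widen_ord (leqnSn n) i' by apply: val_inj.
  have [jn|jn] := ltnP j n.
    pose j' := Ordinal jn.
    have jE : j = widen_ord (leqnSn n) j' by apply: val_inj.
    exists (row_var R [:: i'; j']); rewrite pi_row_var; last by rewrite /std_row /= andbT.
    by rewrite pfE !rowpf_cons !rowpf_nil /= iE jE /genX; ring.
  have jE : j = ord_max by apply/val_inj/anti_leq; rewrite jn -ltnS ltn_ord.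
  exists (row_var R [:: i']); rewrite pi_row_var //.
  by rewrite pfE !rowpf_cons !rowpf_nil /= iE jE /geny; ring.
elim/mpolyind: b => [|c m p _ _ [q <-]]; first by exists 0; apply: raddf0.
have [r rE] : exists r : Rt, pi_pf r = 'X_[m].
  rewrite mpolyXE_id; elim: (index_enum _) => [|k r [q' IH]].
    by exists 1; rewrite big_nil; apply: rmorph1.
  have [pk pkE] := gen k; exists (pk ^+ m k * q').
  by rewrite big_cons -IH -pkE /pi_pf rmorphM rmorphXn.
exists (c *: r + q); rewrite /pi_pf raddfD /= comp_mpolyZ -/(pi_pf _) rE.
by rewrite addrC.
Qed.

End Generators.

Lemma comb_undup (R : comNzRingType) (V : lmodType R) (U : eqType) (F : U -> V)
    (s : seq (R * U)) :
  \sum_(a <- s) a.1 *: F a.2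
  = \sum_(u <- undup (map snd s)) (\sum_(a <- s | a.2 == u) a.1) *: F u.
Proof.
under [RHS]eq_bigr do rewrite scaler_suml big_mkcond.
rewrite exchange_big /= [LHS]big_seq [RHS]big_seq.
apply: eq_bigr => a as_; rewrite (bigD1_seq a.2) ?undup_uniq //=; last first.
  by rewrite mem_undup map_f.
rewrite eqxx big1 ?addr0 // => u /negPf nu.
by rewrite eq_sym nu.
Qed.

Section Spans.
Variables (R : comNzRingType) (n : nat).
Local Notation Rt := {mpoly R[ntvars n]}.

(** The standard combination congruent to p is mapped to 0 by pi, so [pf_tab_free] annihilates its
    coefficients and p itself is left in N. *)
Lemma straight_kernel (N : Rt -> Prop) (p : Rt) :
  (forall q, N q -> pi_pf q = 0) -> straight N p -> pi_pf p = 0 -> N p.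
Proof.
move=> Npi [s [bs Ns]] p0.
have bT T : T \in undup (map snd s) -> basis_tab T.
  by rewrite mem_undup => /mapP[a as_ ->]; apply: (allP bs).
have : pi_pf (p - \sum_(a <- s) a.1 *: tab_mon R a.2) = 0 by apply: Npi.
rewrite /pi_pf raddfB /= -/(pi_pf p) p0 sub0r comb_undup => /eqP.
rewrite oppr_eq0 raddf_sum big_seq => /eqP e.
have e' : \sum_(T <- undup (map snd s))
    (\sum_(a <- s | a.2 == T) a.1) *: pf_tab R T = 0.
  rewrite big_seq -[RHS]e; apply: eq_bigr => T /bT/andP[/and3P[_ sT _] _] /=.
  by rewrite comp_mpolyZ -pi_tab_mon.
have c0 := pf_tab_free (undup_uniq _) (introT allP bT) e'.
suff z : \sum_(a <- s) a.1 *: tab_mon R a.2 = 0 by move: Ns; rewrite z subr0.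
by rewrite comb_undup big_seq big1 // => T /c0 ->; rewrite scale0r.
Qed.

Lemma in_ideal_pi (p : Rt) :
  in_ideal (fun g : Rt => pi_pf g = 0 /\ (msize g <= 3)%N) p -> pi_pf p = 0.
Proof.
move=> [s [hs ->]]; rewrite /pi_pf rmorph_sum big_seq big1 // => a /hs[a0 _].
by rewrite rmorphM /= -/(pi_pf a.2) a0 mulr0.
Qed.

Lemma in_span_theta (p : Rt) :
  in_span (fun g => exists L M : seq 'I_n,
             nonstd2 L M /\ g = theta (t_subst R (n := n)) L M) p ->
  pi_pf p = 0 /\ (msize p <= 3)%N.
Proof.
move=> [s [hs ->]]; split.
  rewrite /pi_pf raddf_sum big_seq big1 // => a /hs[L [M [nLM e]]] /=.
  by rewrite comp_mpolyZ -/(pi_pf a.2) e pi_theta // scaler0.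
apply: leq_trans (msize_sum _ _ _) _; apply/bigmax_leqP_seq => a /hs.
move=> [L [M [nLM e]]] _.
by apply: leq_trans (msizeZ_le _ _) _; rewrite e msize_theta.
Qed.

Lemma straight_ideal (p : Rt) :
  straight (in_ideal (fun g : Rt => pi_pf g = 0 /\ (msize g <= 3)%N)) p.
Proof.
set N := in_ideal _.
have N0 : N 0 by exists [::]; rewrite big_nil.
have ND q q' : N q -> N q' -> N (q + q').
  move=> [s [hs ->]] [t [ht ->]]; exists (s ++ t); rewrite big_cat; split=> // a.
  by rewrite mem_cat => /orP[/hs|/ht].
have NZ c q : N q -> N (c *: q).
  move=> [s [hs ->]]; exists [seq (c *: a.1, a.2) | a <- s]; split.
    by move=> _ /mapP[a /hs ha ->].
  by rewrite big_map scaler_sumr; apply: eq_bigr => a _; rewrite scalerAl.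
rewrite (mpolyE p); apply: straight_sum => // m _; apply: straightZ => //.
rewrite -mon_tabE; apply: straighten (mon_tab_std m) (erefl _) => // T1 T2 L M nLM _.
exists [:: (tab_mon R T1 * tab_mon R T2, theta (t_subst R (n := n)) L M)].
rewrite big_seq1 /= mulrCA [RHS]mulrC; split; last by rewrite mulrCA.
by move=> a; rewrite inE => /eqP ->; rewrite pi_theta ?msize_theta.
Qed.

Lemma straight_span (p : Rt) : (msize p <= 3)%N ->
  straight (in_span (fun g => exists L M : seq 'I_n,
             nonstd2 L M /\ g = theta (t_subst R (n := n)) L M)) p.
Proof.
set N := in_span _ => sp.
have N0 : N 0 by exists [::]; rewrite big_nil.
have ND q q' : N q -> N q' -> N (q + q').
  move=> [s [hs ->]] [t [ht ->]]; exists (s ++ t); rewrite big_cat; split=> // a.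
  by rewrite mem_cat => /orP[/hs|/ht].
have NZ c q : N q -> N (c *: q).
  move=> [s [hs ->]]; exists [seq (c * a.1, a.2) | a <- s]; split.
    by move=> _ /mapP[a /hs ha ->].
  by rewrite big_map scaler_sumr; apply: eq_bigr => a _; rewrite scalerA.
rewrite (mpolyE p); apply: straight_sum => // m mp; apply: straightZ => //.
have dm : (mdeg m <= 2)%N by have := msize_mdeg_lt mp; lia.
(* Padding with empty rows to exactly two rows leaves no room for T1 and T2, so the span is enough
   and no multiples of relations are needed. *)
pose T := mon_tab m ++ nseq (2 - mdeg m) [::].
have -> : 'X_[m] = tab_mon R T.
  rewrite tab_mon_cat mon_tabE -[LHS]mulr1; congr (_ * _).
  by rewrite /tab_mon big_nseq; elim: (2 - _)%N => //= k <-; rewrite mul1r.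
have sT : all (@std_row n) T by rewrite all_cat mon_tab_std all_nseq orbT.
have szT : size T = 2 by rewrite size_cat size_mon_tab size_nseq subnKC.
apply: (@straighten _ _ N N0 ND NZ 2 _ T sT szT).
move=> T1 T2 L M nLM s2.
have [-> ->] : T1 = [::] /\ T2 = [::].
  by case: T1 T2 s2 => [|? ?] [|? ?] //=; rewrite ?addnS.
  exists [:: (1, theta (t_subst R (n := n)) L M)].
  rewrite big_seq1 scale1r /tab_mon big_nil mul1r mulr1; split=> // a.
  by rewrite inE => /eqP ->; exists L, M.
Qed.

End Spans.

Theorem theorem17 (R : comNzRingType) (n : nat) (n_gt0 : (0 < n)%N) :
  [/\ (* (1) *)
      is_family_basis
        (fun T : seq (seq 'I_n) => std_tableau T && ([::] \notin T))
        (pf_tab R (n := n)),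
      (* (2) *)
      (forall b : {mpoly R[nvars n.+1]}, exists p, pi_pf (n := n) p = b) /\
      (forall p : {mpoly R[ntvars n]},
         pi_pf p = 0 <->
         in_ideal (fun g => pi_pf g = 0 /\ (msize g <= 3)%N) p)
    & (* (3) *)
      (forall L M : seq 'I_n, nonstd2 L M -> theta (pf R (n := n)) L M = 0) /\
      (forall p : {mpoly R[ntvars n]},
         (pi_pf p = 0 /\ (msize p <= 3)%N) <->
         in_span (fun g => exists L M : seq 'I_n,
                    nonstd2 L M /\ g = theta (t_subst R (n := n)) L M) p)].
Proof.
split.
- split=> [b|s c us bs]; last exact: pf_tab_free.
  (* Any preimage p of b will do: straightening changes it by an element of the kernel only. *)
  have [p <-] := pi_surjective b; have [s [bs Ns]] := straight_ideal p.
  have bT T : T \in undup (map snd s) -> basis_tab T.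
    by rewrite mem_undup => /mapP[a as_ ->]; apply: (allP bs).
  exists (undup (map snd s)), (fun T => \sum_(a <- s | a.2 == T) a.1).
  split; [exact: undup_uniq|exact/allP|].
  have := in_ideal_pi Ns; rewrite /pi_pf raddfB /= => /eqP.
  rewrite subr_eq0 => /eqP ->; rewrite comb_undup raddf_sum !big_seq.
  apply: eq_bigr => T /bT/andP[/and3P[_ sT _] _] /=.
  by rewrite comp_mpolyZ -pi_tab_mon.
- split=> [|p]; first exact: pi_surjective.
  split=> [|/in_ideal_pi //].
  by apply: straight_kernel (straight_ideal p); apply: in_ideal_pi.
split=> [L M|p]; first exact: theta_pf.
split=> [[p0 sp]|/in_span_theta //].
by apply: straight_kernel (straight_span sp) p0 => q /in_span_theta[].
Qed.
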